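(* Let $k \geq 92$ be an integer with $k\equiv 0\pmod 4$, and let $f = 1 + \sum_{n=1}^{\infty} a(n) q^{n} \in M_{k}$ with $a(n) \geq 0$ for all positive integers $n \leq k^{2} (\log k + \log \log k)^{2}$. Then $a(n) > 0$ for all $n \geq \frac{1}{7316} k^{4} (\log k + \log \log k)^{2}$.
   Context: $M_k$ is the space of holomorphic modular forms of weight $k$ for $\mathrm{SL}_2(\mathbb{Z})$, with Fourier expansion in $q=e^{2\pi i z}$. *)

(* Defs.v *)
From HB Require Import structures.
From mathcomp Require Import all_boot all_order all_algebra.
From mathcomp Require Import all_classical all_reals all_analysis.
From mathcomp.real_closed Require Import complex.
Set Implicit Arguments. Unset Strict Implicit. Unset Printing Implicit Defensive.
Import Order.TTheory GRing.Theory Num.Theory.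
Import numFieldNormedType.Exports.
Local Open Scope ring_scope.
Local Open Scope complex_scope.
Local Open Scope classical_set_scope.
Local Open Scope ring_scope.

Section ModForms.
Variable R : realType.

(* q^n = e^{2 pi i n z} = e^{-2 pi n Im z} (cos(2 pi n Re z) + i sin(2 pi n Re z)) *)
Definition qpow (n : nat) (z : R[i]) : R[i] :=
  let t := 2 * pi * n%:R in
  ((expR (- t * complex.Im z) * cos (t * complex.Re z)) +i* (expR (- t * complex.Im z) * sin (t * complex.Re z))).

Definition cseries_to (u : nat -> R[i]) (l : R[i]) : Prop :=
  let sre : R^nat := fun N => complex.Re (\sum_(0 <= n < N) u n) in
  let sim : R^nat := fun N => complex.Im (\sum_(0 <= n < N) u n) in
  (sre @ \oo --> (complex.Re l : R)) /\ (sim @ \oo --> (complex.Im l : R)).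

Definition upper (z : R[i]) : Prop := 0 < complex.Im z.

Definition has_qexp (f : R[i] -> R[i]) (a : nat -> R[i]) : Prop :=
  forall z, upper z -> cseries_to (fun n => a n * qpow n z) (f z).

(* holomorphic modular forms of weight k for SL_2(Z): functions on H with a
   q-expansion (equivalently: holomorphic, 1-periodic, holomorphic at
   infinity) satisfying f(-1/z) = z^k f(z). *)
Definition modular_form (k : nat) (f : R[i] -> R[i]) : Prop :=
  (exists a, has_qexp f a) /\
  (forall z, upper z -> f (- z^-1) = z ^+ k * f z).

End ModForms.

(* Main.v *)
(* Write L = log k + log log k and Y = kL/2pi. Since 4 | k, f(i/Y) = Y^k f(iY),
   that is, sum_n a(n) w(n) = 0 with w(n) = e^{-2 pi n/Y} - Y^k e^{-2 pi nY}; the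
   choice of Y makes w(0) = 1 - Y^k while w(n) is positive and comparable to
   e^{-2 pi n/Y} for every n >= 1. So nonnegativity of the coefficients forces
   sum_n a(n) e^{-2 pi n/Y} = O(Y^k). The same holds for the coefficients e(n) of
   the power E_4^{k/4}, hence for those of the cusp form g = f - E_4^{k/4}.
   Bounding Im(z)^{k/2} |g(z)| on Im z >= 1/2 (which meets every orbit) by this
   sum, Hecke's argument gives |a(n) - e(n)| = O(Y^k n^{k/2}); in particular the
   coefficients with n > k^2 L^2 = (2 pi Y)^2, of unknown sign, are negligible in
   the sum above. The same tail estimate applied to f - conj f shows that all the
   a(n) are real. Finally sigma_3(n) >= n^3 gives
   e(n) >= c^{k/4} binomial(n + k/2 - 1, k - 1) with c close to (2 pi)^4, which
   exceeds the error as soon as n >= k^4 L^2 / 7316.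
   The modularity of E_4 comes from square partial sums of its lattice series;
   the rows are evaluated by the Lipschitz formula, a limit of the identity
   sum_{j mod Q} psi((z + j)/Q) = Q^4 psi(z) for psi = sum_r r^3 q^r. *)
Require Import Defs.
From HB Require Import structures.
From mathcomp Require Import all_boot all_order all_algebra.
From mathcomp Require Import all_classical all_reals all_analysis.
From mathcomp.real_closed Require Import complex.
From mathcomp Require Import ring lra zify.
Import Order.TTheory GRing.Theory Num.Theory.
Local Open Scope ring_scope.
Set Implicit Arguments. Unset Strict Implicit. Unset Printing Implicit Defensive.
Import numFieldNormedType.Exports.
Local Open Scope complex_scope.
Local Open Scope ring_scope.

(** * Limits of complex sequences *)

Section Modulus.
Variable R : realType.
Implicit Types z w : R[i].

(** The tail estimate is self-referential: Hecke's bound for b(n) = a(n) - e(n) carries as a factor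
    B, the sum of all |b(n)| e^{-2 pi n/Y}. Past T = k^2 L^2 the exponential is below e^{-4 pi^2
    kL}, while the powers n^{k/2} cost only a small multiple of kL in the exponent, so the tail is a
    small fraction of B. The outcome B <= B/20 + 4 Y^k can be solved for B because absolute
    convergence makes B finite beforehand. The second logarithm in L makes e^{2 pi Y} = e^{kL} = (k
    log k)^k, which beats Y^k; hence the positive weights. A power of E_4 is a convenient comparison
    form because its lower bound multiplies: c q^2/(1-q)^4 raised to the power k/4 again has
    binomial coefficients. Comparing c^{k/4} n^{k-1}/(k-1)! with Y^k n^{k/2} puts the crossing, for
    large k, near k^4 L^2 divided by e^2 (2 pi)^4 (250/271)^{1/2}, about 11000. The smaller 7316
    leaves room for the factors polynomial in k at k = 92, for pi >= 3.1 and for 26.58 in place of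
    e^4. *)

Definition cabs z : R := ComplexField.Normc.normc z.

Lemma cabsE z : cabs z = Num.sqrt (complex.Re z ^+ 2 + complex.Im z ^+ 2).
Proof. by case: z. Qed.

Lemma sqr_cabs z : cabs z ^+ 2 = complex.Re z ^+ 2 + complex.Im z ^+ 2.
Proof. by rewrite cabsE sqr_sqrtr // addr_ge0 ?sqr_ge0. Qed.

Lemma cabs_ge0 z : 0 <= cabs z. Proof. by rewrite cabsE sqrtr_ge0. Qed.

Lemma cabs0 : cabs 0 = 0. Proof. exact: ComplexField.Normc.normc0. Qed.
Lemma cabs1 : cabs 1 = 1. Proof. exact: ComplexField.Normc.normc1. Qed.
Lemma cabsM z w : cabs (z * w) = cabs z * cabs w.
Proof. exact: ComplexField.Normc.normcM. Qed.
Lemma cabsV z : cabs z^-1 = (cabs z)^-1.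
Proof. exact: ComplexField.Normc.normcV. Qed.
Lemma cabsD z w : cabs (z + w) <= cabs z + cabs w.
Proof. exact: le_normcD. Qed.
Lemma cabsN z : cabs (- z) = cabs z.
Proof. by rewrite !cabsE; case: z => a b /=; rewrite !sqrrN. Qed.
Lemma cabsBC z w : cabs (z - w) = cabs (w - z).
Proof. by rewrite -cabsN opprB. Qed.
Lemma cabsB z w : cabs (z - w) <= cabs z + cabs w.
Proof. by rewrite -(cabsN w) cabsD. Qed.
Lemma cabsX z n : cabs (z ^+ n) = cabs z ^+ n.
Proof. by elim: n => [|n IH]; rewrite ?expr0 ?cabs1 // !exprS cabsM IH. Qed.
Lemma cabs_eq0 z : (cabs z == 0) = (z == 0).
Proof.
apply/eqP/eqP => [|->]; last exact: cabs0.
exact: ComplexField.Normc.eq0_normc.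
Qed.
Lemma cabs_gt0 z : (0 < cabs z) = (z != 0).
Proof. by rewrite lt_neqAle cabs_ge0 andbT eq_sym cabs_eq0. Qed.
Lemma cabsC (x : R) : cabs x%:C = `|x|.
Proof. by rewrite cabsE /= expr0n /= addr0 sqrtr_sqr. Qed.
Lemma cabs_nat n : cabs n%:R = n%:R.
Proof.
have -> : n%:R = (n%:R : R)%:C :> R[i] by rewrite rmorph_nat.
by rewrite cabsC ger0_norm.
Qed.
Lemma cabsJ z : cabs (conjc z) = cabs z.
Proof. by rewrite !cabsE; case: z => a b /=; rewrite sqrrN. Qed.

Lemma norm_Re_le z : `|complex.Re z| <= cabs z.
Proof.
by rewrite cabsE -sqrtr_sqr ler_wsqrtr // lerDl sqr_ge0.
Qed.
Lemma norm_Im_le z : `|complex.Im z| <= cabs z.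
Proof.
by rewrite cabsE -sqrtr_sqr ler_wsqrtr // lerDr sqr_ge0.
Qed.
Lemma cabs_le_ReIm z : cabs z <= `|complex.Re z| + `|complex.Im z|.
Proof.
rewrite -(@ler_pXn2r _ 2) ?nnegrE ?cabs_ge0 ?addr_ge0 // sqr_cabs.
rewrite sqrrD !real_normK ?num_real // -addrA lerD2l lerDr.
by rewrite mulrn_wge0 // mulr_ge0.
Qed.

Lemma cabs_sum n (u : nat -> R[i]) :
  cabs (\sum_(j < n) u j) <= \sum_(j < n) cabs (u j).
Proof.
elim: n => [|n IH]; first by rewrite !big_ord0 cabs0.
by rewrite !big_ord_recr /= (le_trans (cabsD _ _)) // lerD2r.
Qed.

Lemma ReD z w : complex.Re (z + w) = complex.Re z + complex.Re w.
Proof. by case: z w => [a b] [c d]. Qed.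
Lemma ImD z w : complex.Im (z + w) = complex.Im z + complex.Im w.
Proof. by case: z w => [a b] [c d]. Qed.
Lemma ReB z w : complex.Re (z - w) = complex.Re z - complex.Re w.
Proof. by case: z w => [a b] [c d]. Qed.
Lemma ImB z w : complex.Im (z - w) = complex.Im z - complex.Im w.
Proof. by case: z w => [a b] [c d]. Qed.
Lemma ReM z w : complex.Re (z * w) =
  complex.Re z * complex.Re w - complex.Im z * complex.Im w.
Proof. by case: z w => [a b] [c d]. Qed.
Lemma ImM z w : complex.Im (z * w) =
  complex.Re z * complex.Im w + complex.Im z * complex.Re w.
Proof. by case: z w => [a b] [c d]. Qed.
Lemma Re_sum n (u : nat -> R[i]) :
  complex.Re (\sum_(j < n) u j) = \sum_(j < n) complex.Re (u j).
Proof.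
by elim: n => [|n IH]; rewrite ?big_ord0 // !big_ord_recr /= ReD IH.
Qed.
Lemma Im_sum n (u : nat -> R[i]) :
  complex.Im (\sum_(j < n) u j) = \sum_(j < n) complex.Im (u j).
Proof.
by elim: n => [|n IH]; rewrite ?big_ord0 // !big_ord_recr /= ImD IH.
Qed.
Lemma complex_eqP z w :
  complex.Re z = complex.Re w -> complex.Im z = complex.Im w -> z = w.
Proof. by case: z w => [a b] [c d] /= -> ->. Qed.

End Modulus.
Arguments cabs : simpl never.

(** * Null sequences, complex limits, bounded series *)

Section Limits.
Variable R : realType.
Implicit Types (u v : nat -> R) (s t : nat -> R[i]) (g : nat -> nat).

(** Every complex limit below is reduced through [cabs] to this epsilon form, so that comparison
    ([null_le]) replaces filter arguments; [null_cvg] links it to the convergence used in the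
    statement. *)
Definition null u :=
  forall e : R, 0 < e -> exists N, forall n, (N <= n)%N -> `|u n| <= e.

Definition tends_inf g :=
  forall M, exists N, forall n, (N <= n)%N -> (M <= g n)%N.

Lemma null_le u v (N : nat) :
  null v -> (forall n, (N <= n)%N -> `|u n| <= v n) -> null u.
Proof.
move=> nv huv e /nv[M hM]; exists (maxn N M) => n; rewrite geq_max => /andP[h1 h2].
by apply: le_trans (huv _ h1) (le_trans (ler_norm _) (hM _ h2)).
Qed.

Lemma null_norm u : null u -> null (fun n => `|u n|).
Proof. by move=> nu e /nu[N hN]; exists N => n /hN; rewrite normr_id. Qed.

Lemma null0 : null (fun=> 0).
Proof. by move=> e e0; exists 0%N => n _; rewrite normr0 ltW. Qed.

Lemma nullD u v : null u -> null v -> null (fun n => u n + v n).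
Proof.
move=> nu nv e e0; have e2 : 0 < e / 2 by rewrite divr_gt0.
have [N hN] := nu _ e2; have [M hM] := nv _ e2.
exists (maxn N M) => n; rewrite geq_max => /andP[h1 h2].
rewrite (splitr e) (le_trans (ler_normD _ _)) // lerD //; [exact: hN|exact: hM].
Qed.

Lemma nullZ c u : null u -> null (fun n => c * u n).
Proof.
move=> nu e e0; have c0 : 0 < `|c| + 1 by rewrite ltr_wpDl.
have [N hN] := nu _ (divr_gt0 e0 c0); exists N => n /hN h.
rewrite normrM (@le_trans _ _ ((`|c| + 1) * `|u n|)) ?ler_wpM2r ?lerDl //.
by rewrite mulrC -ler_pdivlMr.
Qed.

Lemma null_cst c : null (fun=> c) -> c = 0.
Proof.
move=> nc; apply/eqP; rewrite -normr_eq0; apply: contraT => c0.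
have c1 : 0 < `|c| by rewrite lt_neqAle eq_sym c0 normr_ge0.
have [N /(_ N (leqnn N))] := nc _ (divr_gt0 c1 (ltr0n _ 2)).
by rewrite ler_pdivlMr // ger_pMr // (ler_nat _ 2 1).
Qed.

Lemma null_comp u g : null u -> tends_inf g -> null (fun n => u (g n)).
Proof.
move=> nu tg e /nu[N hN]; have [M hM] := tg N.
by exists M => n /hM /hN.
Qed.

Lemma tends_inf_ge g : (forall n, (n <= g n)%N) -> tends_inf g.
Proof. by move=> h M; exists M => n /leq_trans; apply. Qed.

Lemma null_inv : null (fun n => n.+1%:R^-1).
Proof.
move=> e e0.
have [N hN] : exists N, e^-1 < N%:R.
  by exists (Num.trunc e^-1).+1; apply: truncnS_gt.
exists N => n le; rewrite ger0_norm ?invr_ge0 //.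
rewrite -[leRHS]invrK lef_pV2 ?posrE ?ltr0n ?invr_gt0 //.
by apply: le_trans (ltW hN) _; rewrite ler_nat leqW.
Qed.

Lemma null_geom (r : R) : 0 <= r < 1 -> null (fun n => r ^+ n).
Proof.
case/andP=> r0 r1.
have [->|rn0] := eqVneq r 0.
  apply: (@null_le _ _ 1 null0) => n; case: n => // n _.
  by rewrite expr0n normr0.
have rp : 0 < r by rewrite lt_neqAle eq_sym rn0.
(* Bernoulli's inequality for [r^-1 = 1 + d] bounds [r ^+ n] by [(1 + n d)^-1]. *)
pose d := r^-1 - 1; have d0 : 0 < d by rewrite subr_gt0 invf_gt1.
have bern n : 1 + n%:R * d <= r^-1 ^+ n.
  elim: n => [|n IH]; first by rewrite mul0r addr0 expr0.
  rewrite exprS; have -> : r^-1 = 1 + d by rewrite /d addrC subrK.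
  have := ler_wpM2l (ltW (addr_gt0 ltr01 d0)) IH; rewrite -natr1.
  have : 0 <= n%:R * d * d by rewrite !mulr_ge0 // ltW.
  have -> : r^-1 = 1 + d by rewrite /d addrC subrK.
  lra.
apply: (@null_le _ (fun n => d^-1 * n.+1%:R^-1 * 2) 1).
  apply: (@null_le _ (fun n => (d^-1 * 2) * n.+1%:R^-1) 0) => [|n _].
    exact: nullZ null_inv.
  by rewrite mulrAC ger0_norm // !mulr_ge0 ?invr_ge0 // ltW.
move=> n n0; rewrite ger0_norm ?exprn_ge0 // -[r in leLHS]invrK exprVn.
have -> : d^-1 * n.+1%:R^-1 * 2 = (d * n.+1%:R / 2)^-1.
  by field; rewrite (gt_eqF d0) /= addrC natr1 pnatr_eq0.

rewrite lef_pV2 ?posrE.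
- apply: le_trans (bern n); rewrite -natr1.
  have : (1 : R) <= n%:R by rewrite ler1n.
  nra.
- by rewrite exprn_gt0 // invr_gt0.
- by rewrite !mulr_gt0 ?invr_gt0 // ltr0n.
Qed.

Definition clim s (l : R[i]) := null (fun n => cabs (s n - l)).

Lemma clim_ext s t l (N : nat) :
  (forall n, (N <= n)%N -> s n = t n) -> clim s l -> clim t l.
Proof.
move=> st h; apply: (@null_le _ _ N h) => n /st <-.
by rewrite ger0_norm ?cabs_ge0.
Qed.

Lemma clim_cst c : clim (fun=> c) c.
Proof.
by apply: (@null_le _ _ 0 null0) => n _; rewrite subrr cabs0 normr0.
Qed.

Lemma clim_unique s l m : clim s l -> clim s m -> l = m.
Proof.
move=> hl hm; apply/eqP; rewrite -subr_eq0 -cabs_eq0; apply/eqP.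
apply: null_cst; apply: (@null_le _ _ 0 (nullD hl hm)) => n _.
rewrite ger0_norm ?cabs_ge0 //.
have -> : l - m = (s n - m) - (s n - l) by ring.
by rewrite [leRHS]addrC; exact: cabsB.
Qed.

Lemma climD s t l m : clim s l -> clim t m -> clim (fun n => s n + t n) (l + m).
Proof.
move=> hl hm; apply: (@null_le _ _ 0 (nullD hl hm)) => n _.
by rewrite ger0_norm ?cabs_ge0 // opprD addrACA cabsD.
Qed.

Lemma climZ c s l : clim s l -> clim (fun n => c * s n) (c * l).
Proof.
move=> hl; apply: (@null_le _ _ 0 (nullZ (cabs c) hl)) => n _.
by rewrite ger0_norm ?cabs_ge0 // -mulrBr cabsM.
Qed.

Lemma climN s l : clim s l -> clim (fun n => - s n) (- l).
Proof.
move=> /(climZ (-1)); rewrite mulN1r; apply: (@clim_ext _ _ _ 0) => n _.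
by rewrite mulN1r.
Qed.

Lemma climB s t l m : clim s l -> clim t m -> clim (fun n => s n - t n) (l - m).
Proof. by move=> hl /climN; apply: climD. Qed.

Lemma climJ s l : clim s l -> clim (fun n => conjc (s n)) (conjc l).
Proof.
move=> hl; apply: (@null_le _ _ 0 hl) => n _.
by rewrite ger0_norm ?cabs_ge0 // -rmorphB cabsJ.
Qed.

Lemma clim_comp s l g : clim s l -> tends_inf g -> clim (fun n => s (g n)) l.
Proof. exact: null_comp. Qed.

Lemma climM s t l m : clim s l -> clim t m -> clim (fun n => s n * t n) (l * m).
Proof.
move=> hl hm.
have [N hN] := hl _ ltr01.
have h := nullD (nullZ (cabs l + 1) hm) (nullZ (cabs m) hl).
apply: (@null_le _ _ N h) => n /hN h1.
rewrite ger0_norm ?cabs_ge0 //.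
have -> : s n * t n - l * m = s n * (t n - m) + m * (s n - l) by ring.
apply: le_trans (cabsD _ _) _; rewrite !cabsM lerD2r ler_wpM2r ?cabs_ge0 //.
have -> : s n = (s n - l) + l by rewrite subrK.
apply: le_trans (cabsD _ _) _; rewrite addrC lerD2l.
by rewrite ger0_norm ?cabs_ge0 in h1.
Qed.

Lemma climX s l k : clim s l -> clim (fun n => s n ^+ k) (l ^+ k).
Proof.
move=> hl; elim: k => [|k IH]; first by rewrite expr0; exact: clim_cst.
by rewrite exprS; have := climM hl IH; apply: (@clim_ext _ _ _ 0) => n _; rewrite exprS.
Qed.

Lemma climV s l : l != 0 -> clim s l -> clim (fun n => (s n)^-1) l^-1.
Proof.
move=> l0 hl; have a0 : 0 < cabs l by rewrite cabs_gt0.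
have [N hN] := hl _ (divr_gt0 a0 (ltr0n _ 2)).
apply: (@null_le _ _ N (nullZ (2 / cabs l ^+ 2) hl)) => n /hN.
rewrite !ger0_norm ?cabs_ge0 // => h1.
have h2 : cabs l / 2 <= cabs (s n).
  have := cabsB (s n) (s n - l); have -> : s n - (s n - l) = l by ring.
  lra.
have s0 : s n != 0 by rewrite -cabs_gt0 (lt_le_trans _ h2) // divr_gt0.
have -> : (s n)^-1 - l^-1 = (l - s n) / (s n * l) by field; rewrite l0 s0.
rewrite cabsM cabsV cabsM cabsBC mulrC ler_wpM2r ?cabs_ge0 //.
rewrite -[leRHS]invrK invf_div lef_pV2 ?posrE ?mulr_gt0 ?cabs_gt0 ?divr_gt0 ?exprn_gt0 //.
by rewrite expr2 mulrAC ler_wpM2r ?cabs_ge0.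
Qed.

Lemma clim_le s l B (N : nat) :
  clim s l -> (forall n, (N <= n)%N -> cabs (s n) <= B) -> cabs l <= B.
Proof.
move=> hl hB; apply/ler_addgt0Pl => e e0.
have [M hM] := hl _ e0; have := hM _ (leq_maxr N M); have := hB _ (leq_maxl N M).
rewrite ger0_norm ?cabs_ge0 // => h1 h2.
have := cabsB (s (maxn N M)) (s (maxn N M) - l).
by rewrite subKr; lra.
Qed.

Lemma clim_Re s l : clim s l -> null (fun n => complex.Re (s n) - complex.Re l).
Proof. by move=> h; apply: (@null_le _ _ 0 h) => n _; rewrite -ReB norm_Re_le. Qed.

Lemma clim_Im s l : clim s l -> null (fun n => complex.Im (s n) - complex.Im l).
Proof. by move=> h; apply: (@null_le _ _ 0 h) => n _; rewrite -ImB norm_Im_le. Qed.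

Lemma clim_ReIm s l : null (fun n => complex.Re (s n) - complex.Re l) ->
  null (fun n => complex.Im (s n) - complex.Im l) -> clim s l.
Proof.
move=> h1 h2; apply: (@null_le _ _ 0 (nullD (null_norm h1) (null_norm h2))) => n _.
by rewrite ger0_norm ?cabs_ge0 // -ReB -ImB cabs_le_ReIm.
Qed.

Lemma null_cvg u (l : R) : null (fun n => u n - l) <-> (u @ \oo --> l)%classic.
Proof.
split.
  move=> h; apply/cvgrPdist_le => e /h[N hN].
  by exists N => // n /= /hN; rewrite distrC.
move=> /cvgrPdist_le h e /h[N _ hN].
by exists N => n /hN; rewrite distrC.
Qed.

Lemma cseries_toP s l : cseries_to s l <-> clim (fun N => \sum_(n < N) s n) l.
Proof.
rewrite /cseries_to /=; split.
  case=> /null_cvg h1 /null_cvg h2; apply: clim_ReIm.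
    by apply: (@null_le _ _ 0 (null_norm h1)) => n _; rewrite big_mkord.
  by apply: (@null_le _ _ 0 (null_norm h2)) => n _; rewrite big_mkord.
move=> h; split; apply/null_cvg.
  by apply: (@null_le _ _ 0 (null_norm (clim_Re h))) => n _; rewrite big_mkord.
by apply: (@null_le _ _ 0 (null_norm (clim_Im h))) => n _; rewrite big_mkord.
Qed.

(** For nonnegative terms: the series converges with sum at most [V]. No infinite sum of reals is
    formed; the least such [V] stands for it. *)
Definition sumle u (V : R) := forall N, \sum_(n < N) u n <= V.

(** Minimality is what turns an estimate of all partial sums into an inequality for [B] itself, as
    in [cusp_vanish] and [coef_bound]. *)
Lemma sumle_sup u V : sumle u V ->
  exists B, sumle u B /\ forall B', sumle u B' -> B <= B'.
Proof.
move=> hV.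
pose A : set R := [set x | exists N, x = \sum_(n < N) u n]%classic.
have A0 : (A !=set0)%classic by exists 0; exists 0%N; rewrite big_ord0.
have hA : has_sup A by split => //; exists V => x [N ->].
exists (sup A); split.
  by move=> N; apply: sup_upper_bound => //; exists N.
by move=> B' hB'; apply: ge_sup => // x [N ->].
Qed.

Lemma sum_ord_nat n (u : nat -> R) : \sum_(j < n) u j = \sum_(0 <= j < n) u j.
Proof. by rewrite big_mkord. Qed.

Lemma sum_le_mono u m n : (forall n, 0 <= u n) -> (m <= n)%N ->
  \sum_(j < m) u j <= \sum_(j < n) u j.
Proof.
move=> u0 /subnKC <-; rewrite !sum_ord_nat (big_cat_nat (leq0n m) (leq_addr _ _)) /=.
by rewrite lerDl sumr_ge0.
Qed.

Lemma sumle_tail u V : (forall n, 0 <= u n) -> sumle u V -> forall e : R, 0 < e ->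
  exists N, forall M, (N <= M)%N -> \sum_(n < M) u n - \sum_(n < N) u n <= e.
Proof.
move=> u0 hV e e0; have [B [hB hm]] := sumle_sup hV.
have [N hN] : exists N, B - e < \sum_(n < N) u n.
  apply: contrapT => h; have : B <= B - e.
    apply: hm => N; rewrite leNgt; apply/negP => hN; apply: h; by exists N.
  lra.
exists N => M _; have := hB M; lra.
Qed.

Lemma sumle_lim u V : (forall n, 0 <= u n) -> sumle u V ->
  exists B, null (fun N => \sum_(n < N) u n - B).
Proof.
move=> u0 hV; have [B [hB hm]] := sumle_sup hV; exists B => e e0.
have [N hN] := sumle_tail u0 hV e0; exists N => n le.
rewrite distrC ger0_norm ?subr_ge0 // lerBlDr; apply: hm => M.
have [h|/ltnW h] := leqP n M; last first.
  by apply: le_trans (sum_le_mono u0 h) _; rewrite lerDr ltW.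
have := hN _ (leq_trans le h); have := sum_le_mono u0 le; lra.
Qed.

(** Both [v] and [x + v] have nonnegative terms and bounded partial sums, so they converge; [x] is
    their difference. *)
Lemma rsum_abs_lim (x v : nat -> R) V : (forall n, `|x n| <= v n) -> sumle v V ->
  exists l, null (fun N => \sum_(n < N) x n - l).
Proof.
move=> xv hV; have v0 n : 0 <= v n by apply: le_trans (xv n).
have [l1 h1] := sumle_lim v0 hV.
have xv0 n : 0 <= x n + v n by have := xv n; rewrite ler_norml => /andP[? _]; lra.
have xv2 : sumle (fun n => x n + v n) (V + V).
  move=> N; rewrite big_split /=; apply: lerD; last exact: hV.
  apply: le_trans (hV N); apply: ler_sum => n _; exact: le_trans (ler_norm _) (xv n).
have [l2 h2] := sumle_lim xv0 xv2.
exists (l2 - l1).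
apply: (@null_le _ _ 0 (nullD (null_norm h2) (null_norm h1))) => n _.
apply: le_trans (ler_normB _ _); rewrite big_split /= le_eqVlt.
by apply/orP; left; apply/eqP; congr (`| _ |); ring.
Qed.

Lemma csum_abs_lim s v V : (forall n, cabs (s n) <= v n) -> sumle v V ->
  exists l, clim (fun N => \sum_(n < N) s n) l.
Proof.
move=> sv hV.
have [l1 h1] := rsum_abs_lim (fun n => le_trans (norm_Re_le (s n)) (sv n)) hV.
have [l2 h2] := rsum_abs_lim (fun n => le_trans (norm_Im_le (s n)) (sv n)) hV.
exists (l1 +i* l2); apply: clim_ReIm => /=.
  by apply: (@null_le _ _ 0 (null_norm h1)) => n _; rewrite Re_sum.
by apply: (@null_le _ _ 0 (null_norm h2)) => n _; rewrite Im_sum.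
Qed.

Lemma clim_sum (F : nat -> nat -> R[i]) (l : nat -> R[i]) m :
  (forall j, (j < m)%N -> clim (fun n => F n j) (l j)) ->
  clim (fun n => \sum_(j < m) F n j) (\sum_(j < m) l j).
Proof.
elim: m => [|m IH] h.
  by rewrite big_ord0; apply: (clim_ext (N := 0) _ (clim_cst 0)) => n _; rewrite big_ord0.
rewrite big_ord_recr /=.
have h' : clim (fun n => \sum_(j < m) F n j) (\sum_(j < m) l j).
  by apply: IH => j jm; apply: h; apply: leqW.
apply: (clim_ext (N := 0) _ (climD h' (h m (ltnSn m)))) => n _.
by rewrite big_ord_recr.
Qed.

(* Tannery's theorem *)
Lemma clim_dominated (F : nat -> nat -> R[i]) (l : nat -> R[i]) v V g L :
  (forall n j, (j < g n)%N -> cabs (F n j) <= v j) -> sumle v V ->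
  (forall j, 0 <= v j) ->
  (forall j, clim (fun n => F n j) (l j)) ->
  tends_inf g -> clim (fun N => \sum_(j < N) l j) L ->
  clim (fun n => \sum_(j < g n) F n j) L.
Proof.
move=> Fv hV v0 Fl tg hL.
have csplit (s : nat -> R[i]) m n : (m <= n)%N ->
    cabs (\sum_(j < n) s j - \sum_(j < m) s j) <=
    \sum_(0 <= i < n - m) cabs (s (i + m)%N).
  move=> mn; rewrite -!(big_mkord xpredT) (big_cat_nat (leq0n m) mn) /=.
  rewrite addrAC subrr add0r.
  have -> : \sum_(m <= i < n) s i = \sum_(0 <= i < n - m) s (i + m)%N.
    by rewrite -{1}[m]add0n big_addn.
  by rewrite !big_mkord (cabs_sum _ (fun i => s (i + m)%N)).
move=> e e0; have e3 : 0 < e / 4 by rewrite divr_gt0.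
have [N1 h1] := sumle_tail v0 hV e3.
have [N2 h2] := hL _ e3.
pose m := maxn N1 N2.
have [N3 h3] := clim_sum (fun j (_ : (j < m)%N) => Fl j) e3.
have [N4 h4] := tg m.
exists (maxn N3 N4) => n; rewrite geq_max => /andP[n3 /h4 n4].
rewrite ger0_norm ?cabs_ge0 //.
set A := \sum_(j < g n) F n j.
have t1 : cabs (A - \sum_(j < m) F n j) <= e / 4 + e / 4.
  apply: le_trans (csplit (F n) _ _ n4) _.
  apply: (@le_trans _ _ (\sum_(0 <= i < g n - m) v (i + m)%N)).
    rewrite big_nat [leRHS]big_nat; apply: ler_sum => i /andP[_ hi].
    by apply: Fv; lia.
  have hm := h1 _ (leq_trans (leq_maxl N1 N2) n4).
  have : \sum_(0 <= i < g n - m) v (i + m)%N = \sum_(j < g n) v j - \sum_(j < m) v j.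
    rewrite !sum_ord_nat (big_cat_nat (leq0n m) n4) /=.
    by rewrite addrAC subrr add0r -{3}[m]add0n big_addn.
  have := sum_le_mono v0 (leq_maxl N1 N2); rewrite -/m.
  lra.
have := h3 _ n3; rewrite ger0_norm ?cabs_ge0 // => t2.
have := h2 _ (leq_maxr N1 N2); rewrite -/m ger0_norm ?cabs_ge0 // => t3.
have -> : A - L = (A - \sum_(j < m) F n j) + (\sum_(j < m) F n j - \sum_(j < m) l j)
   + (\sum_(j < m) l j - L) by ring.
apply: le_trans (cabsD _ _) _.
have := cabsD (A - \sum_(j < m) F n j) (\sum_(j < m) F n j - \sum_(j < m) l j).
lra.
Qed.

End Limits.

(** * q-expansions *)

Section CauchyProduct.
Variable R : realType.

Lemma sum_triangle (x y : nat -> R[i]) N :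
  \sum_(n < N) \sum_(i < n.+1) x i * y (n - i)%N =
  \sum_(i < N) x i * \sum_(j < N - i) y j.
Proof.
elim: N => [|N IH]; first by rewrite !big_ord0.
rewrite big_ord_recr /= IH [X in _ + X = _]big_ord_recr /= subnn.
rewrite [RHS]big_ord_recr /= subSnn big_ord1 addrA.
congr (_ + _); rewrite -big_split /=; apply: eq_bigr => i _.
by rewrite -mulrDr subSn ?[in RHS]big_ord_recr // ltnW.
Qed.

(** By [sum_triangle] the partial sum is a sum of [x i] times a partial sum of [y] of length
    [N - i]; Tannery's theorem applies in [i] with majorant [cabs (x i) * W]. *)
Lemma cauchy_product (x y : nat -> R[i]) V W L M :
  sumle (fun n => cabs (x n)) V -> sumle (fun n => cabs (y n)) W ->
  clim (fun N => \sum_(n < N) x n) L -> clim (fun N => \sum_(n < N) y n) M ->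
  clim (fun N => \sum_(n < N) \sum_(i < n.+1) x i * y (n - i)%N) (L * M).
Proof.
move=> hV hW hL hM.
have W0 : 0 <= W by have := hW 0%N; rewrite big_ord0.
apply: (@clim_ext _ (fun N => \sum_(i < N) x i * \sum_(j < N - i) y j) _ _ 0).
  by move=> n _; rewrite sum_triangle.
apply: (@clim_dominated _ (fun N i => x i * \sum_(j < N - i) y j)
   (fun i => x i * M) (fun i => cabs (x i) * W) (V * W) id).
- move=> n j _; rewrite cabsM ler_wpM2l ?cabs_ge0 //.
  exact: le_trans (cabs_sum _ _) (hW _).
- by move=> N; rewrite -mulr_suml ler_wpM2r.
- by move=> j; rewrite mulr_ge0 ?cabs_ge0.
- move=> j; apply: climZ; apply: (clim_comp hM (g := fun n => (n - j)%N)) => K.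
  by exists (K + j)%N => n h /=; lia.
- exact: tends_inf_ge.
apply: (@clim_ext _ (fun N => M * \sum_(n < N) x n) _ _ 0).
  by move=> n _; rewrite mulr_sumr; apply: eq_bigr => i _; rewrite mulrC.
by rewrite mulrC; exact: climZ.
Qed.

End CauchyProduct.

(** * The exponential q = e^{2 pi i z} and its modulus *)

Section Qpow.
Variable R : realType.
Implicit Types z w : R[i].

(** [ee z] is e^{2 pi i z}, and [qr y] is its modulus at height [y] ([cabs_ee]). *)
Definition ee z : R[i] := qpow 1 z.
Definition qr (y : R) : R := expR (- (2 * pi * y)).

Lemma qr_gt0 y : 0 < qr y. Proof. exact: expR_gt0. Qed.
Lemma qr_ge0 y : 0 <= qr y. Proof. exact: expR_ge0. Qed.
Lemma qr_lt1 y : 0 < y -> qr y < 1.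
Proof. by move=> y0; rewrite /qr expR_lt1 oppr_lt0 !mulr_gt0 ?pi_gt0. Qed.
Lemma qrD x y : qr (x + y) = qr x * qr y.
Proof. by rewrite /qr -expRD; congr expR; ring. Qed.
Lemma qrX n y : qr y ^+ n = expR (- (2 * pi * y * n%:R)).
Proof. by rewrite /qr -expRM_natl; congr expR; ring. Qed.
Lemma qr_le x y : x <= y -> qr y <= qr x.
Proof. by move=> xy; rewrite ler_expR lerN2 ler_wpM2l // mulr_ge0 ?pi_ge0. Qed.

Lemma cabs_polar (r t : R) : 0 <= r -> cabs ((r * cos t) +i* (r * sin t)) = r.
Proof.
move=> r0; rewrite cabsE /= !exprMn -mulrDr cos2Dsin2 mulr1 sqrtr_sqr.
exact: ger0_norm.
Qed.

Lemma eeD z w : ee (z + w) = ee z * ee w.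
Proof.
rewrite /ee /qpow ReD ImD /= !mulrDr cosD sinD expRD.
by apply: complex_eqP => /=; ring.
Qed.

Lemma ee0 : ee 0 = 1.
Proof. by rewrite /ee /qpow /= !mulr0 expR0 cos0 sin0 mulr0 mulr1. Qed.

Lemma ee_natM n z : ee (n%:R * z) = ee z ^+ n.
Proof.
elim: n => [|n IH]; first by rewrite mul0r ee0 expr0.
by rewrite -natr1 mulrDl mul1r eeD IH exprSr.
Qed.

Lemma qpowE n z : qpow n z = ee (n%:R * z).
Proof.
have hR (m : nat) : (m%:R : R[i]) = (m%:R : R)%:C by rewrite rmorph_nat.
rewrite /ee /qpow hR ReM ImM /= !mul0r subr0 addr0.
by apply: complex_eqP => /=; rewrite !mulr1 !mulrA !mulNr.
Qed.

Lemma qpowX n z : qpow n z = ee z ^+ n.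
Proof. by rewrite qpowE ee_natM. Qed.

Lemma cabs_ee z : cabs (ee z) = qr (complex.Im z).
Proof.
by rewrite /ee /qpow cabs_polar ?expR_ge0 // /qr mulr1 mulNr.
Qed.

Lemma ee1 : ee 1 = 1.
Proof.
rewrite /ee /qpow /= !mulr1 mulr0 expR0 !mul1r.
have -> : 2 * pi = pi *+ 2 :> R by rewrite mulr_natl.
by rewrite cos2pi sin2pi.
Qed.

Lemma ee_nat n : ee n%:R = 1.
Proof. by rewrite -[n%:R]mulr1 ee_natM ee1 expr1n. Qed.

Lemma eeN z : ee (- z) = (ee z)^-1.
Proof.
have h : ee z * ee (- z) = 1 by rewrite -eeD subrr ee0.
have h0 : ee z != 0 by apply: contra_eq_neq h => ->; rewrite mul0r eq_sym oner_eq0.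
by apply: (mulfI h0); rewrite h mulfV.
Qed.

Lemma qpow_conj n z : conjc (qpow n (- conjc z)) = qpow n z.
Proof.
case: z => x y; rewrite /qpow; apply: complex_eqP => /=.
  by rewrite opprK mulrN cosN.
by rewrite opprK !mulrN sinN mulrN opprK.
Qed.

(** The real part is 1 - 2 sin(pi t)^2, and the sine is positive for 0 < t < 1. *)
Lemma ee_real_neq1 (t : R) : 0 < t < 1 -> ee t%:C != 1.
Proof.
move=> /andP[t0 t1]; apply/eqP; rewrite /ee /qpow /= mulr0 expR0 !mul1r mulr1.
case=> h _.
have e2 : 2 * pi * t = (pi * t) *+ 2 by rewrite -mulr_natl; ring.
have s0 : 0 < sin (pi * t).
  by apply: sin_gt0_pi; rewrite mulr_gt0 ?pi_gt0 //= gtr_pMr ?pi_gt0.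
move: h; rewrite e2 cos_mulr2n cos2sin2 => h.
have : 0 < sin (pi * t) ^+ 2 by rewrite exprn_gt0.
lra.
Qed.

Lemma geom_sum_le (r : R) : 0 <= r < 1 -> sumle (fun n => r ^+ n) (1 - r)^-1.
Proof.
move=> /andP[r0 r1] N; have d0 : 0 < 1 - r by rewrite subr_gt0.
rewrite -div1r ler_pdivlMr // mulrC.
have -> : (1 - r) * \sum_(i < N) r ^+ i = 1 - r ^+ N.
  by rewrite -[RHS]opprB subrX1 -mulNr opprB.
by rewrite lerBlDr lerDl exprn_ge0.
Qed.

End Qpow.
Arguments ee : simpl never.
Arguments qr : simpl never.

(** * Series in q: absolute convergence, products, Cauchy's estimate *)

Section Qexp.
Variable R : realType.
Implicit Types (f g : R[i] -> R[i]) (a b : nat -> R[i]).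

Lemma has_qexpP f a : has_qexp f a <-> forall z, upper z ->
  clim (fun N => \sum_(n < N) a n * ee z ^+ n) (f z).
Proof.
split=> h z hz.
  have /cseries_toP := h z hz; apply: (@clim_ext _ _ _ _ 0) => n _.
  by apply: eq_bigr => j _; rewrite qpowX.
apply/cseries_toP; have := h z hz; apply: (@clim_ext _ _ _ _ 0) => n _.
by apply: eq_bigr => j _; rewrite qpowX.
Qed.

Lemma qexp_term_bounded f a (y : R) : has_qexp f a -> 0 < y ->
  exists C, forall n, cabs (a n) * qr y ^+ n <= C.
Proof.
move=> /has_qexpP h y0.
have hz : upper (0 +i* y) by [].
have hs := h _ hz.
have [N hN] := hs _ ltr01.
pose t n := cabs (a n) * qr y ^+ n.
have tE n : cabs (a n * ee (0 +i* y) ^+ n) = t n by rewrite cabsM cabsX cabs_ee.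
have big n : (N <= n)%N -> t n <= 2.
  move=> le; have h1 := hN _ le; have h2 := hN _ (leqW le).
  rewrite !ger0_norm ?cabs_ge0 // big_ord_recr /= in h1 h2.
  rewrite -tE.
  set s := \sum_(i < n) _ in h1 h2; set x := a n * _ in h2 *.
  have -> : x = (s + x - f (0 +i* y)) - (s - f (0 +i* y)) by ring.
  by apply: le_trans (cabsB _ _) _; lra.
have t0 n : 0 <= t n by rewrite mulr_ge0 ?cabs_ge0 ?exprn_ge0 ?qr_ge0.
exists (2 + \sum_(j < N) t j) => n.
have [/big le|lt] := leqP N n.
  by apply: le_trans le _; rewrite lerDl sumr_ge0.
rewrite (bigD1 (Ordinal lt)) //= -/(t n).
have : 0 <= \sum_(i < N | i != Ordinal lt) t i by rewrite sumr_ge0.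
lra.
Qed.

(** [has_qexp] speaks of ordered partial sums only. Convergence at height [y / 2] bounds the terms
    there, and passing to height [y] leaves a geometric factor [qr (y / 2) ^+ n]. *)
Lemma qexp_summable f a (y : R) : has_qexp f a -> 0 < y ->
  exists V, sumle (fun n => cabs (a n) * qr y ^+ n) V.
Proof.
move=> h y0; have y2 : 0 < y / 2 by rewrite divr_gt0.
have [C hC] := qexp_term_bounded h y2.
have C0 : 0 <= C.
  by apply: le_trans (hC 0%N); rewrite mulr_ge0 ?cabs_ge0 ?exprn_ge0 ?qr_ge0.
exists (C * (1 - qr (y / 2))^-1) => N.
apply: (@le_trans _ _ (\sum_(n < N) C * qr (y / 2) ^+ n)).
  apply: ler_sum => n _; rewrite [y in leLHS]splitr qrD exprMn mulrA.
  by rewrite ler_wpM2r ?exprn_ge0 ?qr_ge0.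
rewrite -mulr_sumr ler_wpM2l // geom_sum_le // qr_ge0 /=; exact: qr_lt1.
Qed.

Lemma qexp_cabs_le f a z B : has_qexp f a -> upper z ->
  sumle (fun n => cabs (a n) * qr (complex.Im z) ^+ n) B -> cabs (f z) <= B.
Proof.
move=> /has_qexpP h hz hB; apply: (clim_le (N := 0) (h z hz)) => n _.
apply: le_trans (cabs_sum _ (fun j => a j * ee z ^+ j)) _.
apply: le_trans (hB n); apply: ler_sum => j _.
by rewrite cabsM cabsX cabs_ee.
Qed.

Lemma qexpB f g a b : has_qexp f a -> has_qexp g b ->
  has_qexp (fun z => f z - g z) (fun n => a n - b n).
Proof.
move=> /has_qexpP hf /has_qexpP hg; apply/has_qexpP => z hz.
apply: (@clim_ext _ _ _ _ 0) (climB (hf z hz) (hg z hz)) => n _.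
by rewrite -sumrB; apply: eq_bigr => j _; rewrite mulrBl.
Qed.

Lemma qexpM f g a b : has_qexp f a -> has_qexp g b ->
  has_qexp (fun z => f z * g z) (fun n => \sum_(i < n.+1) a i * b (n - i)%N).
Proof.
move=> hf hg; apply/has_qexpP => z hz.
have [V hV] := qexp_summable hf hz; have [W hW] := qexp_summable hg hz.
have absE c : (fun n => cabs (c n * ee z ^+ n)) =1
    (fun n => cabs (c n) * qr (complex.Im z) ^+ n).
  by move=> n; rewrite cabsM cabsX cabs_ee.
have {}hV : sumle (fun n => cabs (a n * ee z ^+ n)) V.
  by move=> N; apply: le_trans (hV N); apply: ler_sum => i _; rewrite absE.
have {}hW : sumle (fun n => cabs (b n * ee z ^+ n)) W.
  by move=> N; apply: le_trans (hW N); apply: ler_sum => i _; rewrite absE.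
have h1 := proj1 (has_qexpP f a) hf z hz.
have h2 := proj1 (has_qexpP g b) hg z hz.
apply: (@clim_ext _ _ _ _ 0) (cauchy_product hV hW h1 h2) => N _.
apply: eq_bigr => n _; rewrite mulr_suml; apply: eq_bigr => i _.
rewrite mulrACA -exprD subnKC // -ltnS; exact: ltn_ord.
Qed.

(** The reflection z -> -conj z preserves the half-plane and conjugates q, so the conjugated
    coefficients again belong to a function there. *)
Lemma qexpJ f a : has_qexp f a ->
  has_qexp (fun z => conjc (f (- conjc z))) (fun n => conjc (a n)).
Proof.
move=> hf z hz; have hz' : upper (- conjc z).
  by case: z hz => x y; rewrite /upper /= opprK.
apply/cseries_toP; have /cseries_toP/climJ := hf _ hz'.
apply: (@clim_ext _ _ _ _ 0) => n _.
rewrite rmorph_sum; apply: eq_bigr => j _; rewrite rmorphM.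
by congr (_ * _); exact: qpow_conj.
Qed.

Lemma qexpT f a z : has_qexp f a -> upper z -> f (z + 1) = f z.
Proof.
move=> /has_qexpP h hz; have hz' : upper (z + 1).
  by case: z hz => x y; rewrite /upper /= addr0.
apply: clim_unique (h z hz); have := h _ hz'.
by apply: (@clim_ext _ _ _ _ 0) => n _; rewrite eeD ee1 mulr1.
Qed.

Lemma ee_root_neq1 (m n Q : nat) : (m < Q)%N -> (n < Q)%N -> m != n ->
  ee ((m%:R - n%:R) / Q%:R) != 1 :> R[i].
Proof.
have lt_case (k l : nat) : (l < k)%N -> (k < Q)%N ->
    ee ((k%:R - l%:R) / Q%:R) != 1 :> R[i].
  move=> lk kQ; have Q0 : (0 : R) < Q%:R by rewrite ltr0n; exact: leq_ltn_trans kQ.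
  have -> : (k%:R - l%:R) / Q%:R = ((k - l)%N%:R / Q%:R : R)%:C.
    by rewrite rmorphM /= fmorphV /= !rmorph_nat natrB // ltnW.
  apply: ee_real_neq1; apply/andP; split.
    by rewrite divr_gt0 // ltr0n subn_gt0.
  rewrite ltr_pdivrMr // mul1r ltr_nat; exact: leq_ltn_trans (leq_subr _ _) kQ.
move=> mQ nQ; rewrite neq_ltn => /orP[lt|lt]; last exact: lt_case.
have := lt_case _ _ lt nQ; apply: contra_neq => h.
have -> : (n%:R - m%:R) / Q%:R = - ((m%:R - n%:R) / Q%:R) :> R[i].
  by rewrite -mulNr opprB.
by rewrite eeN h invr1.
Qed.

(* Distinct indices below Q are incongruent mod Q, so averaging over Q equally
   spaced points isolates one coefficient of the Q-th partial sum. *)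
Lemma qexp_coef_average a (y : R) n Q : (n < Q)%N ->
  \sum_(j < Q) ((\sum_(m < Q) a m * ee (j%:R / Q%:R + 0 +i* y) ^+ m) *
                 ee (- (n%:R * (j%:R / Q%:R)))) = Q%:R * (a n * ee (0 +i* y) ^+ n).
Proof.
move=> nQ; have Q0 : (Q%:R : R[i]) != 0 by rewrite pnatr_eq0 -lt0n; exact: leq_ltn_trans nQ.
have termE j m : a m * ee (j%:R / Q%:R + 0 +i* y) ^+ m * ee (- (n%:R * (j%:R / Q%:R)))
   = (a m * ee (0 +i* y) ^+ m) * ee ((m%:R - n%:R) / Q%:R) ^+ j.
  have -> : ee ((m%:R - n%:R) / Q%:R) ^+ j =
      ee (j%:R / Q%:R) ^+ m * ee (- (n%:R * (j%:R / Q%:R))) :> R[i].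
    by rewrite -!ee_natM -eeD -mulNr -mulrDl; congr ee; rewrite mulrCA.
  by rewrite eeD exprMn; ring.
under eq_bigr => j _ do rewrite mulr_suml.
rewrite exchange_big /= (bigD1 (Ordinal nQ)) //=.
under eq_bigr => j _ do rewrite termE subrr mul0r ee0 expr1n mulr1.
rewrite sumr_const card_ord mulr_natl [X in _ + X]big1 ?addr0 // => m mn.
under eq_bigr => j _ do rewrite termE.
rewrite -mulr_sumr.
set w := ee ((m%:R - n%:R) / Q%:R).
have w1 : w != 1.
  have mn' : (m : nat) != n by apply: contra_neq mn => mn; exact/val_inj.
  exact: (ee_root_neq1 (ltn_ord m) nQ mn').
have wQ : w ^+ Q = 1.
  rewrite -ee_natM mulrCA mulfV // mulr1 eeD eeN.
  by rewrite !ee_nat invr1 mulr1.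
have := subrX1 w Q; rewrite wQ subrr => /esym/eqP.
by rewrite mulf_eq0 subr_eq0 (negbTE w1) /= => /eqP ->; rewrite mulr0.
Qed.

(** Cauchy's estimate on a horizontal line, with the average over [Q] points in place of the
    integral. The average is exact for the [Q]-th partial sum; the rest of the series costs at most
    [e]. *)
Lemma qexp_coef_bound f a (y K : R) : has_qexp f a -> 0 < y ->
  (forall x, cabs (f (x +i* y)) <= K) -> forall n, cabs (a n) * qr y ^+ n <= K.
Proof.
move=> hf y0 hK n; apply/ler_addgt0Pl => e e0.
have [V hV] := qexp_summable hf y0.
have v0 m : 0 <= cabs (a m) * qr y ^+ m.
  by rewrite mulr_ge0 ?cabs_ge0 ?exprn_ge0 ?qr_ge0.
have [N hN] := sumle_tail v0 hV e0.
pose Q := maxn N n.+1; have nQ : (n < Q)%N by exact: leq_maxr.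
have NQ : (N <= Q)%N by exact: leq_maxl.
have part z : upper z -> complex.Im z = y ->
    cabs (\sum_(m < Q) a m * ee z ^+ m) <= e + cabs (f z).
  move=> hz zy; set S := \sum_(m < Q) _.
  have h : cabs (f z - S) <= e.
    have lim := proj1 (has_qexpP f a) hf z hz.
    apply: (clim_le (N := Q) (climB lim (clim_cst S))) => M QM.
    rewrite /S -!(big_mkord xpredT (fun m => a m * ee z ^+ m)).
    rewrite (big_cat_nat (leq0n Q) QM) /= addrAC subrr add0r.
    have -> : \sum_(Q <= m < M) a m * ee z ^+ m =
        \sum_(0 <= i < M - Q) a (i + Q)%N * ee z ^+ (i + Q).
      by rewrite -{1}[Q]add0n big_addn.
    rewrite big_mkord.
    apply: le_trans (cabs_sum _ (fun i => a (i + Q)%N * ee z ^+ (i + Q))) _.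
    apply: le_trans (hN _ (leq_trans NQ QM)).
    have -> : \sum_(j < M - Q) cabs (a (j + Q)%N * ee z ^+ (j + Q)) =
       \sum_(j < M) cabs (a j) * qr y ^+ j - \sum_(j < Q) cabs (a j) * qr y ^+ j.
      rewrite -!(big_mkord xpredT (fun j => cabs (a j) * qr y ^+ j)).
      rewrite (big_cat_nat (leq0n Q) QM) /= addrAC subrr add0r.
      have -> : \sum_(Q <= j < M) cabs (a j) * qr y ^+ j =
          \sum_(0 <= j < M - Q) cabs (a (j + Q)%N) * qr y ^+ (j + Q).
        by rewrite -{1}[Q]add0n big_addn.
      by rewrite !big_mkord; apply: eq_bigr => j _; rewrite cabsM cabsX cabs_ee zy.
    by rewrite lerD2l lerN2; exact: (sum_le_mono v0 NQ).
  have -> : S = f z - (f z - S) by ring.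
  by apply: le_trans (cabsB _ _) _; rewrite addrC lerD2r.
have Q0 : (0 : R) < Q%:R by rewrite ltr0n; exact: leq_ltn_trans nQ.
rewrite -(ler_pM2l Q0).
have -> : Q%:R * (cabs (a n) * qr y ^+ n) = cabs (Q%:R * (a n * ee (0 +i* y) ^+ n)).
  by rewrite cabsM cabs_nat cabsM cabsX cabs_ee.
rewrite -(qexp_coef_average a y nQ).
apply: le_trans (cabs_sum Q (fun j => (\sum_(m < Q) a m * ee (j%:R / Q%:R + 0 +i* y) ^+ m) *
                 ee (- (n%:R * (j%:R / Q%:R))))) _.
have -> : Q%:R * (e + K) = \sum_(j < Q) (e + K).
  by rewrite sumr_const card_ord mulr_natl.
apply: ler_sum => j _.
have jE : j%:R / Q%:R = (j%:R / Q%:R : R)%:C.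
  by rewrite rmorphM /= fmorphV /= !rmorph_nat.
have nE : - (n%:R * (j%:R / Q%:R)) = (- (n%:R * (j%:R / Q%:R)) : R)%:C.
  by rewrite rmorphN rmorphM /= -jE rmorph_nat.
rewrite nE cabsM cabs_ee /= /qr mulr0 oppr0 expR0 mulr1 jE.
have zE : (j%:R / Q%:R : R)%:C + 0 +i* y = (j%:R / Q%:R) +i* y.
  by apply: complex_eqP => /=; rewrite ?addr0 ?add0r.
rewrite zE; apply: le_trans (part _ _ _) _ => //.
by rewrite lerD2l.
Qed.

End Qexp.

(** * Coefficient bound for cusp forms *)

Section CuspBound.
Variable R : realType.
Implicit Types (z w : R[i]) (f : R[i] -> R[i]) (a b : nat -> R[i]).

Lemma Im_Ninv z : complex.Im (- z^-1) = complex.Im z / cabs z ^+ 2.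
Proof. by rewrite sqr_cabs; case: z => x y /=; rewrite opprK. Qed.

Lemma upper_neq0 z : upper z -> z != 0.
Proof. by move=> hz; apply: contraTneq hz => ->; rewrite /upper /= ltxx. Qed.

Lemma upper_Ninv z : upper z -> upper (- z^-1).
Proof.
move=> hz; rewrite /upper Im_Ninv divr_gt0 // exprn_gt0 // cabs_gt0.
exact: upper_neq0.
Qed.

Lemma upperDr z (x : R) : upper z -> upper (z + x%:C).
Proof. by case: z => u v; rewrite /upper /= addr0. Qed.

(* If |Re z| <= 1/2 and Im z < 1/2 then |z|^2 < 1/2, so z |-> -1/z at least
   doubles the height; alternating with integer translations must therefore
   reach height 1/2. *)
Lemma invariant_le (H : R[i] -> R) K :
  (forall z, upper z -> H (z + 1) = H z) ->
  (forall z, upper z -> H (- z^-1) = H z) ->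
  (forall z, 2^-1 <= complex.Im z -> H z <= K) ->
  forall z, upper z -> H z <= K.
Proof.
move=> HT HS HK.
have Tn n z : upper z -> H (z + n%:R) = H z.
  move=> hz; elim: n => [|n IH]; first by rewrite addr0.
  rewrite -natr1 addrA HT ?IH //.
  by have -> : n%:R = (n%:R : R)%:C :> R[i] by [rewrite rmorph_nat]; apply: upperDr.
have Tm (m : int) z : upper z -> H (z + m%:~R) = H z.
  move=> hz; case: m => n; first exact: Tn.
  rewrite NegzE mulrNz; have hz' : upper (z - n.+1%:R).
    have -> : - n.+1%:R = (- n.+1%:R : R)%:C :> R[i] by rewrite rmorphN rmorph_nat.
    exact: upperDr.
  by have := Tn n.+1 _ hz'; rewrite subrK => ->.
have step j z : (2^-1) ^+ j.+1 <= complex.Im z -> H z <= K.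
  elim: j z => [|j IH] z hy; first by apply: HK; rewrite expr1 in hy.
  have hz : upper z by rewrite /upper (lt_le_trans _ hy) // exprn_gt0 // invr_gt0.
  pose m := Num.floor (complex.Re z + 2^-1).
  rewrite -(Tm (- m) z hz); set w := z + _.
  have wR : complex.Re w = complex.Re z - m%:~R.
    have -> : w = z + (- m%:~R : R)%:C by rewrite /w mulrNz rmorphN rmorph_int.
    by rewrite ReD.
  have wI : complex.Im w = complex.Im z.
    have -> : w = z + (- m%:~R : R)%:C by rewrite /w mulrNz rmorphN rmorph_int.
    by rewrite ImD /= addr0.
  have w_le : `|complex.Re w| <= 2^-1.
    have := floor_itv (complex.Re z + 2^-1); rewrite -/m intrD => /andP[h1 h2].
    rewrite wR ler_norml; apply/andP; split; lra.
  have [h|h] := leP 2^-1 (complex.Im w); first exact: HK.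
  have hw : upper w by rewrite /upper wI.
  rewrite -(HS _ hw); apply: IH; rewrite Im_Ninv.
  have w0 : 0 < cabs w by rewrite cabs_gt0 upper_neq0.
  have wn : cabs w ^+ 2 <= 2^-1.
    rewrite sqr_cabs -(real_normK (num_real (complex.Re w))).
    have : `|complex.Re w| ^+ 2 <= 2^-1 ^+ 2 by rewrite lerXn2r ?nnegrE ?invr_ge0.
    have : complex.Im w ^+ 2 <= 2^-1 ^+ 2 by rewrite lerXn2r ?nnegrE ?invr_ge0 // ltW.
    rewrite !expr2; lra.
  rewrite ler_pdivlMr ?exprn_gt0 // wI.
  apply: le_trans (ler_wpM2l _ wn) _; first by rewrite exprn_ge0 // invr_ge0.
  by rewrite -exprSr.
move=> z hz.
have [j hj] : exists j, (2^-1 : R) ^+ j <= complex.Im z.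
  have [|N hN] := @null_geom R 2^-1 _ _ hz; first by apply/andP; split; lra.
  by exists N; have := hN _ (leqnn N); rewrite ger0_norm // exprn_ge0 // invr_ge0.
apply: (step j); apply: le_trans hj; rewrite exprSr ler_piMr ?exprn_ge0 ?invr_ge0 //.
by lra.
Qed.

(** The maximum of x^p e^{-x} is at x = p: raise [1 + t <= expR t] at t = x/p - 1 to the power
    [p]. *)
Lemma powX_expRN_le (p : nat) (x : R) : (0 < p)%N -> 0 <= x ->
  x ^+ p * expR (- x) <= p%:R ^+ p * expR (- p%:R).
Proof.
move=> p0 x0; have pp : (0 : R) < p%:R by rewrite ltr0n.
have h : x / p%:R <= expR (x / p%:R - 1).
  by apply: le_trans (expR_ge1Dx _); rewrite addrC subrK.
have : (x / p%:R) ^+ p <= expR (x / p%:R - 1) ^+ p.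
  by rewrite lerXn2r ?nnegrE ?expR_ge0 ?divr_ge0.
rewrite -expRM_natl expr_div_n ler_pdivrMr ?exprn_gt0 // => h2.
rewrite expRN ler_pdivrMr ?expR_gt0 //; apply: le_trans h2 _.
rewrite mulrAC -mulrA -expRD mulrC ler_wpM2l ?exprn_ge0 //.
rewrite ler_expR mulrBr mulr1 mulrCA mulfV ?gt_eqF // mulr1.
lra.
Qed.

Variables (p : nat) (f : R[i] -> R[i]) (b : nat -> R[i]).
Hypotheses (p_gt0 : (0 < p)%N) (fb : has_qexp f b) (b0 : b 0%N = 0).
Hypothesis f_modular : forall z, upper z -> f (- z^-1) = z ^+ (2 * p) * f z.

(** The left side is invariant under both generators, so [invariant_le] leaves the case Im z >= 1/2,
    where 1/Y <= Im z because [2 <= Y]. As [b 0 = 0], a factor [qr (y - Y^-1)] can be taken out of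
    every term of the series, and it outweighs the growth of y^p. *)
Lemma cusp_height (Y B : R) z : 2 <= Y ->
  sumle (fun n => cabs (b n) * qr Y^-1 ^+ n) B -> upper z ->
  (2 * pi * complex.Im z) ^+ p * cabs (f z) <=
  p%:R ^+ p * expR (- p%:R) * qr (- Y^-1) * B.
Proof.
move=> Y2 hB; have B0 : 0 <= B by have := hB 0%N; rewrite big_ord0.
have pi0 : 0 < 2 * pi :> R by rewrite mulr_gt0 ?pi_gt0.
apply: (@invariant_le (fun z => (2 * pi * complex.Im z) ^+ p * cabs (f z))) => {}z.
- by move=> hz; rewrite (qexpT fb hz) ImD /= addr0.
- move=> hz; rewrite f_modular // Im_Ninv cabsM cabsX exprM mulrA -exprMn.
  congr ((_ ^+ p) * _); rewrite -!mulrA mulVf ?mulr1 //.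
  by rewrite expf_neq0 // cabs_eq0 upper_neq0.
move=> hy; have y0 : 0 < complex.Im z by lra.
have Yi : Y^-1 <= complex.Im z.
  by apply: le_trans hy; rewrite lef_pV2 ?posrE //; lra.
set y := complex.Im z in hy y0 Yi *.
have fB : cabs (f z) <= qr (y - Y^-1) * B.
  apply: (qexp_cabs_le fb) => // N.
  apply: (@le_trans _ _ (qr (y - Y^-1) * \sum_(n < N) cabs (b n) * qr Y^-1 ^+ n)).
    rewrite mulr_sumr; apply: ler_sum => -[[|n] hn] _ /=.
      by rewrite b0 cabs0 !mul0r mulr0.
    rewrite mulrCA ler_wpM2l ?cabs_ge0 // -/y.
    have -> : qr y = qr (y - Y^-1) * qr Y^-1 by rewrite -qrD subrK.
    rewrite exprMn ler_wpM2r ?exprn_ge0 ?qr_ge0 //.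
    rewrite exprS ler_piMr ?qr_ge0 // exprn_ile1 ?qr_ge0 //.
    by rewrite /qr expR_le1 oppr_le0 mulr_ge0 ?(ltW pi0) // subr_ge0.
  by rewrite ler_wpM2l ?qr_ge0.
apply: le_trans (ler_wpM2l _ fB) _.
  by rewrite exprn_ge0 // mulr_ge0 // ltW.
rewrite qrD !mulrA ler_wpM2r // ler_wpM2r ?qr_ge0 //.
by apply: powX_expRN_le => //; rewrite mulr_ge0 // ltW.
Qed.

(** Hecke's argument: Cauchy's estimate on the line at height p/(2 pi n), combined with
    [cusp_height]. *)
Lemma cusp_coef_bound (Y B : R) n : 2 <= Y ->
  sumle (fun n => cabs (b n) * qr Y^-1 ^+ n) B ->
  cabs (b n) <= qr (- Y^-1) * B * n%:R ^+ p.
Proof.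
move=> Y2 hB; have B0 : 0 <= B by have := hB 0%N; rewrite big_ord0.
case: n => [|n].
  by rewrite b0 cabs0 !mulr_ge0 ?qr_ge0 ?exprn_ge0.
have pi0 : 0 < 2 * pi :> R by rewrite mulr_gt0 ?pi_gt0.
have n0 : (0 : R) < n.+1%:R by rewrite ltr0n.
have pp : (0 : R) < p%:R by rewrite ltr0n.
(* At this height 2 pi n y = p, so the factors p^p e^{-p} of [cusp_height] cancel exactly against
   y^p and |q|^n. *)
pose y : R := p%:R / (2 * pi * n.+1%:R).
have y0 : 0 < y by rewrite divr_gt0 // mulr_gt0.
have yE : 2 * pi * y = p%:R / n.+1%:R.
  by rewrite /y invfM mulrCA mulVKf // gt_eqF.
pose K : R := p%:R ^+ p * expR (- p%:R) * qr (- Y^-1) * B / (2 * pi * y) ^+ p.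
have hK x : cabs (f (x +i* y)) <= K.
  have hz : upper (x +i* y) by [].
  have := cusp_height Y2 hB hz; rewrite /= mulrC => h.
  by rewrite ler_pdivlMr // exprn_gt0 // mulr_gt0.
have := qexp_coef_bound fb y0 hK n.+1.
have -> : qr y ^+ n.+1 = expR (- p%:R).
  by rewrite qrX yE divfK // gt_eqF.
rewrite /K yE expr_div_n invf_div.
have -> : p%:R ^+ p * expR (- p%:R) * qr (- Y^-1) * B * (n.+1%:R ^+ p / p%:R ^+ p)
  = qr (- Y^-1) * B * n.+1%:R ^+ p * expR (- p%:R) :> R.
  by field; rewrite expf_neq0 // gt_eqF.
by rewrite ler_pM2r ?expR_gt0.
Qed.

End CuspBound.

(** * Elementary estimates *)

Section ElementaryBounds.
Variable R : realType.
Implicit Types x y : R.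

Lemma norm_sin_le x : `|sin x| <= `|x|.
Proof.
wlog x0 : x / 0 < x.
  move=> h; have [x0|x0|<-] := ltgtP 0 x; first exact: h.
    by have := h (- x); rewrite oppr_gt0 sinN !normrN; exact.
  by rewrite sin0 !normr0.
have [c _] := @MVT R sin cos 0 x x0 (fun y _ => is_derive_sin y)
  (continuous_subspaceT (fun y => continuous_sin (x:=y))).
rewrite sin0 !subr0 => ->; rewrite normrM ler_piMl //; exact: cos_max.
Qed.

Lemma norm_cosB1_le x : `|cos x - 1| <= `|x| /\ `|cos x - 1| <= x ^+ 2 / 2.
Proof.
have e : cos x - 1 = - 2 * sin (x / 2) ^+ 2.
  have {1}-> : x = (x / 2) *+ 2 by rewrite -mulr_natr divfK.
  rewrite cos_mulr2n cos2sin2 -mulr_natl; ring.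
have n2 : `|- 2 * sin (x / 2) ^+ 2| = 2 * `|sin (x / 2)| ^+ 2.
  by rewrite mulNr normrN normrM normrX normr_nat.
have h1 : `|sin (x / 2)| <= `|x| / 2.
  by apply: le_trans (norm_sin_le _) _; rewrite normrM [`|2^-1|]ger0_norm.
have h2 := sin_max (x / 2).
have h0 := normr_ge0 (sin (x / 2)).
rewrite e n2 -(real_normK (num_real x)); split; nra.
Qed.

Lemma norm_sinBid_le x : `|sin x - x| <= x ^+ 2.
Proof.
wlog x0 : x / 0 < x.
  move=> h; have [x0|x0|<-] := ltgtP 0 x; first exact: h.
    have := h (- x); rewrite oppr_gt0 sinN sqrrN -opprD normrN; exact.
  by rewrite sin0 subrr normr0 sqr_ge0.
have [c cx] := @MVT R sin cos 0 x x0 (fun y _ => is_derive_sin y)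
  (continuous_subspaceT (fun y => continuous_sin (x:=y))).
rewrite sin0 !subr0 => ->.
have -> : cos c * x - x = (cos c - 1) * x by ring.
move: cx; rewrite in_itv /= => /andP[c0 cx].
have [h _] := norm_cosB1_le c.
rewrite normrM [`|x|]ger0_norm ?(ltW x0) // expr2 ler_wpM2r ?(ltW x0) //.
by apply: le_trans h _; rewrite ger0_norm ltW.
Qed.

Lemma expRN_bounds y : 0 <= y ->
  `|expR (- y) - 1| <= y /\ `|expR (- y) - 1 + y| <= y ^+ 2.
Proof.
move=> y0; have h1 := expR_ge1Dx (- y).
have h2 : expR (- y) <= 1 by rewrite expR_le1 oppr_le0.
have h3 : expR (- y) * (1 + y) <= 1.
  rewrite expRN mulrC ler_pdivrMr ?expR_gt0 // mul1r; exact: expR_ge1Dx.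
have h0 := expR_ge0 (- y).
split; first by rewrite ler_norml; apply/andP; split; lra.
rewrite ger0_norm; first nra.
lra.
Qed.

(** A second-order Taylor remainder at 0. It gives Q (1 - e^{2 pi i u/Q}) -> -2 pi i u with error
    O(1/Q), as used in [scaled_1Bee_lim]. *)
Lemma ee_linear_approx (w : R[i]) : 0 <= complex.Im w ->
  cabs (ee w - 1 - (0 +i* (2 * pi)) * w) <= 4 * (2 * pi * cabs w) ^+ 2.
Proof.
case: w => x y /= y0.
have pi0 : 0 <= 2 * pi :> R by rewrite mulr_ge0 ?pi_ge0.
set X := 2 * pi * x; set V := 2 * pi * y.
have V0 : 0 <= V by rewrite mulr_ge0.
rewrite exprMn sqr_cabs /=.
have -> : (2 * pi) ^+ 2 * (x ^+ 2 + y ^+ 2) = X ^+ 2 + V ^+ 2.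
  by rewrite /X /V; ring.
apply: le_trans (cabs_le_ReIm _) _.
rewrite /ee /qpow /=.
have -> : expR (- (2 * pi * 1) * y) = expR (- V) by rewrite mulr1 mulNr.
rewrite mulr1 -/X.
have -> : expR (- V) * cos X - 1 - (0 * x - 2 * pi * y) =
   (expR (- V) - 1 + V) + expR (- V) * (cos X - 1) by rewrite /V; ring.
have -> : expR (- V) * sin X - 0 - (0 * y + 2 * pi * x) =
   (sin X - X) + (expR (- V) - 1) * sin X by rewrite /X; ring.
have [e1 e2] := expRN_bounds V0.
have c2 : `|cos X - 1| <= X ^+ 2.
  by have [_ h] := norm_cosB1_le X; have := sqr_ge0 X; lra.
have s1 := norm_sin_le X; have s2 := norm_sinBid_le X.
have eV : `|expR (- V)| <= 1.
  by rewrite ger0_norm ?expR_ge0 // expR_le1 oppr_le0.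
apply: le_trans (lerD (ler_normD _ _) (ler_normD _ _)) _; rewrite !normrM.
have m1 : `|expR (- V)| * `|cos X - 1| <= X ^+ 2.
  by rewrite -[leRHS]mul1r ler_pM.
have m2 : `|expR (- V) - 1| * `|sin X| <= V * `|X| by rewrite ler_pM.
have : 2 * (V * `|X|) <= V ^+ 2 + X ^+ 2.
  rewrite -[X ^+ 2](real_normK (num_real X)).
  have := sqr_ge0 (V - `|X|); rewrite sqrrB; lra.
have := sqr_ge0 X; have := sqr_ge0 V; lra.
Qed.

(* Doubling: |1 - q^2| <= 2|1 - q|, and Re q <= 0 once |Re w| >= 1/4. *)
Lemma norm_1Bee_ge (w : R[i]) : 0 <= complex.Im w -> `|complex.Re w| <= 3 / 4 ->
  4 / 3 * `|complex.Re w| <= cabs (1 - ee w).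
Proof.
have quarter (u : R[i]) : 0 <= complex.Im u -> 4^-1 <= `|complex.Re u| -> `|complex.Re u| <= 3 / 4 ->
    1 <= cabs (1 - ee u).
  move=> _ h1 h2; apply: le_trans (norm_Re_le _).
  have c0 : cos (2 * pi * complex.Re u) <= 0.
    rewrite -cos_norm normrM [`|2 * pi|]ger0_norm ?mulr_ge0 ?pi_ge0 //.
    set t := 2 * pi * _.
    have -> : t = (t - pi) + pi by rewrite subrK.
    rewrite cosDpi oppr_le0 cos_ge0_pihalf //.
    have pi0 := pi_ge0 R.
    have := ler_wpM2l pi0 h1; have := ler_wpM2l pi0 h2; rewrite /t => b1 b2.
    by apply/andP; split; lra.
  rewrite /ee /qpow /= mulr1.
  have := expR_ge0 (- (2 * pi) * complex.Im u) => e0.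
  rewrite ger0_norm; nra.
move=> hI hR.
have [->|r0] := eqVneq (complex.Re w) 0; first by rewrite normr0 mulr0 cabs_ge0.
have rp : 0 < `|complex.Re w| by rewrite normr_gt0.
have step j (u : R[i]) : 0 <= complex.Im u -> (2^-1) ^+ j / 4 <= `|complex.Re u| -> `|complex.Re u| <= 3 / 4 ->
    4 / 3 * `|complex.Re u| <= cabs (1 - ee u).
  elim: j u => [|j IH] u uI h1 h2.
    have := quarter u uI; rewrite expr0 div1r in h1 => /(_ h1 h2); lra.
  have [h|h] := leP 4^-1 `|complex.Re u|.
    by have := quarter u uI h h2; lra.
  have R2 : `|complex.Re (u + u)| = 2 * `|complex.Re u|.
    by rewrite ReD -mulr2n normrMn mulr_natl.
  have := IH (u + u); rewrite R2 ImD.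
  have -> : ee (u + u) = ee u * ee u by rewrite eeD.
  have -> : 1 - ee u * ee u = (1 - ee u) * (1 + ee u) by ring.
  rewrite cabsM => h3.
  have h4 : cabs (1 + ee u) <= 2.
    apply: le_trans (cabsD _ _) _; rewrite cabs1 cabs_ee.
    have : qr (complex.Im u) <= qr 0 by exact: qr_le.
    rewrite {2}/qr mulr0 oppr0 expR0; lra.
  have : 4 / 3 * (2 * `|complex.Re u|) <= cabs (1 - ee u) * cabs (1 + ee u).
    apply: h3; first lra.
      by rewrite exprS in h1; lra.
    lra.
  have := ler_wpM2l (cabs_ge0 (1 - ee u)) h4; lra.
have [|N hN] := @null_geom R 2^-1 _ _ rp; first by apply/andP; split; lra.
apply: (step N) => //.
have := hN _ (leqnn N); rewrite ger0_norm ?exprn_ge0 ?invr_ge0 // => h.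
have : 0 <= (2^-1 : R) ^+ N by rewrite exprn_ge0 // invr_ge0.
lra.
Qed.

(** With [s] the fourth root of [r], three of the four factors s^n absorb n^3, since n s^n <= 1 + s
    + ... + s^{n-1} <= 1/(1-s); the fourth remains. *)
Lemma cube_geom_le (r : R) : 0 <= r < 1 ->
  exists C s : R, 0 <= s < 1 /\ forall n, n%:R ^+ 3 * r ^+ n <= C * s ^+ n.
Proof.
move=> /andP[r0 r1]; pose s := Num.sqrt (Num.sqrt r).
have s0 : 0 <= s by exact: sqrtr_ge0.
have sr : s ^+ 4 = r by rewrite (exprM _ 2 2) !sqr_sqrtr // sqrtr_ge0.
have s1 : s < 1.
  by rewrite ltNge; apply: contraL r1 => h; rewrite -leNgt -sr exprn_ege1.
exists ((1 - s)^-1 ^+ 3), s; split; first by rewrite s0.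
move=> n; have h : n%:R * s ^+ n <= (1 - s)^-1.
  apply: le_trans (geom_sum_le _ n); last by rewrite s0.
  rewrite -[n in n%:R]card_ord -sum1_card natr_sum mulr_suml; apply: ler_sum => i _.
  by rewrite mul1r ler_wiXn2l ?(ltW s1) // ltnW.
have -> : n%:R ^+ 3 * r ^+ n = (n%:R * s ^+ n) ^+ 3 * s ^+ n.
  have e : r ^+ n = (s ^+ n) ^+ 3 * s ^+ n by rewrite -exprSr -sr exprAC.
  by rewrite e [(n%:R * _) ^+ 3]exprMn mulrA.
rewrite ler_wpM2r ?exprn_ge0 // lerXn2r ?nnegrE ?mulr_ge0 ?exprn_ge0 ?invr_ge0 //.
by rewrite subr_ge0 ltW.
Qed.

End ElementaryBounds.

(** * Multiplication formula *)

Section Lipschitz.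
Variable R : realType.
Implicit Types (q z w : R[i]).

(** The rational form of the sum of r^3 q^r, with an Eulerian polynomial as numerator. Its pole of
    order 4 at [q = 1] is the source of the terms (z + j)^-4. *)
Definition psi q : R[i] := q * (1 + 4 * q + q ^+ 2) / (1 - q) ^+ 4.

(** Clearing the denominator makes the finite sum a polynomial whose remainder carries q^N, so the
    induction step is a ring identity. *)
Lemma cube_sum_closed q N :
  (1 - q) ^+ 4 * (\sum_(r < N) r%:R ^+ 3 * q ^+ r) =
  q * (1 + 4 * q + q ^+ 2) - q ^+ N * (N%:R ^+ 3 * (1 - q) ^+ 3 +
    3 * N%:R ^+ 2 * q * (1 - q) ^+ 2 + 3 * N%:R * q * (1 + q) * (1 - q) +
    q * (1 + 4 * q + q ^+ 2)).
Proof.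
elim: N => [|N IH]; first by rewrite big_ord0 expr0; ring.
by rewrite big_ord_recr /= mulrDr IH -(natr1 N) (exprS q N); ring.
Qed.

Lemma cabs_lt1_neq q : cabs q < 1 -> 1 - q != 0.
Proof.
move=> q1; rewrite subr_eq0; apply: contraTneq q1 => <-.
by rewrite cabs1 ltxx.
Qed.

Lemma psi_num_le q : cabs q <= 1 -> cabs (q * (1 + 4 * q + q ^+ 2)) <= 6.
Proof.
move=> q1; have q0 := cabs_ge0 q.
rewrite cabsM; have h : cabs (1 + 4 * q + q ^+ 2) <= 6.
  have := cabsD (1 + 4 * q) (q ^+ 2); have := cabsD 1 (4 * q).
  rewrite cabsM cabs_nat cabs1 cabsX.
  have : cabs q ^+ 2 <= 1 by rewrite exprn_ile1.
  lra.
have := cabs_ge0 (1 + 4 * q + q ^+ 2); nra.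
Qed.

Lemma psi_lim q : cabs q < 1 ->
  clim (fun N => \sum_(r < N) r%:R ^+ 3 * q ^+ r) (psi q).
Proof.
move=> q1; have q0 := cabs_lt1_neq q1; have q40 : (1 - q) ^+ 4 != 0 by rewrite expf_neq0.
have [C [s [s1 hC]]] : exists C s : R, 0 <= s < 1 /\
    forall n, n%:R ^+ 3 * cabs q ^+ n <= C * s ^+ n.
  by apply: cube_geom_le; rewrite cabs_ge0.
pose P N := N%:R ^+ 3 * (1 - q) ^+ 3 +
    3 * N%:R ^+ 2 * q * (1 - q) ^+ 2 + 3 * N%:R * q * (1 + q) * (1 - q) +
    q * (1 + 4 * q + q ^+ 2).
have lim0 : clim (fun N => q ^+ N * P N) 0.
  apply: (@null_le _ _ (fun N => C * 100 * s ^+ N) 1).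
    exact: nullZ (null_geom s1).
  move=> N N1; rewrite ger0_norm ?cabs_ge0 // subr0 cabsM cabsX.
  have N1' : (1 : R) <= N%:R by rewrite ler1n.
  have hq := cabs_ge0 q.
  have q2 : cabs (1 - q) <= 2 by apply: le_trans (cabsB _ _) _; rewrite cabs1; lra.
  have q3 : cabs (1 + q) <= 2 by apply: le_trans (cabsD _ _) _; rewrite cabs1; lra.
  (* The four terms contribute at most 8, 12, 12 and 6 times N^3; 100 is a generous total. *)
  have hP : cabs (P N) <= 100 * N%:R ^+ 3.
    rewrite /P.
    have d1 := cabs_ge0 (1 - q); have d2 := cabs_ge0 (1 + q).
    have t1 : cabs (N%:R ^+ 3 * (1 - q) ^+ 3) <= N%:R ^+ 3 * 8.
      rewrite cabsM !cabsX cabs_nat ler_wpM2l ?exprn_ge0 //.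
      have -> : 8 = 2 ^+ 3 :> R by ring.
      by rewrite lerXn2r ?nnegrE.
    have N2 : (N%:R : R) ^+ 2 <= N%:R ^+ 3 by rewrite ler_weXn2l.
    have N3 : (N%:R : R) <= N%:R ^+ 3 by rewrite -[leLHS]expr1 ler_weXn2l.
    have N4 : 1 <= (N%:R : R) ^+ 3 by rewrite exprn_ege1.
    have t2 : cabs (3 * N%:R ^+ 2 * q * (1 - q) ^+ 2) <= 12 * N%:R ^+ 3.
      rewrite 3!cabsM !cabsX !cabs_nat.
      have e1 : cabs q * cabs (1 - q) ^+ 2 <= 4.
        have -> : 4 = 1 * 2 ^+ 2 :> R by ring.
        by rewrite ler_pM ?exprn_ge0 ?(ltW q1) // lerXn2r ?nnegrE.
      have e0 : 0 <= cabs q * cabs (1 - q) ^+ 2 by rewrite mulr_ge0 ?exprn_ge0.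
      have -> : 12 * N%:R ^+ 3 = 3 * (N%:R ^+ 3 * 4) :> R by ring.
      have -> : 3 * N%:R ^+ 2 * cabs q * cabs (1 - q) ^+ 2 =
        3 * (N%:R ^+ 2 * (cabs q * cabs (1 - q) ^+ 2)) by ring.
      apply: ler_wpM2l => //; apply: ler_pM => //; exact: exprn_ge0.
    have t3 : cabs (3 * N%:R * q * (1 + q) * (1 - q)) <= 12 * N%:R ^+ 3.
      rewrite !cabsM !cabs_nat.
      have e1 : cabs q * (cabs (1 + q) * cabs (1 - q)) <= 4.
        have -> : 4 = 1 * (2 * 2) :> R by ring.
        by rewrite !ler_pM ?mulr_ge0 ?(ltW q1).
      have -> : 12 * N%:R ^+ 3 = 3 * (N%:R ^+ 3 * 4) :> R by ring.
      have -> : 3 * N%:R * cabs q * cabs (1 + q) * cabs (1 - q) =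
        3 * (N%:R * (cabs q * (cabs (1 + q) * cabs (1 - q)))) by ring.
      apply: ler_wpM2l => //; apply: ler_pM => //; by rewrite !mulr_ge0.
    have t4 := psi_num_le (ltW q1).
    have := cabsD (N%:R ^+ 3 * (1 - q) ^+ 3) (3 * N%:R ^+ 2 * q * (1 - q) ^+ 2).
    set A := N%:R ^+ 3 * (1 - q) ^+ 3 in t1 *; set B := 3 * N%:R ^+ 2 * q * (1 - q) ^+ 2 in t2 *.
    set D := 3 * N%:R * q * _ * _ in t3 *; set E := q * _ in t4 *.
    have := cabsD (A + B) D; have := cabsD (A + B + D) E.
    lra.
  apply: le_trans (ler_wpM2l (exprn_ge0 _ hq) hP) _.
  have := hC N; lra.
have lim1 : clim (fun N => ((1 - q) ^+ 4)^-1 * (q * (1 + 4 * q + q ^+ 2) - q ^+ N * P N))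
    (((1 - q) ^+ 4)^-1 * (q * (1 + 4 * q + q ^+ 2) - 0)).
  by apply: climZ; apply: climB lim0; apply: clim_cst.
have psiE : psi q = ((1 - q) ^+ 4)^-1 * (q * (1 + 4 * q + q ^+ 2)) by rewrite mulrC.
rewrite subr0 -psiE in lim1.
apply: (@clim_ext _ _ _ _ 0) lim1 => N _.
by rewrite -cube_sum_closed mulKf.
Qed.

Lemma sum_blocks (F : nat -> R[i]) Q M :
  \sum_(r < Q * M) F r = \sum_(s < M) \sum_(t < Q) F (s * Q + t)%N.
Proof.
elim: M => [|M IH]; first by rewrite muln0 !big_ord0.
rewrite mulnS addnC big_split_ord /= IH big_ord_recr /=; congr (_ + _).
by apply: eq_bigr => t _; rewrite mulnC.
Qed.

Lemma sum_ee_root Q t : (0 < t < Q)%N ->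
  \sum_(j < Q) ee (j%:R / Q%:R) ^+ t = 0 :> R[i].
Proof.
move=> /andP[t0 tQ].
have Q0 : (Q%:R : R[i]) != 0 by rewrite pnatr_eq0 -lt0n; exact: leq_ltn_trans tQ.
have Q1 : (0 < Q)%N by exact: leq_ltn_trans tQ.
have w1 : ee ((t%:R - 0%:R) / Q%:R) != 1 :> R[i].
  by apply: (ee_root_neq1 R tQ Q1); rewrite -lt0n.
rewrite subr0 in w1; set w := ee _ in w1.
have -> : \sum_(j < Q) ee (j%:R / Q%:R) ^+ t = \sum_(j < Q) w ^+ j.
  by apply: eq_bigr => j _; rewrite /w -!ee_natM; congr ee; rewrite mulrCA.
have wQ : w ^+ Q = 1 by rewrite /w -ee_natM mulrCA mulfV // mulr1 ee_nat.
have := subrX1 w Q; rewrite wQ subrr => /esym/eqP.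
by rewrite mulf_eq0 subr_eq0 (negbTE w1) /= => /eqP.
Qed.

Lemma ee_lt1 z : upper z -> cabs (ee z) < 1.
Proof. by move=> hz; rewrite cabs_ee qr_lt1. Qed.

Lemma upper_div z Q : (0 < Q)%N -> upper z -> upper (z / Q%:R).
Proof.
move=> Q0; have -> : (Q%:R : R[i])^-1 = (Q%:R^-1 : R)%:C.
  by rewrite fmorphV /= rmorph_nat.
case: z => x y; rewrite /upper /= mulr0 add0r => y0.
by rewrite mulr_gt0 // invr_gt0 ltr0n.
Qed.

Lemma upper_nat_add z n : upper z -> upper (z + n%:R).
Proof.
by move=> hz; have -> : n%:R = (n%:R : R)%:C :> R[i] by [rewrite rmorph_nat]; apply: upperDr.
Qed.

Lemma upper_nat_sub z n : upper z -> upper (z - n%:R).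
Proof.
move=> hz; have -> : - n%:R = (- n%:R : R)%:C :> R[i] by rewrite rmorphN rmorph_nat.
exact: upperDr.
Qed.

(** Write the exponent as r = sQ + t. Summing over [j] kills every residue t <> 0 by orthogonality,
    and t = 0 leaves Q (sQ)^3 = Q^4 s^3. *)
Lemma psi_distribution z Q : (0 < Q)%N -> upper z ->
  \sum_(j < Q) psi (ee ((z + j%:R) / Q%:R)) = Q%:R ^+ 4 * psi (ee z).
Proof.
move=> Q0 hz.
have l1 (j : nat) : clim (fun M => \sum_(r < Q * M) r%:R ^+ 3 * ee ((z + j%:R) / Q%:R) ^+ r)
    (psi (ee ((z + j%:R) / Q%:R))).
  apply: (@clim_comp _ (fun N => \sum_(r < N) r%:R ^+ 3 * ee ((z + j%:R) / Q%:R) ^+ r)).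
    by apply: psi_lim; apply: ee_lt1; apply: upper_div => //; exact: upper_nat_add.
  by apply: tends_inf_ge => M; rewrite leq_pmull.
have l2 := clim_sum (fun j (_ : (j < Q)%N) => l1 j).
apply: clim_unique l2 _.
have := climZ (Q%:R ^+ 4) (psi_lim (ee_lt1 hz)).
apply: (@clim_ext _ _ _ _ 0) => M _.
have Qn0 : (Q%:R : R[i]) != 0 by rewrite pnatr_eq0 -lt0n.
rewrite exchange_big /=.
pose F r := \sum_(j < Q) r%:R ^+ 3 * ee ((z + j%:R) / Q%:R) ^+ r.
rewrite (sum_blocks F) mulr_sumr; apply: eq_bigr => s _.
have FE t : F (s * Q + t)%N = (s * Q + t)%:R ^+ 3 * ee (z / Q%:R) ^+ (s * Q + t) *
    \sum_(j < Q) ee (j%:R / Q%:R) ^+ t.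
  rewrite mulr_sumr; apply: eq_bigr => j _.
  rewrite mulrDl eeD exprMn -mulrA; congr (_ * (_ * _)).
  rewrite exprD mulnC exprM -(ee_natM Q) mulrCA mulfV // mulr1 ee_nat expr1n mul1r.
  by [].
rewrite (bigD1 (Ordinal Q0)) //= [X in _ = _ + X]big1 ?addr0.
  rewrite FE addn0.
  under eq_bigr => j _ do rewrite expr0.
  rewrite sumr_const card_ord natrM (mulnC s Q) (exprM (ee (z / Q%:R))) -(ee_natM Q).
  have -> : Q%:R * (z / Q%:R) = z by rewrite mulrCA mulfV // mulr1.
  by ring.
move=> t t0; rewrite FE sum_ee_root ?mulr0 // ltn_ord andbT lt0n.
by apply: contra_neq t0 => t0; apply/val_inj.
Qed.

Definition zsum (phi : R[i] -> R[i]) z N : R[i] :=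
  phi z + \sum_(j < N) (phi (z + j.+1%:R) + phi (z - j.+1%:R)).

(** An odd number of consecutive translates can be centred: with modulus 2N + 1, [psi_distribution]
    at z - N runs over the shifts from -N to N. *)
Lemma sum_symm (phi : R[i] -> R[i]) z N :
  \sum_(j < (2 * N).+1) phi (z - N%:R + j%:R) = zsum phi z N.
Proof.
elim: N => [|N IH].
  by rewrite muln0 /zsum big_ord_recl !big_ord0 subr0 !addr0.
have -> : zsum phi z N.+1 = zsum phi z N + (phi (z + N.+1%:R) + phi (z - N.+1%:R)).
  by rewrite /zsum [X in _ + X = _]big_ord_recr /= addrA.
rewrite -IH.
have -> : (2 * N.+1)%N = (2 * N).+2 by lia.
rewrite big_ord_recl big_ord_recr /= addr0.
have -> : z - N.+1%:R + (bump 0 (2 * N).+1)%:R = z + N.+1%:R.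
  have -> : (bump 0 (2 * N).+1)%:R = N.+1%:R + N.+1%:R :> R[i].
    by rewrite /bump /= -natrD; congr (_%:R); lia.
  by ring.
have -> : \sum_(i < (2 * N).+1) phi (z - N.+1%:R + (bump 0 i)%:R) =
    \sum_(j < (2 * N).+1) phi (z - N%:R + j%:R).
  apply: eq_bigr => j _; congr phi.
  by rewrite /bump /= natrD -(natr1 N); ring.
by ring.
Qed.

End Lipschitz.

(** * Lipschitz formula *)

Section LipschitzFormula.
Variable R : realType.
Implicit Types (q z w u : R[i]).

Local Notation Q N := ((2 * N).+1).

(** The constant of the Lipschitz formula: near v = 0, psi(e^{2 pi i v}) behaves like 6/(2 pi v)^4,
    the numerator tending to 1 + 4 + 1. *)
Definition lam : R[i] := ((2 * pi) ^+ 4 / 6)%:C.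

Lemma pi2_gt0 : 0 < 2 * pi :> R. Proof. by rewrite mulr_gt0 ?pi_gt0. Qed.

Lemma lam_neq0 : lam != 0.
Proof.
rewrite /lam -cabs_eq0 cabsC normr_eq0 gt_eqF // divr_gt0 // exprn_gt0 //.
exact: pi2_gt0.
Qed.

Lemma null_invQ : null (fun N => (Q N)%:R^-1 : R).
Proof.
apply: (@null_le _ _ _ 0 (@null_inv R)) => n _.
rewrite ger0_norm ?invr_ge0 // lef_pV2 ?posrE ?ltr0n // ler_nat; lia.
Qed.

Lemma Im_divQ u N : complex.Im (u / (Q N)%:R) = complex.Im u / (Q N)%:R.
Proof.
have -> : ((Q N)%:R : R[i])^-1 = ((Q N)%:R^-1 : R)%:C by rewrite fmorphV /= rmorph_nat.
by rewrite ImM /= mulr0 add0r.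
Qed.

Lemma Re_divQ u N : complex.Re (u / (Q N)%:R) = complex.Re u / (Q N)%:R.
Proof.
have -> : ((Q N)%:R : R[i])^-1 = ((Q N)%:R^-1 : R)%:C by rewrite fmorphV /= rmorph_nat.
by rewrite ReM /= mulr0 subr0.
Qed.

Lemma scaled_1Bee_lim u : upper u ->
  clim (fun N => (Q N)%:R * (1 - ee (u / (Q N)%:R))) (- ((0 +i* (2 * pi)) * u)).
Proof.
move=> hu.
apply: (@null_le _ _ _ 0 (nullZ (4 * (2 * pi * cabs u) ^+ 2) null_invQ)) => N _.
rewrite ger0_norm ?cabs_ge0 // opprK.
set q := (Q N)%:R.
have q0 : (q : R[i]) != 0 by rewrite pnatr_eq0.
have -> : q * (1 - ee (u / q)) + (0 +i* (2 * pi)) * u =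
    - (q * (ee (u / q) - 1 - (0 +i* (2 * pi)) * (u / q))).
  have e : q * (u / q) = u by rewrite mulrCA mulfV // mulr1.
  set E := ee _; set c := _ +i* _.
  by transitivity (q * (1 - E) + c * (q * (u / q))); [rewrite e|ring].
have hI : 0 <= complex.Im (u / q) by rewrite Im_divQ divr_ge0 // ltW.
rewrite cabsN cabsM cabs_nat.
apply: le_trans (ler_wpM2l (ler0n _ _) (ee_linear_approx hI)) _.
rewrite cabsM cabsV cabs_nat -/q.
set x : R := (Q N)%:R; have x0 : x != 0 by rewrite pnatr_eq0.
rewrite le_eqVlt; apply/orP; left; apply/eqP; by field.
Qed.

Lemma ee_divQ_lim u : upper u -> clim (fun N => ee (u / (Q N)%:R)) 1.
Proof.
move=> hu.
have hQ : clim (fun N => ((Q N)%:R : R[i])^-1) 0.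
  apply: (@null_le _ _ _ 0 null_invQ) => N _.
  by rewrite ger0_norm ?cabs_ge0 // subr0 cabsV cabs_nat.
have := climB (clim_cst 1) (climM hQ (scaled_1Bee_lim hu)).
rewrite mul0r subr0; apply: (@clim_ext _ _ _ _ 0) => N _.
by rewrite mulrA mulVf ?pnatr_eq0 // mul1r subKr.
Qed.

Lemma psi_scaledE u N : upper u ->
  ((Q N)%:R ^+ 4)^-1 * psi (ee (u / (Q N)%:R)) =
  ee (u / (Q N)%:R) * (1 + 4 * ee (u / (Q N)%:R) + ee (u / (Q N)%:R) ^+ 2) /
   ((Q N)%:R * (1 - ee (u / (Q N)%:R))) ^+ 4.
Proof.
move=> hu; rewrite /psi [(_ * (1 - _)) ^+ 4]exprMn [in RHS]invfM.
by rewrite [in RHS]mulrCA.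
Qed.

Lemma psi_scaled_lim u : upper u ->
  clim (fun N => ((Q N)%:R ^+ 4)^-1 * psi (ee (u / (Q N)%:R))) (lam^-1 * (u ^+ 4)^-1).
Proof.
move=> hu; have u0 := upper_neq0 hu.
have h1 := ee_divQ_lim hu.
have h2 := scaled_1Bee_lim hu.
have num : clim (fun N => ee (u / (Q N)%:R) *
    (1 + 4 * ee (u / (Q N)%:R) + ee (u / (Q N)%:R) ^+ 2)) (1 * (1 + 4 * 1 + 1 ^+ 2)).
  apply: climM => //; apply: climD (climX 2 h1).
  by apply: climD; [exact: clim_cst|exact: climZ].
have d0 : (- ((0 +i* (2 * pi)) * u)) ^+ 4 != 0.
  rewrite expf_neq0 // oppr_eq0 mulf_neq0 // -cabs_eq0 cabsE /= expr0n /= add0r.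
  by rewrite sqrtr_sqr normr_eq0 gt_eqF // pi2_gt0.
have := climM num (climV d0 (climX 4 h2)).
have -> : 1 * (1 + 4 * 1 + 1 ^+ 2) / (- ((0 +i* (2 * pi)) * u)) ^+ 4 = lam^-1 * (u ^+ 4)^-1.
  have -> : (- ((0 +i* (2 * pi)) * u)) ^+ 4 = ((2 * pi) ^+ 4)%:C * u ^+ 4.
    rewrite -mulNr exprMn; congr (_ * _).
    rewrite [_ ^+ 4](exprM _ 2 2) sqrrN.
    have -> : (0 +i* (2 * pi)) ^+ 2 = (- (2 * pi) ^+ 2)%:C :> R[i].
      by apply: complex_eqP => /=; rewrite ?expr2; ring.
    by rewrite -rmorphXn sqrrN -exprM.
  rewrite invfM mulrA; congr (_ * _).
  rewrite /lam fmorph_div /= invf_div; congr (_ / _).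
  by rewrite rmorph_nat; ring.
apply: (@clim_ext _ _ _ _ 0) => N _.
by rewrite psi_scaledE.
Qed.

Lemma inv_sq_sumle : sumle (fun j => (1 + j%:R ^+ 2)^-1 : R) 4.
Proof.
(* Keeping the remainder [2 / N.+1] makes the induction close: the new term is at most
   2/((n+1)(n+2)) = 2/(n+1) - 2/(n+2). *)
suff h N : \sum_(j < N.+1) (1 + j%:R ^+ 2)^-1 <= 4 - 2 / N.+1%:R :> R.
  case=> [|N]; first by rewrite big_ord0.
  by apply: le_trans (h N) _; rewrite gerBl divr_ge0.
elim: N => [|N IH].
  by rewrite big_ord_recl big_ord0 expr0n /= !addr0 invr1; lra.
rewrite big_ord_recr /=; apply: le_trans (lerD IH (lexx _)) _.
have n0 : (0 : R) <= N%:R by [].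
set n : R := N%:R in n0.
have e1 : N.+1%:R = n + 1 :> R by rewrite natr1.
have e2 : N.+2%:R = n + 2 :> R by rewrite -addn2 natrD.
rewrite e1 e2.
have : (1 + (n + 1) ^+ 2)^-1 <= 2 / ((n + 1) * (n + 2)).
  rewrite -div1r ler_pdivrMr; last by have := sqr_ge0 (n + 1); lra.
  rewrite mulrAC ler_pdivlMr; last by rewrite mulr_gt0; lra.
  nra.
have -> : 2 / ((n + 1) * (n + 2)) = 2 / (n + 1) - 2 / (n + 2).
  by field; apply/andP; split; rewrite gt_eqF; lra.
lra.
Qed.

(** The Tannery majorant, uniform in [N]. The modulus [D] of the base of the denominator is bounded
    below twice: by 4/3 |x + s| through [norm_1Bee_ge], applicable once N >= 2|x|, and by a constant
    [c2] depending only on the height. Together 1 + s^2 = O(D^2). *)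
Lemma psi_scaled_dominated z : upper z -> exists C N0, 0 <= C /\
  forall N (s : R), (N0 <= N)%N -> `|s| <= N%:R ->
  cabs (((Q N)%:R ^+ 4)^-1 * psi (ee ((z + s%:C) / (Q N)%:R))) <= C * (1 + s ^+ 2)^-1.
Proof.
move=> hz; set x := complex.Re z; set y := complex.Im z.
have y0 : 0 < y by [].
pose c2 := 2 * pi * y / (1 + 2 * pi * y).
have py : 0 < 2 * pi * y by rewrite mulr_gt0 ?pi2_gt0.
have c20 : 0 < c2 by rewrite divr_gt0 // addr_gt0.
pose K := (1 + 2 * x ^+ 2) / c2 ^+ 2 + 9 / 8.
have K0 : 0 <= K.
  by rewrite addr_ge0 // divr_ge0 // ?exprn_ge0 ?(ltW c20) // addr_ge0 // mulr_ge0 // sqr_ge0.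
exists (6 * K ^+ 2), (Num.trunc (2 * `|x|)).+1.
split; first by rewrite mulr_ge0 // sqr_ge0.
move=> N s N0 sN; set u := z + s%:C.
have hu : upper u by exact: upperDr.
have uI : complex.Im u = y by rewrite ImD addr0.
have uR : complex.Re u = x + s by rewrite ReD.
have xN : 2 * `|x| <= N%:R.
  by apply: le_trans (ltW (truncnS_gt _)) _; rewrite ler_nat.
set q : R := (Q N)%:R.
have q1 : 1 <= q by rewrite ler1n.
have qE : q = 2 * N%:R + 1 by rewrite /q -natr1 natrM.
have q0 : 0 < q by lra.
pose D := q * cabs (1 - ee (u / (Q N)%:R)).
have D1 : 4 / 3 * `|x + s| <= D.
  have hR : `|complex.Re (u / (Q N)%:R)| = `|x + s| / q.
    by rewrite Re_divQ uR normrM [`|_^-1|]ger0_norm // invr_ge0.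
  have := @norm_1Bee_ge R (u / (Q N)%:R).
  rewrite hR Im_divQ uI divr_ge0 ?(ltW y0) // => /(_ isT).
  have h : `|x + s| / q <= 3 / 4.
    rewrite ler_pdivrMr // qE; have := ler_normD x s; have := normr_ge0 x; lra.
  by move=> /(_ h); rewrite mulrA ler_pdivrMr // [D]mulrC.
have D2 : c2 <= D.
  have h : 1 - qr (y / q) <= cabs (1 - ee (u / (Q N)%:R)).
    have := cabsD (1 - ee (u / (Q N)%:R)) (ee (u / (Q N)%:R)).
    by rewrite subrK cabs1 cabs_ee Im_divQ uI -/q; lra.
  have h2 : qr (y / q) * (1 + 2 * pi * y / q) <= 1.
    rewrite /qr expRN mulrC ler_pdivrMr ?expR_gt0 // mul1r mulrA.
    exact: expR_ge1Dx.
  apply: le_trans (ler_wpM2l (ltW q0) h).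
  rewrite /c2 ler_pdivrMr ?addr_gt0 //.
  set t := 2 * pi * y in py h2 *.
  have tq : 0 < t / q by rewrite divr_gt0.
  set r := qr (y / q) in h2 *.
  have r0 : 0 < r by exact: qr_gt0.
  have e : q * (t / q) = t by rewrite mulrCA mulfV ?mulr1 // gt_eqF.
  have h3 : t <= q * (1 - r) * (1 + t / q).
    have : r * (1 + t / q) * q <= q by rewrite ler_piMl // ltW.
    have -> : q * (1 - r) * (1 + t / q) = q + q * (t / q) - r * (1 + t / q) * q by ring.
    by rewrite e -addrA addrCA lerDl subr_ge0.
  apply: le_trans h3 _; rewrite ler_wpM2l //.
    rewrite mulr_ge0 ?(ltW q0) // subr_ge0.
    by apply: le_trans h2; rewrite ler_peMr ?(ltW r0) // lerDl ltW.
  by rewrite lerD2l ler_pdivrMr // ler_peMr // ltW.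
have D0 : 0 < D by exact: lt_le_trans D2.
have KD : 1 + s ^+ 2 <= K * D ^+ 2.
  have a1 : `|x + s| ^+ 2 <= 9 / 16 * D ^+ 2.
    have : (4 / 3 * `|x + s|) ^+ 2 <= D ^+ 2.
      apply: lerXn2r => //; rewrite nnegrE; last exact: ltW.
      by rewrite !mulr_ge0 ?divr_ge0.
    rewrite exprMn; lra.
  rewrite real_normK ?num_real // in a1.
  have a2 : 1 + 2 * x ^+ 2 <= (1 + 2 * x ^+ 2) / c2 ^+ 2 * D ^+ 2.
    rewrite mulrAC ler_pdivlMr ?exprn_gt0 // ler_wpM2l //.
      by have := sqr_ge0 x; lra.
    by rewrite lerXn2r ?nnegrE ?(ltW c20) ?(ltW D0).
  rewrite /K mulrDl.
  have : s ^+ 2 <= 2 * (x + s) ^+ 2 + 2 * x ^+ 2.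
    have := sqr_ge0 (2 * x + s); rewrite !sqrrD; lra.
  lra.
rewrite psi_scaledE // [cabs (_ / _)]cabsM cabsV cabsX [cabs (_%:R * _)]cabsM cabs_nat -/q -/D.
have s1 : 1 <= 1 + s ^+ 2 by rewrite lerDl sqr_ge0.
have s0 : 0 < 1 + s ^+ 2 by lra.
have ee1 : cabs (ee (u / (Q N)%:R)) <= 1.
  by apply: ltW; apply: ee_lt1; apply: upper_div.
rewrite ler_pdivrMr ?exprn_gt0 //.
apply: le_trans (psi_num_le ee1) _.
rewrite mulrAC ler_pdivlMr //.
have : (1 + s ^+ 2) <= K ^+ 2 * D ^+ 4.
  apply: (@le_trans _ _ ((1 + s ^+ 2) ^+ 2)); first by rewrite expr2 ler_peMl ?(ltW s0).
  have -> : K ^+ 2 * D ^+ 4 = (K * D ^+ 2) ^+ 2 by ring.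
  apply: lerXn2r => //; rewrite nnegrE; first exact: ltW.
  by rewrite mulr_ge0 // sqr_ge0.
lra.
Qed.

(** By [psi_distribution] at z - N, the scaled terms Q^-4 psi(e^{2 pi i (z + j)/Q}) with |j| <= N
    sum to psi(e^{2 pi i z}) for every [N], while each tends to (z + j)^-4 / [lam]. *)
Lemma lipschitz z : upper z ->
  clim (fun N => zsum (fun u => (u ^+ 4)^-1) z N) (lam * psi (ee z)).
Proof.
move=> hz; have [C [N0 [C0 hC]]] := psi_scaled_dominated hz.
(* The shift by [N0] brings every index into the range of the majorant. *)
pose g n := (n + N0)%N.
have tg : tends_inf g by apply: tends_inf_ge => n; exact: leq_addr.
pose phi n u := ((Q (g n))%:R ^+ 4)^-1 * psi (ee (u / (Q (g n))%:R)).
pose F n (j : nat) := phi n (z + j.+1%:R) + phi n (z - j.+1%:R).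
pose l (j : nat) := lam^-1 * (((z + j.+1%:R) ^+ 4)^-1 + ((z - j.+1%:R) ^+ 4)^-1).
pose v (j : nat) : R := 2 * C * (1 + j%:R ^+ 2)^-1.
have natC (j : nat) : (j%:R : R[i]) = (j%:R : R)%:C by rewrite rmorph_nat.
have Fv n j : (j < g n)%N -> cabs (F n j) <= v j.
  move=> jg; apply: le_trans (cabsD _ _) _.
  have b (s : R) : `|s| = j.+1%:R -> cabs (phi n (z + s%:C)) <= C * (1 + j%:R ^+ 2)^-1.
    move=> sE; apply: le_trans (hC (g n) s _ _) _; first exact: leq_addl.
      by rewrite sE ler_nat.
    rewrite ler_wpM2l // -(real_normK (num_real s)) sE.
    have j0 : (0 : R) <= j%:R by [].
    rewrite lef_pV2 ?posrE ?ltr_wpDr ?sqr_ge0 // lerD2l -(natr1 j) sqrrD; lra.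
  have := b j.+1%:R (ger0_norm (ler0n _ _)).
  have := b (- j.+1%:R); rewrite normrN ger0_norm // => /(_ erefl).
  rewrite rmorphN /= -natC /v; lra.
have v0 j : 0 <= v j by rewrite !mulr_ge0 // invr_ge0 addr_ge0 // sqr_ge0.
have sv : sumle v (2 * C * 4).
  by move=> N; rewrite -mulr_sumr ler_wpM2l ?mulr_ge0 //; exact: inv_sq_sumle.
have Fl j : clim (fun n => F n j) (l j).
  have /psi_scaled_lim h1 := upper_nat_add j.+1 hz.
  have /psi_scaled_lim h2 := upper_nat_sub j.+1 hz.
  have := climD (clim_comp h1 tg) (clim_comp h2 tg).
  by rewrite -mulrDr.
have lv j : cabs (l j) <= v j.
  apply: (clim_le (N := j.+1) (Fl j)) => n jn; apply: Fv.
  exact: leq_trans jn (leq_addr _ _).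
have [L hL] := csum_abs_lim lv sv.
have hF := clim_dominated Fv sv v0 Fl tg hL.
have hs : lam^-1 * (z ^+ 4)^-1 + L = psi (ee z).
  apply: clim_unique (clim_cst (psi (ee z))).
  apply: (@clim_ext _ _ _ _ 0) (climD (clim_comp (psi_scaled_lim hz) tg) hF) => n _.
  rewrite /F -[LHS]/(zsum (phi n) z (g n)) -sum_symm -mulr_sumr.
  rewrite (psi_distribution (ltn0Sn _) (upper_nat_sub (g n) hz)).
  rewrite mulKf ?expf_neq0 ?pnatr_eq0 //.
  by rewrite eeD eeN ee_nat invr1 mulr1.
have -> : lam * psi (ee z) = (z ^+ 4)^-1 + lam * L.
  by rewrite -hs mulrDr mulVKf ?lam_neq0.
apply: climD; first exact: clim_cst.
apply: (@clim_ext _ _ _ _ 0) (climZ lam hL) => N _.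
by rewrite mulr_sumr; apply: eq_bigr => j _; rewrite /l mulVKf ?lam_neq0.
Qed.

End LipschitzFormula.

(** * The Eisenstein series of weight 4 *)

Section EisensteinSeries.
Variable R : realType.
Implicit Types (q z w u : R[i]).

(** The sum of the cubes of the divisors, written over factorisations of [n] in a box so that the
    Lambert rearrangement is an exchange of finite sums. At [n = 0] the box is empty and the value
    is 0. *)
Definition sigma3 (n : nat) : nat :=
  \sum_(m < n) \sum_(r < n) (if (m.+1 * r.+1 == n)%N then (r.+1 ^ 3)%N else 0%N).

Lemma sum_trunc (V : nmodType) (u : nat -> V) n N : (n <= N)%N ->
  (forall j, (n <= j < N)%N -> u j = 0) -> \sum_(j < N) u j = \sum_(j < n) u j.
Proof.
move=> nN h; rewrite -!(big_mkord xpredT u) (big_cat_nat (leq0n n) nN) /=.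
rewrite [X in _ + X]big_nat [X in _ + X]big1 ?addr0 // => j; exact: h.
Qed.

Lemma sigma3_widen n N : (n <= N)%N -> sigma3 n =
  (\sum_(m < N) \sum_(r < N) (if (m.+1 * r.+1 == n)%N then (r.+1 ^ 3)%N else 0%N))%N.
Proof.
move=> nN; symmetry.
rewrite (@sum_trunc nat (fun m => \sum_(r < N) (if (m.+1 * r.+1 == n)%N then (r.+1 ^ 3)%N else 0%N)) n) //.
  apply: eq_bigr => m _.
  apply: (@sum_trunc nat (fun r => if (m.+1 * r.+1 == n)%N then (r.+1 ^ 3)%N else 0%N)) => //.
  move=> j /andP[nj _]; case: eqP => // e; exfalso.
  have : (j.+1 <= m.+1 * j.+1)%N by rewrite leq_pmull.
  by rewrite e leqNgt ltnS nj.
move=> j /andP[nj _]; apply: big1 => r _; case: eqP => // e; exfalso.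
have : (j.+1 <= j.+1 * r.+1)%N by rewrite leq_pmulr.
by rewrite e leqNgt ltnS nj.
Qed.

Lemma sigma3_ge n : (n ^ 3 <= sigma3 n)%N.
Proof.
case: n => // n; rewrite /sigma3 big_ord_recl /=.
apply: leq_trans (leq_addr _ _).
by rewrite big_ord_recr /= mul1n eqxx leq_addl.
Qed.

Lemma psi_lim_shift q : cabs q < 1 ->
  clim (fun N => \sum_(r < N) r.+1%:R ^+ 3 * q ^+ r.+1) (psi q).
Proof.
move=> q1.
have := clim_comp (psi_lim q1) (tends_inf_ge leqnSn).
apply: (@clim_ext _ _ _ _ 0) => N _.
by rewrite big_ord_recl expr0n /= mul0r add0r.
Qed.

(** Both series are limits of one double sum over (m+1)(r+1) < N. Collected by the product it gives
    [sigma3]; collected by rows it tends to the values of [psi], by Tannery in [r] and then in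
    [m]. *)
Lemma lambert_lim q : cabs q < 1 -> exists L,
  clim (fun N => \sum_(m < N) psi (q ^+ m.+1)) L /\
  clim (fun N => \sum_(n < N) (sigma3 n)%:R * q ^+ n) L.
Proof.
move=> q1; have q0 := cabs_ge0 q.
have hq : 0 <= cabs q < 1 by rewrite q0.
have [C [s [s1 hC]]] := cube_geom_le hq.
have [s0 s1'] := andP s1.
have C0 : 0 <= C by have := hC 0%N; rewrite !expr0 !mulr1 expr0n.
pose V := C * (1 - s)^-1.
have hV N : \sum_(r < N) r.+1%:R ^+ 3 * cabs q ^+ r.+1 <= V.
  have -> : \sum_(r < N) r.+1%:R ^+ 3 * cabs q ^+ r.+1 =
      \sum_(r < N.+1) r%:R ^+ 3 * cabs q ^+ r.
    by rewrite [RHS]big_ord_recl expr0n /= mul0r add0r.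
  apply: (@le_trans _ _ (\sum_(r < N.+1) C * s ^+ r)); first exact: ler_sum.
  by rewrite -mulr_sumr ler_wpM2l // geom_sum_le.
have V0 : 0 <= V by have := hV 0%N; rewrite big_ord0.
pose T N m r : R[i] := if (m.+1 * r.+1 < N)%N then r.+1%:R ^+ 3 * (q ^+ m.+1) ^+ r.+1 else 0.
(* Since (m+1)(r+1) >= m + (r+1), the majorant separates into a factor in [m] and a factor in
   [r]. *)
have Tb N m r : cabs (T N m r) <= cabs q ^+ m * (r.+1%:R ^+ 3 * cabs q ^+ r.+1).
  have h0 : 0 <= cabs q ^+ m * (r.+1%:R ^+ 3 * cabs q ^+ r.+1).
    by rewrite !mulr_ge0 ?exprn_ge0.
  rewrite /T; case: ifP => _; last by rewrite cabs0.
  rewrite cabsM !cabsX cabs_nat mulrCA ler_wpM2l ?exprn_ge0 //.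
  rewrite -exprM -exprD ler_wiXn2l ?(ltW q1) //; nia.
pose F N m := \sum_(r < N) T N m r.
pose v m := cabs q ^+ m * V.
have Fv N m : cabs (F N m) <= v m.
  apply: le_trans (cabs_sum _ _) _.
  apply: (@le_trans _ _ (\sum_(r < N) cabs q ^+ m * (r.+1%:R ^+ 3 * cabs q ^+ r.+1))).
    exact: ler_sum.
  by rewrite -mulr_sumr ler_wpM2l ?exprn_ge0.
have v0 m : 0 <= v m by rewrite mulr_ge0 ?exprn_ge0.
have sv : sumle v ((1 - cabs q)^-1 * V).
  by move=> N; rewrite -mulr_suml ler_wpM2r //; exact: geom_sum_le.
have Fl m : clim (fun N => F N m) (psi (q ^+ m.+1)).
  have qm : cabs (q ^+ m.+1) < 1 by rewrite cabsX exprn_ilt1.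
  apply: (@clim_dominated _ (fun N r => T N m r)
     (fun r => r.+1%:R ^+ 3 * (q ^+ m.+1) ^+ r.+1)
     (fun r => cabs q ^+ m * (r.+1%:R ^+ 3 * cabs q ^+ r.+1)) (cabs q ^+ m * V) id).
  - by move=> *; exact: Tb.
  - by move=> N; rewrite -mulr_sumr ler_wpM2l ?exprn_ge0.
  - by move=> j; rewrite !mulr_ge0 ?exprn_ge0.
  - move=> r; apply: (@clim_ext _ _ _ _ (m.+1 * r.+1).+1) (clim_cst _) => N hN.
    by rewrite /T hN.
  - exact: tends_inf_ge.
  - exact: psi_lim_shift.
have lv m : cabs (psi (q ^+ m.+1)) <= v m by apply: (clim_le (N := 0) (Fl m)) => n _.
have [L hL] := csum_abs_lim lv sv.
exists L; split => //.
have := clim_dominated (g := id) (fun n j _ => Fv n j) sv v0 Fl (tends_inf_ge leqnn) hL.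
apply: (@clim_ext _ _ _ _ 0) => N _.
have -> : \sum_(n < N) (sigma3 n)%:R * q ^+ n = \sum_(n < N) \sum_(m < N) \sum_(r < N)
    (if (m.+1 * r.+1 == n)%N then r.+1%:R ^+ 3 * (q ^+ m.+1) ^+ r.+1 else 0).
  apply: eq_bigr => n _; rewrite (sigma3_widen (ltnW (ltn_ord n))) natr_sum mulr_suml.
  apply: eq_bigr => m _; rewrite natr_sum mulr_suml; apply: eq_bigr => r _.
  case: eqP => [e|_]; last by rewrite mul0r.
  by rewrite natrX -exprM e.
rewrite [RHS]exchange_big /=; apply: eq_bigr => m _.
rewrite [RHS]exchange_big /=; apply: eq_bigr => r _.
rewrite /T; case: ltnP => [lt|le].
  rewrite (bigD1 (Ordinal lt)) //= eqxx big1 ?addr0 // => n nn.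
  case: eqP => // e; exfalso; move/eqP: nn; apply; exact/val_inj.
apply/esym/big1 => n _; case: eqP => // e; exfalso.
by have := ltn_ord n; rewrite -e ltnNge le.
Qed.

Definition inv4 u : R[i] := (u ^+ 4)^-1.

Lemma inv4M u w : inv4 (u * w) = inv4 u * inv4 w.
Proof. by rewrite /inv4 exprMn invfM. Qed.

Lemma inv4N u : inv4 (- u) = inv4 u.
Proof. by rewrite /inv4 (exprM (- u) 2 2) sqrrN -exprM. Qed.

Lemma inv4V u : inv4 u^-1 = u ^+ 4.
Proof. by rewrite /inv4 exprVn invrK. Qed.

(** The form |mz + s|^2 dominates a multiple of m^2 + s^2, and (M^2 + s^2)^2 >= M^2 (1 + s^2) for M
    >= 1. Uniformity in the row length [N] lets rows and columns grow together. *)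
Lemma lattice_row_bound z : upper z -> exists C : R, 0 <= C /\ forall N m,
  cabs (zsum inv4 (m.+1%:R * z) N) <= C * (1 + m%:R ^+ 2)^-1.
Proof.
move=> hz; set x := complex.Re z; set y := complex.Im z.
have y0 : 0 < y by [].
pose K := 2 + (1 + 2 * x ^+ 2) / y ^+ 2.
have K0 : 0 < K.
  by rewrite ltr_pwDl // divr_ge0 ?sqr_ge0 // addr_ge0 // mulr_ge0 // sqr_ge0.
exists (9 * K ^+ 2); split; first by rewrite mulr_ge0 // sqr_ge0.
move=> N m; set M : R := m.+1%:R.
have M1 : 1 <= M by rewrite ler1n.
have M0 : 0 < M by lra.
have ME : (m.+1%:R : R[i]) = M%:C by rewrite /M rmorph_nat.
have key (s : R) : M ^+ 2 + s ^+ 2 <= K * cabs (m.+1%:R * z + s%:C) ^+ 2.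
  rewrite sqr_cabs ME ReD ImD ReM ImM /= !mul0r subr0 !addr0 -/x -/y.
  have a : (1 + 2 * x ^+ 2) * M ^+ 2 = (1 + 2 * x ^+ 2) / y ^+ 2 * (M * y) ^+ 2.
    by field; rewrite gt_eqF.
  have b : 0 <= (1 + 2 * x ^+ 2) / y ^+ 2 * (M * x + s) ^+ 2.
    by rewrite mulr_ge0 ?sqr_ge0 // divr_ge0 ?sqr_ge0 // addr_ge0 // mulr_ge0 // sqr_ge0.
  have c : s ^+ 2 <= 2 * (M * x + s) ^+ 2 + 2 * (M * x) ^+ 2.
    have := sqr_ge0 (2 * (M * x) + s); rewrite !sqrrD; lra.
  have d : 0 <= 2 * (M * y) ^+ 2 by rewrite mulr_ge0 // sqr_ge0.
  rewrite /K mulrDl !mulrDr -a; move: c; rewrite [(M * x) ^+ 2]exprMn; lra.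
have term (s : R) : cabs (inv4 (m.+1%:R * z + s%:C)) <=
    K ^+ 2 * (M ^+ 2)^-1 * (1 + s ^+ 2)^-1.
  rewrite -mulrA; have h := key s; set c := cabs _ in h.
  have s0 : 0 < 1 + s ^+ 2 by rewrite ltr_wpDr ?sqr_ge0.
  have M2 : 1 <= M ^+ 2 by rewrite exprn_ege1.
  have c2 : 0 < c ^+ 2.
    have : 0 < K * c ^+ 2 by apply: lt_le_trans h; have := sqr_ge0 s; lra.
    by rewrite pmulr_rgt0.
  have c4 : c ^+ 4 = c ^+ 2 * c ^+ 2 by ring.
  rewrite /inv4 cabsV cabsX -/c c4 -!invfM.
  have M20 : 0 < M ^+ 2 * (1 + s ^+ 2) by rewrite mulr_gt0 // exprn_gt0.
  rewrite -div1r ler_pdivrMr ?(mulr_gt0 c2 c2) // mulrAC ler_pdivlMr //.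
  have h2 : M ^+ 2 * (1 + s ^+ 2) <= (K * c ^+ 2) * (K * c ^+ 2).
    apply: ler_pM => //; rewrite ?sqr_ge0 ?(ltW s0) //.
      by apply: le_trans h; rewrite lerDl sqr_ge0.
    by apply: le_trans h; rewrite lerD2r.
  lra.
have natC (j : nat) : (j%:R : R[i]) = (j%:R : R)%:C by rewrite rmorph_nat.
have t0 : 0 <= K ^+ 2 * (M ^+ 2)^-1 by rewrite mulr_ge0 ?invr_ge0 ?sqr_ge0.
(* 1 for the central term plus [2 * 4] for the pairs, 4 being the bound of [inv_sq_sumle]. *)
have tot : cabs (zsum inv4 (m.+1%:R * z) N) <= 9 * (K ^+ 2 * (M ^+ 2)^-1).
  set T := K ^+ 2 * _ in term t0 *.
  rewrite /zsum; apply: le_trans (cabsD _ _) _.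
  have h0 := term 0; rewrite addr0 expr0n /= addr0 invr1 mulr1 in h0.
  have h1 : cabs (\sum_(j < N) (inv4 (m.+1%:R * z + j.+1%:R) + inv4 (m.+1%:R * z - j.+1%:R))) <=
     8 * T.
    apply: le_trans (cabs_sum _ (fun j => inv4 (m.+1%:R * z + j.+1%:R) + inv4 (m.+1%:R * z - j.+1%:R))) _.
    apply: (@le_trans _ _ (\sum_(j < N) 2 * T * (1 + j%:R ^+ 2)^-1)).
      apply: ler_sum => j _.
      have j1 : (1 + j.+1%:R ^+ 2)^-1 <= (1 + j%:R ^+ 2)^-1 :> R.
        have j0 : (0 : R) <= j%:R by [].
        rewrite lef_pV2 ?posrE ?ltr_wpDr ?sqr_ge0 // lerD2l -(natr1 j) sqrrD; lra.
      have := term j.+1%:R; have := term (- j.+1%:R).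
      rewrite sqrrN rmorphN /= -natC => b1 b2.
      have b3 := ler_wpM2l t0 j1.
      apply: le_trans (cabsD _ _) _; rewrite -mulrA; lra.
    rewrite -mulr_sumr.
    have := ler_wpM2l t0 (inv_sq_sumle R N); lra.
  lra.
apply: le_trans tot _; rewrite mulrA; apply: ler_wpM2l.
  by rewrite mulr_ge0 // sqr_ge0.
have m0 : (0 : R) <= m%:R by [].
rewrite lef_pV2 ?posrE ?exprn_gt0 ?ltr_wpDr ?sqr_ge0 // /M -(natr1 m) sqrrD; lra.
Qed.

Definition zeta4_part N : R := \sum_(n < N) (n.+1%:R ^+ 4)^-1.

(* Telescoping n^-4 <= (1/3) ((n - 1/2)^-3 - (n + 1/2)^-3) from n = 3 on. *)
Lemma zeta4_bound : sumle (fun n => (n.+1%:R ^+ 4)^-1 : R) (271 / 250).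
Proof.
have t0 n : 0 <= (n.+1%:R ^+ 4)^-1 :> R by rewrite invr_ge0 exprn_ge0.
suff h N : zeta4_part N.+2 <= 17 / 16 + 8 / 3 * (125^-1 - ((2 * N.+2 + 1)%:R ^+ 3)^-1).
  move=> N; apply: le_trans (sum_le_mono t0 (leq_trans (leqnSn N) (leqnSn _))) _.
  apply: le_trans (h N) _.
  have : 0 <= ((2 * N.+2 + 1)%:R ^+ 3)^-1 :> R by rewrite invr_ge0 exprn_ge0.
  lra.
elim: N => [|N IH].
  rewrite /zeta4_part !big_ord_recl big_ord0 /=.
  have -> : ((2 * 2 + 1)%:R ^+ 3)^-1 = 125^-1 :> R by congr (_^-1); ring.
  have -> : ((bump 0 0).+1%:R ^+ 4)^-1 = 16^-1 :> R by congr (_^-1); rewrite /bump /=; ring.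
  by rewrite expr1n invr1; lra.
rewrite /zeta4_part big_ord_recr /= -/(zeta4_part N.+2).
set n : R := N.+3%:R.
have n3 : 3 <= n by rewrite ler_nat.
have -> : (2 * N.+3 + 1)%:R = 2 * n + 1 :> R by rewrite natrD natrM.
have e : (2 * N.+2 + 1)%:R = 2 * n - 1 :> R.
  have -> : n = N.+2%:R + 1 by rewrite natr1.
  by rewrite natrD natrM; ring.
rewrite e in IH.
suff : (n ^+ 4)^-1 <= 8 / 3 * (((2 * n - 1) ^+ 3)^-1 - ((2 * n + 1) ^+ 3)^-1).
  set i1 := ((2 * n - 1) ^+ 3)^-1 in IH *; set i2 := ((2 * n + 1) ^+ 3)^-1.
  by set i3 := (n ^+ 4)^-1; lra.
have d1 : 0 < 2 * n - 1 by lra.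
have d2 : 0 < 2 * n + 1 by lra.
have -> : 8 / 3 * (((2 * n - 1) ^+ 3)^-1 - ((2 * n + 1) ^+ 3)^-1) =
   8 * (24 * n ^+ 2 + 2) / (3 * ((2 * n - 1) ^+ 3 * (2 * n + 1) ^+ 3)).
  by field; rewrite !gt_eqF.
have n0 : 0 < n by lra.
have dd : 0 < 3 * ((2 * n - 1) ^+ 3 * (2 * n + 1) ^+ 3).
  by apply: mulr_gt0 => //; apply: mulr_gt0; apply: exprn_gt0.
rewrite -div1r ler_pdivrMr ?(exprn_gt0 4 n0) // mulrAC ler_pdivlMr // mul1r.
have -> : 3 * ((2 * n - 1) ^+ 3 * (2 * n + 1) ^+ 3) =
   192 * n ^+ 6 - 144 * n ^+ 4 + 36 * n ^+ 2 - 3 by ring.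
have -> : 8 * (24 * n ^+ 2 + 2) * n ^+ 4 = 192 * n ^+ 6 + 16 * n ^+ 4 by ring.
have a2 : 1 <= n ^+ 2 by rewrite exprn_ege1 //; lra.
have a4 : n ^+ 2 <= n ^+ 4 by rewrite ler_weXn2l //; lra.
lra.
Qed.

(** [Z] is zeta(4), about 1.0823. The upper bound is 17/16 + 8/375 (two terms and the telescoped
    tail) rounded up, and it enters [eis_base]. *)
Lemma zeta4_exists : exists Z : R, [/\ 1 <= Z, Z <= 271 / 250 &
  null (fun N => zeta4_part N - Z)].
Proof.
have t0 n : 0 <= (n.+1%:R ^+ 4)^-1 :> R by rewrite invr_ge0 exprn_ge0.
have [Z hZ] := sumle_lim t0 zeta4_bound; exists Z; split => //.
  rewrite leNgt; apply/negP => Z1; have e0 : 0 < (1 - Z) / 2 by rewrite divr_gt0 // subr_gt0.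
  have [N /(_ N.+1 (leqnSn N))] := hZ _ e0.
  have : 1 <= \sum_(n < N.+1) (n.+1%:R ^+ 4)^-1 :> R.
    by rewrite big_ord_recl /= expr1n invr1 lerDl sumr_ge0.
  by move=> h; rewrite ger0_norm; lra.
rewrite leNgt; apply/negP => Z1.
have e0 : 0 < (Z - 271 / 250) / 2 by lra.
have hZ' : null (fun N => zeta4_part N - Z) := hZ.
have [N /(_ N (leqnn N))] := hZ' _ e0.
rewrite ler_norml => /andP[h1 _]; have h : zeta4_part N <= 271 / 250 := zeta4_bound N; lra.
Qed.

(** Half of the sum of (mz + j)^-4 over the square |m|, |j| <= N without the origin: one of each
    pair of opposite points, the row m = 0 giving the partial sum of zeta(4). *)
Definition lattice_part z N : R[i] :=
  (zeta4_part N)%:C + \sum_(m < N) zsum inv4 (m.+1%:R * z) N.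

(** The square is stable under the quarter turn that z -> -1/z induces on (m, j), so the law already
    holds exactly at each finite [N]. *)
Lemma lattice_part_modular z N : upper z ->
  lattice_part (- z^-1) N = z ^+ 4 * lattice_part z N.
Proof.
move=> hz; have z0 := upper_neq0 hz.
pose A : R[i] := (zeta4_part N)%:C.
have AE : A = \sum_(m < N) inv4 m.+1%:R.
  rewrite /A rmorph_sum; apply: eq_bigr => m _.
  by rewrite fmorphV rmorphXn /= rmorph_nat.
pose D w := \sum_(m < N) \sum_(j < N) (inv4 (m.+1%:R * w + j.+1%:R) + inv4 (m.+1%:R * w - j.+1%:R)).
(* The axis m = 0, the axis j = 0, and the points off both axes: inversion exchanges the first two
   and permutes the third. *)
have E w : lattice_part w N = A + (inv4 w * A + D w).
  rewrite /lattice_part /zsum big_split /=; congr (_ + (_ + _)).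
  by rewrite AE mulr_sumr; apply: eq_bigr => m _; rewrite inv4M mulrC.
have DE : D (- z^-1) = z ^+ 4 * D z.
  rewrite /D exchange_big /= mulr_sumr; apply: eq_bigr => m _.
  rewrite mulr_sumr; apply: eq_bigr => j _.
  have -> : j.+1%:R * - z^-1 + m.+1%:R = z^-1 * (m.+1%:R * z - j.+1%:R).
    by rewrite mulrBr mulrN mulrCA mulVf // mulr1 addrC mulrC.
  have -> : j.+1%:R * - z^-1 - m.+1%:R = - (z^-1 * (m.+1%:R * z + j.+1%:R)).
    by rewrite mulrDr opprD mulrN mulrCA mulVf // mulr1 addrC [z^-1 * _]mulrC.
  by rewrite inv4N !inv4M inv4V -mulrDr addrC.
rewrite !E DE inv4N inv4V !mulrDr [X in _ = _ + (X + _)]mulrA.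
have -> : z ^+ 4 * inv4 z = 1 by rewrite /inv4 mulfV // expf_neq0.
by ring.
Qed.

Lemma lattice_part_lim z (Z : R) L : upper z -> null (fun N => zeta4_part N - Z) ->
  clim (fun N => \sum_(m < N) psi (ee z ^+ m.+1)) L ->
  clim (lattice_part z) (Z%:C + lam R * L).
Proof.
move=> hz hZ hL; apply: climD.
  apply: (@null_le _ _ _ 0 (null_norm hZ)) => N _.
  by rewrite -rmorphB cabsC normr_id.
have [C [C0 hC]] := lattice_row_bound hz.
apply: (@clim_dominated _ (fun N m => zsum inv4 (m.+1%:R * z) N)
   (fun m => lam R * psi (ee z ^+ m.+1)) (fun m => C * (1 + m%:R ^+ 2)^-1) (C * 4) id).
- by move=> n j _; exact: hC.
- by move=> N; rewrite -mulr_sumr ler_wpM2l // inv_sq_sumle.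
- by move=> j; rewrite mulr_ge0 // invr_ge0 addr_ge0 // sqr_ge0.
- move=> m; have hmz : upper (m.+1%:R * z).
    have -> : (m.+1%:R : R[i]) = (m.+1%:R : R)%:C by rewrite rmorph_nat.
    by rewrite /upper ImM /= mul0r addr0 mulr_gt0.
  by rewrite -ee_natM; exact: lipschitz.
- exact: tends_inf_ge.
apply: (@clim_ext _ _ _ _ 0) (climZ (lam R) hL) => N _.
by rewrite mulr_sumr.
Qed.

(** The lattice sum divided by zeta(4), so that e(n) = (2 pi)^4/(6 zeta(4)) [sigma3 n] for n >= 1.
    The lower bound comes from [zeta4_exists] and [sigma3_ge]. *)
Lemma eisenstein4 : exists (G : R[i] -> R[i]) (e : nat -> R),
  [/\ has_qexp G (fun n => (e n)%:C),
      forall z, upper z -> G (- z^-1) = z ^+ 4 * G z,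
      e 0%N = 1, forall n, 0 <= e n &
      forall n, (2 * pi) ^+ 4 / (6 * (271 / 250)) * n%:R ^+ 3 <= e n].
Proof.
have [Z [Z1 Z2 hZ]] := zeta4_exists; have Z0 : 0 < Z by lra.
have ZC : (Z%:C : R[i]) != 0 by rewrite -cabs_eq0 cabsC normr_eq0 gt_eqF.
(* The guard inside the existential lets [choice] give one function on all of [R[i]]; off the
   half-plane its value is arbitrary. *)
have ex z : exists L, upper z -> clim (fun N => \sum_(m < N) psi (ee z ^+ m.+1)) L /\
   clim (fun N => \sum_(n < N) (sigma3 n)%:R * ee z ^+ n) L.
  have [hz|hz] := pselect (upper z); last by exists 0.
  by have [L hL] := lambert_lim (ee_lt1 hz); exists L.
have [L hL] := choice ex.
have pp : 0 < (2 * pi) ^+ 4 / 6 :> R by rewrite divr_gt0 // exprn_gt0 // pi2_gt0.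
(* As [sigma3 0 = 0], the indicator alone supplies the constant term. *)
pose e n : R := (n == 0%N)%:R + (2 * pi) ^+ 4 / 6 / Z * (sigma3 n)%:R.
exists (fun z => Z%:C^-1 * (Z%:C + lam R * L z)), e.
have e0 : e 0%N = 1 by rewrite /e eqxx /sigma3 big_ord0 mulr0 addr0.
split=> //.
- apply/has_qexpP => z hz; have [_ h] := hL z hz.
  have := climD (clim_cst 1) (climZ (Z%:C^-1 * lam R) h).
  rewrite mulrDr mulVf // mulrA.
  apply: (@clim_ext _ _ _ _ 1) => -[//|N] _.
  rewrite mulr_sumr big_ord_recl [RHS]big_ord_recl /= e0 !expr0 /sigma3 big_ord0.
  rewrite mul0r mulr0 add0r mulr1; congr (_ + _); apply: eq_bigr => n _.
  rewrite /e /= add0r mulrA; congr (_ * _).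
  rewrite rmorphM /= rmorph_nat; congr (_ * _).
  by rewrite [RHS]rmorphM [in RHS]fmorphV mulrC.
- move=> z hz; have hz' := upper_Ninv hz.
  have [h _] := hL z hz; have [h' _] := hL _ hz'.
  rewrite mulrCA; congr (_ * _).
  apply: clim_unique (lattice_part_lim hz' hZ h') _.
  apply: (@clim_ext _ _ _ _ 0) (climZ (z ^+ 4) (lattice_part_lim hz hZ h)) => N _.
  by rewrite lattice_part_modular.
- by move=> n; rewrite addr_ge0 // mulr_ge0 // divr_ge0 // ltW.
move=> n; apply: (@le_trans _ _ ((2 * pi) ^+ 4 / 6 / Z * (sigma3 n)%:R)); last by rewrite lerDr.
apply: ler_pM.
- by apply: divr_ge0; [apply: exprn_ge0; exact: ltW (pi2_gt0 R)|lra].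
- exact: exprn_ge0.
- rewrite invfM mulrA; apply: ler_wpM2l; first exact: ltW.
  rewrite lef_pV2 ?posrE; lra.
by rewrite -natrX ler_nat sigma3_ge.
Qed.

End EisensteinSeries.

(** * Powers of the Eisenstein series *)

Section EisensteinPowers.
Variable R : realType.

(** Subsets of {0, ..., N} with p + q + 1 elements, classified by their (p+1)-st smallest element
    [j]; the proof is by Pascal's rule. *)
Lemma sum_bin_conv N p q :
  (\sum_(j < N.+1) 'C(j, p) * 'C(N - j, q) = 'C(N.+1, (p + q).+1))%N.
Proof.
elim: N q => [|N IH] q.
  by rewrite big_ord_recl big_ord0 addn0 /= !bin0n; case: p => [|p]; case: q.
rewrite big_ord_recr /= subnn.
case: q => [|q].
  have e : (\sum_(j < N.+1) 'C(j, p) * 'C(N.+1 - j, 0) = 'C(N.+1, p.+1))%N.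
    by have := IH 0%N; rewrite addn0 => <-; apply: eq_bigr => j _; rewrite !bin0.
  by rewrite e bin0 muln1 addn0 binS.
rewrite bin0n muln0 addn0.
have -> : (\sum_(j < N.+1) 'C(j, p) * 'C(N.+1 - j, q.+1) =
   \sum_(j < N.+1) 'C(j, p) * 'C(N - j, q.+1) + \sum_(j < N.+1) 'C(j, p) * 'C(N - j, q))%N.
  rewrite -big_split /=; apply: eq_bigr => j _.
  by rewrite subSn ?binS ?mulnDr // -ltnS.
by rewrite !IH addnS binS.
Qed.

(** The case q = 3 of [sum_bin_conv] with its first [a] terms dropped: they vanish, having an upper
    index below [a <= p]. *)
Lemma sum_bin_shift a p n :
  (a <= p)%N ->
  (\sum_(j < n.+1) 'C(j + a, p) * 'C((n - j).+1, 3) = 'C(n + a + 2, p + 4))%N.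
Proof.
move=> ap.
have e1 : (n + a + 2 = (n + a + 1).+1)%N by lia.
have e2 : (p + 4 = (p + 3).+1)%N by lia.
rewrite e1 e2 -sum_bin_conv.
have -> : (n + a + 1).+1 = (a + (n.+1 + 1))%N by lia.
rewrite !big_split_ord /= [X in _ = (X + _)%N]big1 ?add0n.
  rewrite big_ord1 /= addn0.
  have -> : (n + a + 1 - (a + n.+1) = 0)%N by lia.
  rewrite bin0n muln0 addn0; apply: eq_bigr => j _.
  by have jn := ltn_ord j; rewrite addnC; congr (_ * 'C(_, 3))%N; lia.
by move=> j _; rewrite bin_small ?(leq_trans (ltn_ord j)).
Qed.

Lemma cube_ge_bin n : (6 * 'C(n.+1, 3) <= n ^ 3)%N.
Proof.
have -> : (6 * 'C(n.+1, 3) = n.+1 ^_ 3)%N by rewrite -bin_ffact mulnC.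
rewrite !ffactnS ffactn0 /= muln1.
case: n => [|[|n]] //=; nia.
Qed.

(** The c with e(n) >= c C(n+1, 3) for E_4: the factor 6 in n^3 >= 6 C(n+1, 3) cancels the 6 of
    [eisenstein4]. *)
Definition eis_base : R := (2 * pi) ^+ 4 * (250 / 271).

Lemma eis_base_gt0 : 0 < eis_base.
Proof. by apply: mulr_gt0; [apply: exprn_gt0; exact: pi2_gt0|lra]. Qed.

(** The numbers C(n+1, 3) are the coefficients of q^2/(1-q)^4, whose power m+1 has the coefficients
    C(n+2m+1, 4m+3). Nonnegativity lets termwise lower bounds multiply. *)
Lemma eisenstein_power m : exists (G : R[i] -> R[i]) (e : nat -> R),
  [/\ has_qexp G (fun n => (e n)%:C),
      forall z, upper z -> G (- z^-1) = z ^+ (4 * m.+1) * G z,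
      e 0%N = 1, forall n, 0 <= e n &
      forall n, eis_base ^+ m.+1 * ('C(n + 2 * m + 1, 4 * m + 3))%:R <= e n].
Proof.
have [G4 [e4 [q4 mod4 e40 e4ge0 e4ge]]] := eisenstein4 R.
have A0 := eis_base_gt0.
have e4bin n : eis_base * 'C(n.+1, 3)%:R <= e4 n.
  apply: le_trans (e4ge n).
  have -> : eis_base * 'C(n.+1, 3)%:R = (2 * pi) ^+ 4 / (6 * (271 / 250)) * (6 * 'C(n.+1, 3))%:R.
    by rewrite natrM /eis_base; field.
  rewrite -natrX; apply: ler_wpM2l; last by rewrite ler_nat cube_ge_bin.
  by apply: divr_ge0; [apply: exprn_ge0; apply: ltW; exact: pi2_gt0|lra].
elim: m => [|m [G [e [qG modG e0 ege0 ege]]]].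
  exists G4, e4; split => // n; rewrite expr1 muln0 addn0 add0n addn1; exact: e4bin.
exists (fun z => G z * G4 z), (fun n => \sum_(i < n.+1) e i * e4 (n - i)%N).
split.
- move=> z hz; have /has_qexpP h := qexpM qG q4.
  apply/cseries_toP; apply: (@clim_ext _ _ _ _ 0) (h z hz) => N _.
  apply: eq_bigr => n _; rewrite qpowX; congr (_ * _).
  by rewrite rmorph_sum; apply: eq_bigr => i _; rewrite rmorphM.
- move=> z hz; rewrite modG // mod4 //.
  have -> : (4 * m.+2 = 4 * m.+1 + 4)%N by lia.
  by rewrite exprD; ring.
- by rewrite big_ord_recl big_ord0 subn0 e0 e40 mulr1 addr0.
- by move=> n; apply: sumr_ge0 => i _; rewrite mulr_ge0.
move=> n.
have -> : (n + 2 * m.+1 + 1 = n + (2 * m + 1) + 2)%N by lia.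
have -> : (4 * m.+1 + 3 = (4 * m + 3) + 4)%N by lia.
rewrite -sum_bin_shift; last lia.
rewrite natr_sum mulr_sumr; apply: ler_sum => i _.
rewrite natrM exprSr mulrACA addnA; apply: ler_pM => //; rewrite mulr_ge0 ?exprn_ge0 //; exact: ltW.
Qed.

Lemma ffact_ge N j : ((N - j) ^ j <= N ^_ j)%N.
Proof.
elim: j N => [|j IH] N; first by rewrite expn0 ffactn0.
rewrite expnS ffactnS leq_mul ?leq_subr //.
by have -> : (N - j.+1 = N.-1 - j)%N by lia.
Qed.

(** The falling factorial has 4m+3 factors, each at least (n + 2m + 1) - (4m + 3) = n - 2(m+1). *)
Lemma eis_bin_ge m n : (2 * m.+1 <= n)%N ->
  (n%:R - (2 * m.+1)%:R) ^+ (4 * m + 3) <=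
  'C(n + 2 * m + 1, 4 * m + 3)%:R * ((4 * m + 3)`!)%:R :> R.
Proof.
move=> mn; rewrite -natrM bin_ffact -natrB // -natrX ler_nat.
by apply: leq_trans (ffact_ge _ _); rewrite leq_exp2r; lia.
Qed.

End EisensteinPowers.

(** * Comparison with the Eisenstein power *)

Section Tail.
Variable R : realType.

(** With x = pi n/Y, e^{-2 pi n/Y} splits as e^{-x} e^{-x/2} e^{-x/2}: the first factor pays for
    n^p, the second is the gain from n > T, the third is summed geometrically. The leading [qr]
    comes from Hecke's bound. *)
Definition tail_factor (p : nat) (Y T : R) : R :=
  qr (- Y^-1) * (p%:R ^+ p * expR (- p%:R) * (Y / pi) ^+ p) *
  expR (- (pi * T / (2 * Y))) * (1 - expR (- (pi / (2 * Y))))^-1.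

Lemma tail_term (p n : nat) (Y T : R) : (0 < p)%N -> 0 < Y -> T <= n%:R ->
  n%:R ^+ p * qr Y^-1 ^+ n <= (p%:R ^+ p * expR (- p%:R) * (Y / pi) ^+ p) *
  expR (- (pi * T / (2 * Y))) * expR (- (pi / (2 * Y))) ^+ n.
Proof.
move=> p0 Y0 Tn; have pi0 := pi_gt0 R.
set x := pi * n%:R / Y.
have x0 : 0 <= x by rewrite divr_ge0 ?mulr_ge0 ?pi_ge0 // ltW.
have nE : n%:R = x * (Y / pi) by rewrite /x mulrA divfK ?gt_eqF // mulrAC divff ?gt_eqF // mul1r.
have sE : qr Y^-1 ^+ n = expR (- x) * (expR (- (x / 2)) * expR (- (x / 2))).
  rewrite qrX -!expRD; congr expR; rewrite /x; field; by rewrite gt_eqF.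
have h1 := powX_expRN_le p0 x0.
have h2 : expR (- (x / 2)) <= expR (- (pi * T / (2 * Y))).
  rewrite ler_expR lerN2 /x.
  have -> : pi * n%:R / Y / 2 = pi * n%:R / (2 * Y) by field; rewrite gt_eqF.
  by rewrite ler_wpM2r ?invr_ge0 ?mulr_ge0 ?(ltW Y0) // ler_wpM2l ?pi_ge0.
have h3 : expR (- (x / 2)) = expR (- (pi / (2 * Y))) ^+ n.
  by rewrite -expRM_natl; congr expR; rewrite /x; field; rewrite gt_eqF.
rewrite sE {1}nE -h3.
set E1 := expR (- (x / 2)) in h2 *.
have E0 : 0 <= E1 by exact: expR_ge0.
have Yp : 0 <= (Y / pi) ^+ p by rewrite exprn_ge0 // divr_ge0 ?pi_ge0 ?(ltW Y0).
have -> : (x * (Y / pi)) ^+ p * (expR (- x) * (E1 * E1)) =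
    (x ^+ p * expR (- x)) * (Y / pi) ^+ p * E1 * E1 by rewrite exprMn; ring.
rewrite ler_wpM2r //.
apply: ler_pM => //; first by apply: mulr_ge0 => //; rewrite mulr_ge0 ?exprn_ge0 ?expR_ge0.
by rewrite ler_wpM2r.
Qed.

Variables (p : nat) (f : R[i] -> R[i]) (b : nat -> R[i]).
Hypotheses (p_gt0 : (0 < p)%N) (fb : has_qexp f b) (b0 : b 0%N = 0).
Hypothesis f_modular : forall z, upper z -> f (- z^-1) = z ^+ (2 * p) * f z.
Variables (Y T : R).
Hypotheses (Y2 : 2 <= Y) (tail60 : tail_factor p Y T <= 60^-1).

Let t n : R := if T < n%:R then cabs (b n) * qr Y^-1 ^+ n else 0.

(** The coefficient bound is proportional to [B], so the part beyond [T] is a fraction of the whole.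
    Used three times in [coef_bound], B/60 becomes B/20. *)
Lemma cusp_tail B : sumle (fun n => cabs (b n) * qr Y^-1 ^+ n) B -> sumle t (B / 60).
Proof.
move=> hB N; have B0 : 0 <= B by have := hB 0%N; rewrite big_ord0.
have Y0 : 0 < Y by apply: lt_le_trans Y2.
set r := expR (- (pi / (2 * Y))).
have r0 : 0 <= r by exact: expR_ge0.
have r1 : r < 1 by rewrite /r expR_lt1 oppr_lt0 divr_gt0 ?pi_gt0 // mulr_gt0.
set K := qr (- Y^-1) * (p%:R ^+ p * expR (- p%:R) * (Y / pi) ^+ p) * expR (- (pi * T / (2 * Y))).
have K0 : 0 <= K.
  apply: mulr_ge0; last exact: expR_ge0.
  apply: mulr_ge0; first exact: qr_ge0.
  apply: mulr_ge0; first by apply: mulr_ge0; [exact: exprn_ge0|exact: expR_ge0].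
  by apply: exprn_ge0; apply: divr_ge0; [exact: ltW|exact: pi_ge0].
have tle n : t n <= B * K * r ^+ n.
  rewrite /t; case: ltP => [lt|_]; last by apply: mulr_ge0; [exact: mulr_ge0|exact: exprn_ge0].
  have h1 := cusp_coef_bound p_gt0 fb b0 f_modular n Y2 hB.
  have h2 := tail_term p_gt0 Y0 (ltW lt).
  apply: le_trans (ler_wpM2r (exprn_ge0 n (qr_ge0 Y^-1)) h1) _.
  rewrite -[X in X <= _]mulrA; apply: le_trans (ler_wpM2l _ h2) _; first by rewrite mulr_ge0 ?qr_ge0.
  rewrite /K -/r le_eqVlt; apply/orP; left; apply/eqP; ring.
apply: (@le_trans _ _ (\sum_(n < N) B * K * r ^+ n)); first exact: ler_sum.
rewrite -mulr_sumr; apply: (@le_trans _ _ (B * K * (1 - r)^-1)).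
  by rewrite ler_wpM2l ?(mulr_ge0 B0 K0) // geom_sum_le // r0.
by rewrite -mulrA ler_wpM2l.
Qed.

(** With no coefficients up to [T] the whole sum is tail, so its least bound satisfies B <= B/60 and
    vanishes. *)
Lemma cusp_vanish : (forall n, n%:R <= T -> b n = 0) -> forall n, b n = 0.
Proof.
move=> hT n.
have Yi : 0 < Y^-1 by rewrite invr_gt0; apply: lt_le_trans Y2.
have [V hV] := qexp_summable fb Yi.
have [B [hB hm]] := sumle_sup hV.
have B0 : 0 <= B by have := hB 0%N; rewrite big_ord0.
have B60 : B <= B / 60.
  apply: hm => N; apply: le_trans (cusp_tail hB N); apply: ler_sum => j _.
  rewrite /t; case: ltP => // /hT ->; by rewrite cabs0 mul0r.
have Bz : B = 0 by lra.
have := cusp_coef_bound p_gt0 fb b0 f_modular n Y2 hB.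
rewrite Bz mulr0 mul0r => h; apply/eqP; rewrite -cabs_eq0.
by rewrite eq_le h cabs_ge0.
Qed.

End Tail.

(** * Reality of the coefficients and comparison of f with the Eisenstein power *)

Section Comparison.
Variable R : realType.

Lemma ee_imag (y : R) : ee (0 +i* y) = (qr y)%:C.
Proof.
rewrite /ee /qpow /= !mulr0 cos0 sin0 mulr1 mulr0.
by apply: complex_eqP; rewrite //= /qr mulr1 mulNr.
Qed.

Variables (m : nat) (f G : R[i] -> R[i]) (a : nat -> R[i]) (e : nat -> R) (Y T : R).
Let k := (4 * m.+1)%N.
Let p := (2 * m.+1)%N.
Hypotheses (fa : has_qexp f a) (Ge : has_qexp G (fun n => (e n)%:C)).
Hypotheses (f_modular : forall z, upper z -> f (- z^-1) = z ^+ k * f z).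
Hypotheses (G_modular : forall z, upper z -> G (- z^-1) = z ^+ k * G z).
Hypotheses (a0 : a 0%N = 1) (e0 : e 0%N = 1) (e_ge0 : forall n, 0 <= e n).
Hypothesis a_ge0 : forall n, (0 < n)%N -> n%:R <= T -> 0 <= a n.
Hypotheses (Y2 : 2 <= Y) (tail60 : tail_factor p Y T <= 60^-1).

Let kE : k = (2 * p)%N. Proof. by rewrite /k /p; lia. Qed.
Let p_gt0 : (0 < p)%N. Proof. by []. Qed.

Lemma coef_real n : complex.Im (a n) = 0.
Proof.
pose b n := a n - conjc (a n).
have fb := qexpB fa (qexpJ fa).
have mod_b z : upper z -> (fun z => f z - conjc (f (- conjc z))) (- z^-1) =
    z ^+ (2 * p) * (fun z => f z - conjc (f (- conjc z))) z.
  move=> hz /=; have hz' : upper (- conjc z).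
    by case: z hz => x y; rewrite /upper /= opprK.
  have -> : - conjc (- z^-1) = - (- conjc z)^-1.
    by rewrite rmorphN /= conjc_inv invrN.
  rewrite !f_modular // mulrBr -kE; congr (_ - _).
  (* Conjugating (-conj z)^k gives (-z)^k, which is z^k because [k] is even. *)
  rewrite rmorphM rmorphXn; congr (_ * _).
  rewrite rmorphN /= conjcK kE mulnC exprM (exprM _ p 2).
  by rewrite -!exprM !(mulnC p 2) !exprM sqrrN.
have b0 : b 0%N = 0 by rewrite /b a0 conjc1 subrr.
(* In the order of [R[i]], [0 <= a j] includes that [a j] is real. *)
have b_small j : j%:R <= T -> b j = 0.
  case: j => [//|j] jT; have := a_ge0 (ltn0Sn j) jT => /ger0_Im h.
  by rewrite /b; case: (a j.+1) h => x y /= ->; rewrite oppr0 subrr.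
have := cusp_vanish p_gt0 fb b0 mod_b Y2 tail60 b_small n.
rewrite /b; case: (a n) => x y /=; case=> _; lra.
Qed.

Hypothesis Y_half : Y ^+ k * qr (Y - Y^-1) <= 2^-1.

Let w n : R := qr Y^-1 ^+ n - Y ^+ k * qr Y ^+ n.

Lemma theta_balance (h : R[i] -> R[i]) (c : nat -> R[i]) : has_qexp h c ->
  (forall z, upper z -> h (- z^-1) = z ^+ k * h z) ->
  null (fun N => \sum_(n < N) complex.Re (c n) * w n).
Proof.
move=> hc hmod; have Y0 : 0 < Y by apply: lt_le_trans Y2.
have u1 : upper (0 +i* Y) by [].
have u2 : upper (0 +i* Y^-1) by rewrite /upper /= invr_gt0.
have e1 := proj1 (has_qexpP h c) hc _ u1.
have e2 := proj1 (has_qexpP h c) hc _ u2.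
have hY : h (0 +i* Y^-1) = (Y ^+ k)%:C * h (0 +i* Y).
  have -> : 0 +i* Y^-1 = - (0 +i* Y)^-1.
    apply: complex_eqP => /=; first by rewrite mul0r oppr0.
    by rewrite expr0n /= add0r opprK expr2 invfM mulVKf // gt_eqF.
  rewrite hmod //; congr (_ * _).
  have -> : 0 +i* Y = (0 +i* 1) * Y%:C.
    by apply: complex_eqP => /=; ring.
  rewrite exprMn rmorphXn /k exprM.
  (* i^k = 1 because 4 divides [k]; this fixes the sign of the second weight. *)
  have -> : (0 +i* 1 : R[i]) ^+ 4 = 1.
    by rewrite [_ ^+ 4](exprM _ 2 2) sqr_i sqrrN expr1n.
  by rewrite expr1n mul1r.
have hn := clim_Re (climB e2 (climZ (Y ^+ k)%:C e1)).
apply: (@null_le _ _ _ 0 (null_norm hn)) => N _.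
rewrite hY subrr subr0 mulr_sumr -sumrB.
rewrite (Re_sum _ (fun n => c n * ee (0 +i* Y^-1) ^+ n - (Y ^+ k)%:C * (c n * ee (0 +i* Y) ^+ n))).
rewrite le_eqVlt; apply/orP; left; apply/eqP.
congr (`| _ |); apply: eq_bigr => n _.
by rewrite !ee_imag -!rmorphXn ReB !ReM /w /=; ring.
Qed.

(** Summing a termwise bound: the balance makes the part linear in the coefficients tend to 0, the
    index 0 contributes 4 (Y^k - 1), and the indices beyond [T] cost three times the tail. *)
Lemma coef_bound B : sumle (fun n => cabs (a n - (e n)%:C) * qr Y^-1 ^+ n) B ->
  (forall B', sumle (fun n => cabs (a n - (e n)%:C) * qr Y^-1 ^+ n) B' -> B <= B') ->
  B <= B / 20 + 4 * Y ^+ k.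
Proof.
pose b n := a n - (e n)%:C; rewrite -/b => hB hm.
have fb : has_qexp (fun z => f z - G z) b := qexpB fa Ge.
have mod_b z : upper z -> (fun z => f z - G z) (- z^-1) = z ^+ (2 * p) * (fun z => f z - G z) z.
  by move=> hz /=; rewrite f_modular // G_modular // mulrBr kE.
have b0 : b 0%N = 0 by rewrite /b a0 e0 subrr.
have hT := cusp_tail p_gt0 fb b0 mod_b Y2 tail60 hB.
have Y0 : 0 < Y by apply: lt_le_trans Y2.
have Yge1 : 1 <= Y by apply: le_trans Y2; rewrite ler1n.
have Y1 : 1 <= Y ^+ k by rewrite exprn_ege1.
pose P n := cabs (b n) * qr Y^-1 ^+ n.
pose t n : R := if T < n%:R then P n else 0.
have nf := theta_balance fa f_modular; have ng := theta_balance Ge G_modular.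
have P0 n : 0 <= P n by rewrite mulr_ge0 ?cabs_ge0 ?exprn_ge0 ?qr_ge0.
(* At n = 0 the last term offsets 2 * 2 * w(0) = -4 (Y^k - 1). For n <= T, |b n| <= Re a(n) + e(n),
   and |q|^n <= 2 w(n) by [Y_half]. For n > T the linear part is at least -2 P(n), and 3 t(n) makes
   up for it. *)
have pt n : P n <= 2 * ((complex.Re (a n) + e n) * w n) + 3 * t n + (n == 0%N)%:R * (4 * (Y ^+ k - 1)).
  have [->|n0] := eqVneq n 0%N.
    have t0 : 0 <= t 0%N by rewrite /t; case: ifP.
    rewrite /P b0 cabs0 a0 e0 /w !expr0 /=; lra.
  have p0 : 0 <= qr Y^-1 ^+ n by rewrite exprn_ge0 ?qr_ge0.
  have w_lo : qr Y^-1 ^+ n <= 2 * w n.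
    have qE : qr Y = qr (Y - Y^-1) * qr Y^-1 by rewrite -qrD subrK.
    have h1 : qr (Y - Y^-1) ^+ n <= qr (Y - Y^-1).
      case: n n0 {p0} => // n _; rewrite exprS ler_piMr ?qr_ge0 // exprn_ile1 ?qr_ge0 //.
      rewrite /qr expR_le1 oppr_le0 mulr_ge0 ?mulr_ge0 ?pi_ge0 // subr_ge0.
      by apply: (@le_trans _ _ 1); [rewrite invf_le1|].
    have h2 : Y ^+ k * qr Y ^+ n <= 2^-1 * qr Y^-1 ^+ n.
      rewrite qE exprMn mulrA ler_wpM2r //; apply: le_trans Y_half.
      by rewrite ler_wpM2l // exprn_ge0 // ltW.
    rewrite /w; lra.
  have w_hi : w n <= qr Y^-1 ^+ n.
    by rewrite /w gerBl mulr_ge0 ?exprn_ge0 ?qr_ge0 // ltW.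
  have w0 : 0 <= w n by lra.
  rewrite mul0r addr0 /t; case: ltP => [lt|le].
    have reb : - cabs (b n) <= complex.Re (a n) + e n.
      have := norm_Re_le (b n); rewrite ler_norml => /andP[h _].
      by move: h; rewrite /b ReB /= => h; have := e_ge0 n; lra.
    have := ler_wpM2r w0 reb; have := ler_wpM2l (cabs_ge0 (b n)) w_hi.
    rewrite /P; lra.
  have n1 : (0 < n)%N by rewrite lt0n.
  have an0 := a_ge0 n1 le.
  have bn : cabs (b n) <= complex.Re (a n) + e n.
    rewrite /b; apply: le_trans (cabsB _ _) _; rewrite cabsC ger0_norm // lerD2r.
    have := an0; rewrite lecE /= => /andP[/eqP h1 h2].
    by apply: le_trans (cabs_le_ReIm _) _; rewrite h1 normr0 addr0 ger0_norm.
  rewrite mulr0 addr0 /P.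
  have s0 : 0 <= complex.Re (a n) + e n := le_trans (cabs_ge0 _) bn.
  have := ler_pM (cabs_ge0 _) p0 bn w_lo; lra.
apply: hm => N; apply/ler_addgt0Pl => eps eps0.
have [M hM] := nullD nf ng (divr_gt0 eps0 (ltr0n _ 2)).
pose N' := (maxn N M).+1.
have NN' : (N <= N')%N by rewrite /N'; lia.
have MN' : (M <= N')%N by rewrite /N'; lia.
apply: le_trans (sum_le_mono P0 NN') _.
apply: (@le_trans _ _ (\sum_(n < N') (2 * ((complex.Re (a n) + e n) * w n) + 3 * t n +
    ((n : nat) == 0%N)%:R * (4 * (Y ^+ k - 1))))).
  by apply: ler_sum => n _; exact: pt.
rewrite !big_split /= -!mulr_sumr.
have hS := hM _ MN'.
have e1 : \sum_(i < N') (complex.Re (a i) + e i) * w i =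
    \sum_(n < N') complex.Re (a n) * w n + \sum_(n < N') complex.Re (e n)%:C * w n.
  by rewrite -big_split /=; apply: eq_bigr => i _; rewrite mulrDl.
have e2 : \sum_(i < N') ((i : nat) == 0%N)%:R * (4 * (Y ^+ k - 1)) = 4 * (Y ^+ k - 1).
  by rewrite /N' big_ord_recl /= mul1r big1 ?addr0 // => i _; rewrite mul0r.
rewrite e1 e2; have := hT N'; rewrite -/t => hT'.
move: hS; rewrite ler_norml => /andP[_ hS]; lra.
Qed.

(** The inequality of [coef_bound] solves to B <= 80/19 Y^k, since 4/(1 - 1/20) = 80/19; Hecke's
    bound does the rest. *)
Lemma coef_compare n : (0 < n)%N ->
  cabs (a n - (e n)%:C) <= qr (- Y^-1) * (80 / 19 * Y ^+ k) * n%:R ^+ p.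
Proof.
move=> n0; have fb := qexpB fa Ge.
have mod_b z : upper z -> (fun z => f z - G z) (- z^-1) = z ^+ (2 * p) * (fun z => f z - G z) z.
  by move=> hz /=; rewrite f_modular // G_modular // mulrBr kE.
have b0 : a 0%N - (e 0%N)%:C = 0 by rewrite a0 e0 subrr.
have Yi : 0 < Y^-1 by rewrite invr_gt0; apply: lt_le_trans Y2.
have [V hV] := qexp_summable fb Yi.
have [B [hB hm]] := sumle_sup hV.
have B_le := coef_bound hB hm.
apply: le_trans (cusp_coef_bound p_gt0 fb b0 mod_b n Y2 hB) _.
rewrite ler_wpM2r ?exprn_ge0 // ler_wpM2l ?qr_ge0 //; lra.
Qed.

End Comparison.

(** * Numerical estimates *)

Section Numerics.
Variable R : realType.

(** Two angle doublings from x = 31/80, where cos x >= 1 - x^2/2, show cos(31/20) > 0, which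
    excludes pi/2 < 31/20. *)
Lemma pi_ge31 : 31 / 10 <= pi :> R.
Proof.
rewrite leNgt; apply/negP => pi_lt.
have pi0 := pi_gt0 R; have pi2 := pi_ge2 R.
pose x : R := 31 / 80.
have c1 : 61 / 66 <= cos x.
  have [_] := norm_cosB1_le x; rewrite ler_norml => /andP[h _].
  by move: h; rewrite /x !expr2; lra.
have dbl (y c : R) : 0 <= c -> c <= cos y -> 2 * (c * c) - 1 <= cos (y *+ 2).
  move=> c0 h; rewrite cos_mulr2n mulr2n expr2.
  have := ler_pM c0 c0 h h; lra.
have c2 : 17 / 24 <= cos (x *+ 2) by apply: le_trans (dbl _ _ _ c1); lra.
have c3 : 0 < cos (x *+ 2 *+ 2).
  apply: lt_le_trans (dbl _ _ _ c2); lra.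
have x4 : x *+ 2 *+ 2 = 31 / 20.
  by rewrite -mulrnA -[(2 * 2)%N]/4%N -[LHS]mulr_natl /x; lra.
have le : pi / 2 <= x *+ 2 *+ 2 by rewrite x4; lra.
have : cos (x *+ 2 *+ 2) <= cos (pi / 2).
  rewrite leNgt ltr_cos ?in_itv /=.
  - by rewrite -leNgt.
  - by rewrite ?x4; apply/andP; split; lra.
  - by rewrite ?x4; apply/andP; split; lra.
by rewrite cos_pihalf leNgt c3.
Qed.

Lemma pi_le4 : pi <= 4 :> R.
Proof. by have := pihalf_lt2 R; lra. Qed.

(** From 1 + t <= e^t at t = 1/8 and t = -1/8, squared three times with rounding down at each
    stage. *)
Lemma expR1_bounds : (5 / 2 : R) <= expR (1 : R) <= 3.
Proof.
have e8 : expR (8%:R^-1 : R) ^+ 8 = expR 1.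
  by rewrite -expRM_natl mulfV ?pnatr_eq0.
have n8 : expR (- 8%:R^-1 : R) ^+ 8 = (expR 1)^-1.
  by rewrite -expRM_natl mulrN mulfV ?pnatr_eq0 // expRN.
have sq (c y : R) : 0 <= c -> c <= y -> c * c <= y ^+ 2.
  by move=> c0 h; rewrite expr2 ler_pM.
have pow8 (y : R) : y ^+ 8 = ((y ^+ 2) ^+ 2) ^+ 2 by rewrite -!exprM.
apply/andP; split.
  have a1 : 9 / 8 <= expR (8%:R^-1 : R) by apply: le_trans (expR_ge1Dx _); lra.
  rewrite -e8 pow8.
  have a2 : 5 / 4 + 1 / 100 <= expR (8%:R^-1 : R) ^+ 2 by apply: le_trans (sq _ _ _ a1); lra.
  have a3 : 19 / 12 <= (expR (8%:R^-1 : R) ^+ 2) ^+ 2 by apply: le_trans (sq _ _ _ a2); lra.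
  by apply: le_trans (sq _ _ _ a3); lra.
have a1 : 7 / 8 <= expR (- 8%:R^-1 : R) by apply: le_trans (expR_ge1Dx _); lra.
rewrite -[leRHS]invrK -[leLHS]invrK lef_pV2 ?posrE ?invr_gt0 ?expR_gt0 // -n8 pow8.
have a2 : 13 / 17 <= expR (- 8%:R^-1 : R) ^+ 2 by apply: le_trans (sq _ _ _ a1); lra.
have a3 : 7 / 12 <= (expR (- 8%:R^-1 : R) ^+ 2) ^+ 2 by apply: le_trans (sq _ _ _ a2); lra.
by apply: le_trans (sq _ _ _ a3); lra.
Qed.

(** Below, e^4 <= 3^4 < 92. Above, 92 < (5/2)^5 and the tangent at 92 give ln x <= 4 + x/92. *)
Lemma ln_bounds (x : R) : 92 <= x -> 4 <= ln x <= x / 16.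
Proof.
move=> x92; have x0 : 0 < x by lra.
have [e1 e2] := andP expR1_bounds.
have lnk : expR (ln x) = x by rewrite lnK.
have e0 : 0 <= expR 1 :> R by exact: expR_ge0.
apply/andP; split.
  rewrite -ler_expR lnk.
  have -> : 4 = 4%:R * 1 :> R by rewrite mulr1.
  rewrite expRM_natl; apply: le_trans x92.
  apply: (@le_trans _ _ (3 ^+ 4)); first by rewrite lerXn2r ?nnegrE.
  by rewrite !exprS expr0; lra.
have l92 : ln 92 <= 5 :> R.
  rewrite -ler_expR lnK ?posrE //.
  have -> : 5 = 5%:R * 1 :> R by rewrite mulr1.
  rewrite expRM_natl; apply: (@le_trans _ _ ((5 / 2) ^+ 5)).
    by rewrite !exprS expr0; lra.
  by rewrite lerXn2r ?nnegrE ?divr_ge0.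
have : ln (1 + (x / 92 - 1)) <= x / 92 - 1 by apply: le_ln1Dx; lra.
rewrite addrC subrK ln_div ?posrE //; lra.
Qed.

(** The binomial expansion cut after degree two; at t = 1/M it gives (1 + 1/M)^M >= 5/2 - 1/(2M). *)
Lemma pow_one_plus_ge (t : R) M : 0 <= t ->
  1 + M%:R * t + M%:R * (M%:R - 1) / 2 * t ^+ 2 <= (1 + t) ^+ M.
Proof.
move=> t0; elim: M => [|M IH]; first by rewrite expr0; lra.
have t1 : 0 <= 1 + t by lra.
rewrite (exprS _ M); apply: le_trans (ler_wpM2l t1 IH).
rewrite -(natr1 M); set n : R := M%:R.
have -> : (1 + t) * (1 + n * t + n * (n - 1) / 2 * t ^+ 2) =
   1 + (n + 1) * t + (n + 1) * (n + 1 - 1) / 2 * t ^+ 2 + n * (n - 1) / 2 * t ^+ 3 by field.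
rewrite lerDl mulr_ge0 ?exprn_ge0 // divr_ge0 //.
rewrite /n; case: M {IH n} => [|M]; first by rewrite mul0r.
by rewrite mulr_ge0 // subr_ge0 ler1n.
Qed.

(* 2658/100 is an upper bound for 7316^2 (271/250) / (2 pi)^8. *)
Lemma fact_bound_base :
  (6 * (4 * 23) ^ 5 * (4 * 23)`! * 2658 ^ 23 <=
   64 * (62 * 118) * 100 ^ 23 * (4 * 23) ^ (4 * 23))%N.
Proof.
have -> : (4 * 23 = 92)%N by [].
by rewrite !factS fact0; lia.
Qed.

Lemma fact_bound_cast (a b c d g h x y z : nat) :
  (a * b ^ x * c * d ^ y <= g * h ^ y * b ^ z)%N ->
  a%:R * b%:R ^+ x * c%:R * d%:R ^+ y <= g%:R * h%:R ^+ y * b%:R ^+ z :> R.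
Proof. by rewrite -(ler_nat R) !natrM !natrX. Qed.

(** The growth of both sides of [fact_bound] from M to M+1, with k = 4M: [U] is (1 + 1/M)^{4M} and
    [v] is (1 + 1/M)^5. It closes because 5/4 * 26.58 < 37. *)
Lemma fact_bound_step (k v U A B : R) : 0 <= k -> 0 <= v -> v <= 5 / 4 -> 37 <= U ->
  0 <= A -> A <= B ->
  A * (v * ((k + 4) * (k + 3) * (k + 2) * (k + 1)) * 2658) <=
  B * ((k + 4) ^+ 4 * (U * 100)).
Proof.
move=> k0 v0 v1 U1 A0 AB.
have P0 : 0 <= (k + 4) * (k + 3) * (k + 2) * (k + 1).
  by apply: mulr_ge0; [apply: mulr_ge0; [apply: mulr_ge0|]|]; lra.
have P1 : (k + 4) * (k + 3) * (k + 2) * (k + 1) <= (k + 4) ^+ 4.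
  have -> : (k + 4) ^+ 4 = (k + 4) * (k + 4) * (k + 4) * (k + 4) by ring.
  move: P0; set a := k + 4; set b := k + 3; set c := k + 2; set d := k + 1.
  have a0 : 0 <= a by rewrite /a; lra.
  have b0 : 0 <= b by rewrite /b; lra.
  have c0 : 0 <= c by rewrite /c; lra.
  have d0 : 0 <= d by rewrite /d; lra.
  have ba : b <= a by rewrite /a /b; lra.
  have ca : c <= a by rewrite /a /c; lra.
  have da : d <= a by rewrite /a /d; lra.
  move=> _; apply: ler_pM => //; first by rewrite !mulr_ge0.
  by apply: ler_pM => //; [rewrite mulr_ge0|apply: ler_pM].
move: P0 P1; set P := _ * (k + 1); set Q := (k + 4) ^+ 4 => P0 P1.
have h1 := ler_pM v0 P0 v1 P1.
have Q0 := le_trans P0 P1.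
have h2 : Q * 37 <= Q * U by rewrite ler_wpM2l.
apply: ler_pM; [exact: A0| |exact: AB|].
  by apply: mulr_ge0; [exact: mulr_ge0|exact: ler0n].
by move: h1 h2 Q0; clear; lra.
Qed.

Lemma natr_fact_add4 (n : nat) : (n.+4`!)%:R =
  (n%:R + 4) * (n%:R + 3) * (n%:R + 2) * (n%:R + 1) * (n`!)%:R :> R.
Proof.
have -> : (n.+4`! = (n + 4) * (n + 3) * (n + 2) * (n + 1) * n`!)%N.
  by rewrite !factS addn4 addn3 addn2 addn1 !mulnA.
by rewrite !natrM !natrD.
Qed.

(** An explicit weak form of Stirling's k! ~ k^k e^{-k}: e^4 is lowered to 26.58, and the gap pays
    for the polynomial factor. *)
Lemma fact_bound (M : nat) : (23 <= M)%N ->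
  6 * (4 * M)%:R ^+ 5 * ((4 * M)`!)%:R * 2658 ^+ M <=
  (64 * (62 * 118))%:R * 100 ^+ M * (4 * M)%:R ^+ (4 * M) :> R.
Proof.
move=> hM; rewrite -(subnKC hM); elim: (M - 23)%N => [|j IH] {M hM}.
  by rewrite addn0; exact: (fact_bound_cast fact_bound_base).
rewrite addnS; move: (23 + j)%N (leq_addr j 23) IH => M M23n IH.
have M23 : (23 : R) <= M%:R by rewrite ler_nat.
have M0 : 0 < M%:R :> R by lra.
set u : R := 1 + M%:R^-1.
have u1 : 1 <= u by rewrite lerDl invr_ge0.
have u2 : u <= 24 / 23.
  have : M%:R^-1 <= 23^-1 :> R by rewrite lef_pV2 ?posrE.
  rewrite /u; lra.
have Mu : M.+1%:R = M%:R * u by rewrite /u mulrDr mulr1 mulfV ?gt_eqF // natr1.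
pose k : R := (4 * M)%:R.
have kE : k = 4 * M%:R by rewrite /k natrM.
have k4 : (4 * M.+1)%:R = k + 4 :> R by rewrite kE natrM -(natr1 M); ring.
have ku : k + 4 = k * u by rewrite -k4 natrM Mu kE mulrA.
have k0 : 92 <= k by lra.
have g : 247 / 100 <= u ^+ M.
  apply: le_trans (pow_one_plus_ge M _); last by rewrite invr_ge0 ltW.
  have -> : 1 + M%:R * M%:R^-1 + M%:R * (M%:R - 1) / 2 * M%:R^-1 ^+ 2 = 5 / 2 - M%:R^-1 / 2 :> R.
    by field; rewrite gt_eqF.
  have : M%:R^-1 <= 23^-1 :> R by rewrite lef_pV2 ?posrE.
  lra.
have g4 : 37 <= (u ^+ M) ^+ 4.
  have -> : (u ^+ M) ^+ 4 = ((u ^+ M) ^+ 2) ^+ 2 by ring.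
  have a : 61 / 10 <= (u ^+ M) ^+ 2 by rewrite expr2; apply: le_trans (ler_pM _ _ g g); lra.
  by rewrite expr2; apply: le_trans (ler_pM _ _ a a); lra.
have u5 : u ^+ 5 <= 5 / 4.
  have b1 : u ^+ 5 <= (24 / 23) ^+ 5 by rewrite lerXn2r ?nnegrE ?divr_ge0 //; lra.
  by apply: le_trans b1 _; rewrite !exprS expr0; lra.
rewrite k4.
have fE : ((4 * M.+1)`!)%:R = (k + 4) * (k + 3) * (k + 2) * (k + 1) * ((4 * M)`!)%:R :> R.
  by rewrite mulnS addnC addn4 natr_fact_add4.
have pE : (k + 4) ^+ (4 * M.+1) = (k + 4) ^+ 4 * (k ^+ (4 * M) * (u ^+ M) ^+ 4).
  rewrite mulnS exprD; congr (_ * _).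
  by rewrite ku exprMn -exprM (mulnC M).
rewrite fE pE {1}ku [(k * u) ^+ 5]exprMn (exprS _ M) (exprS 100 M).
set D := (64 * (62 * 118))%:R in IH *; set F := ((4 * M)`!)%:R in IH *.
set S := 2658 ^+ M in IH *; set H := 100 ^+ M in IH *.
rewrite -/k in IH; set K5 := k ^+ 5 in IH *; set KM := k ^+ (4 * M) in IH *.
set U := (u ^+ M) ^+ 4 in g4 *.
have -> : 6 * (K5 * u ^+ 5) * ((k + 4) * (k + 3) * (k + 2) * (k + 1) * F) * (2658 * S) =
   (6 * K5 * F * S) * (u ^+ 5 * ((k + 4) * (k + 3) * (k + 2) * (k + 1)) * 2658) by ring.
have -> : D * (100 * H) * ((k + 4) ^+ 4 * (KM * U)) =
   (D * H * KM) * ((k + 4) ^+ 4 * (U * 100)) by ring.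
apply: (fact_bound_step _ _ u5 g4 _ IH).
- exact: le_trans k0.
- exact: exprn_ge0 (le_trans ler01 u1).
apply: mulr_ge0; last by apply: exprn_ge0; exact: ler0n.
apply: mulr_ge0; last exact: ler0n.
apply: mulr_ge0; first exact: ler0n.
by apply: exprn_ge0; exact: ler0n.
Qed.

End Numerics.

(** * The explicit threshold *)

(* 9903/2000 lies just above 7316 / (2 pi)^4 (with pi >= 3.1) and just below
   the square root of 2658/100 * 250/271. *)
Lemma rational_square_bound (R : realType) (s : R) : 0 <= s ->
  9903 / 2000 * (9903 / 2000) * s <= 2658 / 100 * (250 / 271) * s.
Proof. lra. Qed.

(** The margin 6 of [fact_bound] covers all the constants: 1.22 bounds [qr (- Y^-1)], 80/19 is from
    [coef_compare], 9/10 from Bernoulli, and 1.22 * 80/19 < 5.4. *)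
Lemma rational_factor_lt (R : realType) (x y : R) : 6 * x <= y -> 0 < y ->
  122 / 100 * (80 / 19) * x < 9 / 10 * y.
Proof. lra. Qed.

Lemma threshold_constant (R : realType) : 7316 = 62 * 118 :> R.
Proof. by rewrite -natrM. Qed.

Lemma threshold_constant_gt0 (R : realType) : 0 < 7316 :> R.
Proof. rewrite threshold_constant; lra. Qed.

Lemma index_split m : (4 * m + 3 = 2 * m.+1 + (2 * m + 1))%N.
Proof. lia. Qed.

(** In use, [P] is (kL)^k, common to Y^k = P/Q and X^p = P K/S, with Q = (2 pi)^k, K = k^k, S =
    7316^p; [A] is c^{k/4} and [W] is 26.58^{k/4}. *)
Lemma cancel_common_power (R : realType) (c F X A P K Q S W : R) :
  0 < A -> 0 < P -> 0 < Q -> 0 < S -> 0 <= c * F * X ->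
  c * F * X * W < 9 / 10 * K -> S <= W * (A * Q) ->
  c * F * (P / Q) * X < 9 / 10 * A * (P * K / S).
Proof.
move=> A0 P0 Q0 S0 cFX h SW.
have -> : c * F * (P / Q) * X = P * (c * F * X / Q) by ring.
have -> : 9 / 10 * A * (P * K / S) = P * (9 / 10 * K * A / S) by ring.
rewrite ltr_pM2l // ltr_pdivrMr // [ltRHS]mulrAC ltr_pdivlMr //.
apply: le_lt_trans (ler_wpM2l cFX SW) _.
have -> : c * F * X * (W * (A * Q)) = (c * F * X * W) * (A * Q) by ring.
have -> : 9 / 10 * K * A * Q = 9 / 10 * K * (A * Q) by ring.
by rewrite ltr_pM2r // mulr_gt0.
Qed.

(** * The analytic conditions on Y and T, and dominance of the main term *)

Section Conditions.
Variables (R : realType) (m : nat).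
Hypothesis m_ge : (22 <= m)%N.
Let p := (2 * m.+1)%N.
Variables (k L Y T : R).
Hypotheses (kE : k = (4 * m.+1)%:R) (LE : L = ln k + ln (ln k)).
Hypotheses (YE : Y = k * L / (2 * pi)) (TE : T = k ^+ 2 * L ^+ 2).

Let k92 : 92 <= k.
Proof. rewrite kE ler_nat; lia. Qed.

Let k_double : k = 2 * p%:R.
Proof. by rewrite kE -natrM /p mulnA. Qed.

Let pi3 : 3 <= pi :> R.
Proof. have := pi_ge31 R; lra. Qed.

Let L_bounds : [/\ 4 <= L, L <= k / 8 & expR L = k * ln k].
Proof.
have hk := k92; have hpi := pi3.
have /andP[l4 lk] := ln_bounds k92.
have ll0 : 0 <= ln (ln k) by apply: ln_ge0; lra.
have ll1 : ln (ln k) <= ln k by apply: ltW; apply: ln_sublinear; lra.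
split; rewrite LE; try lra.
rewrite expRD !lnK ?posrE //; lra.
Qed.

Let lnk_le : ln k <= L.
Proof.
have hk := k92; have hpi := pi3.
have /andP[l4 _] := ln_bounds k92; rewrite LE lerDl; apply: ln_ge0; lra.
Qed.

Lemma Y_ge : 46 <= Y.
Proof.
have hk := k92; have hpi := pi3.
have [L4 _ _] := L_bounds; have p4 := pi_le4 R.
rewrite YE ler_pdivlMr; last by rewrite mulr_gt0 ?pi_gt0.
have : 92 * 4 <= k * L by apply: ler_pM.
lra.
Qed.

Let Y_le : Y <= k * L / 6.
Proof.
have hk := k92; have hpi := pi3.
have [L4 _ _] := L_bounds.
rewrite YE ler_pM2l; last by apply: mulr_gt0; lra.
rewrite lef_pV2 ?posrE; lra.
Qed.

Let twopiY : 2 * pi * Y = k * L.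
Proof. by rewrite YE mulrCA mulfV ?mulr1 // gt_eqF // mulr_gt0 ?pi_gt0. Qed.

Let qr_small : qr (- Y^-1) <= 122 / 100.
Proof.
have hk := k92; have hpi := pi3.
have Y0 : 0 < Y by have := Y_ge; lra.
have x_le : 2 * pi / Y <= 8 / 46.
  rewrite ler_pdivrMr //; have := pi_le4 R; have := Y_ge; lra.
have h : 1 - 2 * pi / Y <= expR (- (2 * pi / Y)) by exact: expR_ge1Dx.
have -> : qr (- Y^-1) = (expR (- (2 * pi / Y)))^-1.
  by rewrite -expRN /qr; congr expR; rewrite mulrN.
rewrite -div1r ler_pdivrMr ?expR_gt0 //; lra.
Qed.

(** Since e^{2 pi Y} = (e^L)^k and e^L = k log k >= 3Y, the product is at most 3^{-k} times
    [qr (- Y^-1)]. *)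
Lemma Y_half : Y ^+ (4 * m.+1) * qr (Y - Y^-1) <= 2^-1.
Proof.
have hk := k92; have hpi := pi3.
have [L4 Lk eL] := L_bounds; have /andP[l4 lk] := ln_bounds k92.
have Y0 : 0 <= Y by have := Y_ge; lra.
have Y3 : Y <= expR L / 3.
  have ll1 : ln (ln k) <= ln k by apply: ltW; apply: ln_sublinear; lra.
  rewrite eL; apply: le_trans Y_le _.
  have : k * L <= k * (2 * ln k) by rewrite ler_wpM2l //; rewrite ?LE; lra.
  lra.
have Yk : Y ^+ (4 * m.+1) <= expR (k * L) * 3^-1 ^+ (4 * m.+1).
  have -> : expR (k * L) = expR L ^+ (4 * m.+1) by rewrite kE expRM_natl.
  by rewrite -exprMn lerXn2r ?nnegrE ?mulr_ge0 ?expR_ge0 ?invr_ge0.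
have q1 : qr (Y - Y^-1) = (expR (k * L))^-1 * qr (- Y^-1).
  by rewrite qrD -expRN /qr twopiY.
rewrite q1 mulrA.
have e0 : 0 < expR (k * L) by exact: expR_gt0.
apply: (@le_trans _ _ (3^-1 ^+ (4 * m.+1) * (122 / 100))).
  apply: ler_pM; [|exact: qr_ge0| |exact: qr_small].
    by apply: mulr_ge0; [exact: exprn_ge0|rewrite invr_ge0 ltW].
  by rewrite ler_pdivrMr // mulrC.
have : 3^-1 ^+ (4 * m.+1) <= 3^-1 ^+ 1 :> R.
  by rewrite ler_wiXn2l ?invr_ge0 //; lra.
rewrite expr1; lra.
Qed.

(** On the scale e^{kL}: the powers cost an exponent 3/2, the geometric series 1, and the cut-off
    gains pi^2 >= 9, leaving -13/2. *)
Lemma tail_factor_le : tail_factor p Y T <= 60^-1.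
Proof.
have hk := k92; have hpi := pi3.
have [L4 Lk eL] := L_bounds; have /andP[l4 lk] := ln_bounds k92.
have Yg := Y_ge; have Yl := Y_le; have Y0 : 0 < Y by lra.
have kL : 92 * 4 <= k * L by apply: ler_pM.
have pE := k_double.
have expk : expR (ln k) = k by rewrite lnK // posrE; lra.
have k0 : 0 <= k by lra.
have F1 : p%:R ^+ p * expR (- p%:R) * (Y / pi) ^+ p <= expR (3 / 2 * (k * L)).
  have a1 : p%:R * (Y / pi) <= k ^+ 3.
    have a : Y / pi <= Y / 3 by rewrite ler_wpM2l ?(ltW Y0) // lef_pV2 ?posrE; lra.
    have b : k * L <= k * (k / 8) by rewrite ler_wpM2l.
    have c : Y / pi <= k ^+ 2 by rewrite expr2; lra.
    have -> : k ^+ 3 = k * k ^+ 2 by ring.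
    apply: ler_pM => //; first by apply: divr_ge0; lra.
    lra.
  have a0 : 0 <= p%:R * (Y / pi) by apply: mulr_ge0 => //; apply: divr_ge0; lra.
  have a2 : (p%:R * (Y / pi)) ^+ p <= expR (3 / 2 * (k * L)).
    apply: (@le_trans _ _ ((k ^+ 3) ^+ p)).
      by apply: lerXn2r => //; rewrite nnegrE ?exprn_ge0 //; lra.
    rewrite -{1}expk -expRM_natl -expRM_natl ler_expR pE.
    have : ln (2 * p%:R) * (2 * p%:R) <= L * (2 * p%:R) :> R.
      by rewrite -pE; apply: ler_wpM2r; [exact: k0|exact: lnk_le].
    lra.
  apply: le_trans a2; rewrite mulrAC -exprMn; apply: ler_piMr; first exact: exprn_ge0.
  by rewrite expR_le1 oppr_le0.
have F2 : expR (- (pi * T / (2 * Y))) <= expR (- (9 * (k * L))).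
  rewrite ler_expR lerN2.
  have -> : pi * T / (2 * Y) = pi ^+ 2 * (k * L).
    have -> : T = 2 * pi * Y * (k * L) by rewrite twopiY TE; ring.
    field; exact: lt0r_neq0.
  rewrite ler_wpM2r //; first by lra.
  have : 3 * 3 <= pi * pi :> R by apply: ler_pM.
  by rewrite expr2; lra.
have F3 : (1 - expR (- (pi / (2 * Y))))^-1 <= expR (k * L).
  set x := pi / (2 * Y).
  have x0 : 0 < x by rewrite divr_gt0 ?pi_gt0 ?mulr_gt0.
  have h : expR (- x) * (1 + x) <= 1.
    rewrite expRN mulrC ler_pdivrMr ?expR_gt0 // mul1r; exact: expR_ge1Dx.
  have e1 : expR (- x) < 1 by rewrite expR_lt1 oppr_lt0.
  apply: (@le_trans _ _ (1 + x^-1)).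
    rewrite -div1r ler_pdivrMr ?subr_gt0 //.
    have xi : x^-1 * x = 1 by rewrite mulVf // gt_eqF.
    have -> : (1 + x^-1) * (1 - expR (- x)) =
       1 + x^-1 * (1 - expR (- x) * (1 + x)) + (x^-1 * x - 1) * expR (- x) by ring.
    rewrite xi subrr mul0r addr0 lerDl mulr_ge0 ?invr_ge0 ?(ltW x0) // subr_ge0.
    exact: h.
  have : x^-1 <= Y.
    rewrite /x invf_div ler_pdivrMr ?pi_gt0 // mulrC ler_wpM2l ?(ltW Y0) //.
    by have := pi3; lra.
  have := expR_ge1Dx (k * L); lra.
have q0 := qr_ge0 (- Y^-1).
have D0 : 0 <= p%:R ^+ p * expR (- p%:R) * (Y / pi) ^+ p.
  apply: mulr_ge0; first by apply: mulr_ge0; [exact: exprn_ge0|exact: expR_ge0].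
  by apply: exprn_ge0; apply: divr_ge0; [exact: ltW|exact: pi_ge0].
have G1 := ler_pM q0 D0 qr_small F1.
have G2 := ler_pM (mulr_ge0 q0 D0) (expR_ge0 _) G1 F2.
have i0 : 0 <= (1 - expR (- (pi / (2 * Y))))^-1.
  by rewrite invr_ge0 subr_ge0 expR_le1 oppr_le0 divr_ge0 ?pi_ge0 ?mulr_ge0 ?(ltW Y0).
have G3 := ler_pM (mulr_ge0 (mulr_ge0 q0 D0) (expR_ge0 _)) i0 G2 F3.
rewrite /tail_factor; apply: le_trans G3 _.
rewrite -mulrA -expRD -mulrA -expRD.
have -> : 3 / 2 * (k * L) + (- (9 * (k * L)) + k * L) = - (13 / 2 * (k * L)) by field.
rewrite expRN ler_pdivrMr ?expR_gt0 //.
have := expR_ge1Dx (13 / 2 * (k * L)); lra.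
Qed.

Lemma bernoulli_le (u : R) j : 0 <= u -> u <= 1 -> 1 - j%:R * u <= (1 - u) ^+ j.
Proof.
move=> u0 u1; elim: j => [|j IH]; first by rewrite expr0; lra.
have v0 : 0 <= 1 - u by lra.
rewrite exprS; apply: le_trans (ler_wpM2l v0 IH).
rewrite -(natr1 j).
have -> : (1 - u) * (1 - j%:R * u) = 1 - (j%:R + 1) * u + j%:R * (u * u) by ring.
by rewrite lerDl !mulr_ge0.
Qed.

Let X := k ^+ 4 * L ^+ 2 / 7316.

(** The power m+1 of the single inequality 7316^2 <= 26.58 c (2 pi)^4, since p = 2(m+1). *)
Lemma threshold_pow_le : 7316 ^+ p <=
  (2658 / 100) ^+ m.+1 * (eis_base R ^+ m.+1 * (2 * pi) ^+ (4 * m.+1)).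
Proof.
have s_ge : 1477 + 3 / 5 <= (2 * pi) ^+ 4 :> R.
  have a1 : 31 / 5 <= 2 * pi :> R by have := pi_ge31 R; lra.
  have a2 : 38 + 2 / 5 + 1 / 25 <= (2 * pi) ^+ 2 :> R.
    by rewrite expr2; apply: le_trans (ler_pM _ _ a1 a1); lra.
  have -> : (2 * pi) ^+ 4 = (2 * pi) ^+ 2 * (2 * pi) ^+ 2 :> R by ring.
  by apply: le_trans (ler_pM _ _ a2 a2); lra.
move: s_ge; rewrite /eis_base (exprM (2 * pi)); set s := (2 * pi) ^+ 4 => s_ge.
rewrite /p exprM -!exprMn; apply: lerXn2r; rewrite ?nnegrE.
- exact: sqr_ge0.
- by apply: mulr_ge0; [lra|apply: mulr_ge0; [apply: mulr_ge0|]]; lra.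
rewrite threshold_constant.
have h1 : 62 * 118 <= 9903 / 2000 * s by lra.
have h0 : (0 : R) <= 62 * 118 by lra.
rewrite expr2; apply: le_trans (ler_pM h0 h0 h1 h1) _.
have ss : 0 <= s * s by apply: mulr_ge0; lra.
have -> : 9903 / 2000 * s * (9903 / 2000 * s) = 9903 / 2000 * (9903 / 2000) * (s * s) by ring.
have -> : 2658 / 100 * (s * (250 / 271) * s) = 2658 / 100 * (250 / 271) * (s * s) by ring.
exact: rational_square_bound.
Qed.

(** The lower bound makes k^2/n small, as Bernoulli's inequality needs; the upper one uses L <= k/8
    to make [X] polynomial in [k]. *)
Lemma X_bounds : [/\ 0 < X, k ^+ 2 * 18 <= X & X * (64 * 7316) <= k ^+ 6].
Proof.
have hk := k92; have [L4 Lk _] := L_bounds.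
have k0 : 0 < k by lra.
have L0 : 0 < L by lra.
have c0 := threshold_constant_gt0 R.
have kk0 : 0 <= k ^+ 2 by exact: sqr_ge0.
split.
- by apply: divr_gt0; [apply: mulr_gt0; apply: exprn_gt0|exact: c0].
- rewrite /X (ler_pdivlMr _ _ c0).
  have a : 92 * 92 <= k * k by apply: ler_pM.
  have b : 4 * 4 <= L * L by apply: ler_pM.
  have c : 92 * 92 * (4 * 4) <= (k * k) * (L * L) by apply: ler_pM => //; lra.
  have -> : k ^+ 4 * L ^+ 2 = k ^+ 2 * ((k * k) * (L * L)) by ring.
  rewrite -[X in X <= _]mulrA; apply: (ler_wpM2l kk0); apply: le_trans c.
  rewrite threshold_constant.
  lra.
have -> : X * (64 * 7316) = k ^+ 4 * (64 * L ^+ 2).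
  rewrite /X; move: (7316 : R) c0 => c c0.
  by field; rewrite gt_eqF.
have -> : k ^+ 6 = k ^+ 4 * (k * k) by ring.
rewrite ler_wpM2l ?exprn_ge0 ?(ltW k0) //.
have : L * L <= k / 8 * (k / 8) by apply: ler_pM => //; exact: ltW.
rewrite expr2; lra.
Qed.

(** The k^6 that bounds [X] supplies the missing k of k! = k (k-1)! and leaves the k^5 of
    [fact_bound]. *)
Lemma factorial_vs_power :
  (122 / 100 * (80 / 19)) * ((4 * m + 3)`!)%:R * X * (2658 / 100) ^+ m.+1 <
  9 / 10 * k ^+ (4 * m.+1).
Proof.
have hk := k92; have [X0 _ X_hi] := X_bounds.
have k0 : 0 < k by lra.
have M23 : (23 <= m.+1)%N by [].
have h := fact_bound R M23; rewrite -kE in h.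
have jE : ((4 * m.+1)`!)%:R = k * ((4 * m + 3)`!)%:R :> R.
  have e : (4 * m.+1 = (4 * m + 3).+1)%N by rewrite mulnS addnC -addnS.
  by rewrite {1}e factS natrM -e -kE.
have cE : (64 * (62 * 118))%:R = 64 * 7316 :> R.
  by rewrite threshold_constant -!natrM.
rewrite jE cE in h; move: h X_hi.
have k5 : 0 < k ^+ 5 by exact: exprn_gt0.
have F0 : 0 <= ((4 * m + 3)`!)%:R :> R by exact: ler0n.
have K0 : 0 < k ^+ (4 * m.+1) by exact: exprn_gt0.
have H0 : 0 < 100 ^+ m.+1 :> R by exact: exprn_gt0.
have S0 : 0 <= 2658 ^+ m.+1 :> R by apply: exprn_ge0; exact: ler0n.
have c0 : 0 < 64 * 7316 :> R by apply: mulr_gt0; [lra|exact: threshold_constant_gt0].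
rewrite expr_div_n.
move: F0 K0 H0 S0 c0; set F := (_`!)%:R; set K := k ^+ (4 * m.+1).
set H := 100 ^+ _; set S := 2658 ^+ _; set c := 64 * 7316.
move=> F0 K0 H0 S0 c0 h X_hi.
have h2 : X * c * F * S <= k ^+ 6 * F * S by rewrite ler_wpM2r // ler_wpM2r.
have h3 : 6 * (X * c * F * S) <= c * H * K.
  apply: le_trans h; have -> : 6 * k ^+ 5 * (k * F) * S = 6 * (k ^+ 6 * F * S) by ring.
  by rewrite ler_wpM2l.
have h4 : 6 * (X * F * S) <= H * K.
  rewrite -(ler_pM2l c0) [leRHS]mulrA; apply: le_trans h3; rewrite le_eqVlt; apply/orP; left.
  by apply/eqP; ring.
rewrite [X in X < _]mulrA ltr_pdivrMr //.
have HK : 0 < H * K by exact: mulr_gt0.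
have -> : 122 / 100 * (80 / 19) * F * X * S = 122 / 100 * (80 / 19) * (X * F * S) by ring.
have -> : 9 / 10 * K * H = 9 / 10 * (H * K) by ring.
exact: rational_factor_lt.
Qed.

Lemma main_term_dominates n : X <= n%:R ->
  (0 < n)%N /\
  qr (- Y^-1) * (80 / 19 * Y ^+ (4 * m.+1)) * n%:R ^+ p <
  eis_base R ^+ m.+1 * 'C(n + 2 * m + 1, 4 * m + 3)%:R.
Proof.
move=> Xn; have hk := k92; have [L4 Lk eL] := L_bounds; have [X0 X_lo _] := X_bounds.
have k0 : 0 < k by lra.
have L0 : 0 < L by lra.
have n0 : (0 : R) < n%:R by exact: lt_le_trans Xn.
have c0 : 0 <= 122 / 100 * (80 / 19) :> R by lra.
have c1 : 0 <= 80 / 19 :> R by lra.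
have kp := k_double.
have p0 : (0 : R) <= p%:R by [].
have kX : k ^+ 2 * 18 <= n%:R by exact: le_trans Xn.
have pn : p%:R <= n%:R :> R.
  apply: le_trans kX; rewrite expr2.
  have : 92 * k <= k * k by rewrite ler_wpM2r // ltW.
  lra.
split; first by rewrite -(ltr0n R).
have bin_ge := eis_bin_ge R; have /bin_ge {}bin_ge : (2 * m.+1 <= n)%N by rewrite -(ler_nat R).
pose j := (4 * m + 3)%N.
have jk : j%:R <= k by rewrite kE ler_nat /j mulnS addnC leq_add2r.
(* (1 - p/n)^j >= 1 - kp/n, and kp = k^2/2 while n >= 18 k^2, so the loss is at most 1/36. *)
have bern : 9 / 10 * n%:R ^+ j <= (n%:R - p%:R) ^+ j :> R.
  have -> : n%:R - p%:R = n%:R * (1 - p%:R / n%:R) :> R.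
    by rewrite mulrBr mulr1 mulrCA mulfV ?mulr1 // gt_eqF.
  rewrite exprMn mulrC ler_wpM2l ?exprn_ge0 //.
  have u0 : 0 <= p%:R / n%:R :> R by rewrite divr_ge0.
  have u1 : p%:R / n%:R <= 1 :> R by rewrite ler_pdivrMr // mul1r.
  apply: le_trans (bernoulli_le j u0 u1).
  have : j%:R * (p%:R / n%:R) <= 10^-1 :> R.
    rewrite mulrA ler_pdivrMr //.
    have : j%:R * p%:R <= k * p%:R by rewrite ler_wpM2r.
    have : k * p%:R = k ^+ 2 / 2 by rewrite kp; field.
    lra.
  lra.
have fj0 : 0 < ((4 * m + 3)`!)%:R :> R by rewrite ltr0n fact_gt0.
have A0 := eis_base_gt0 R.
have Am : 0 < eis_base R ^+ m.+1 by exact: exprn_gt0.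
have lowC : eis_base R ^+ m.+1 * (9 / 10 * n%:R ^+ j) <=
    eis_base R ^+ m.+1 * 'C(n + 2 * m + 1, 4 * m + 3)%:R * ((4 * m + 3)`!)%:R.
  by rewrite -[leRHS]mulrA ler_pM2l //; exact: le_trans bin_ge.
rewrite -(ltr_pM2r fj0); apply: lt_le_trans lowC.
pose r := (2 * m + 1)%N.
have jE : j = (p + r)%N by exact: index_split.
have Yg := Y_ge; have Y0 : 0 < Y by lra.
have Yk0 : 0 < Y ^+ (4 * m.+1) by exact: exprn_gt0.
have np0 : 0 < n%:R ^+ p :> R by exact: exprn_gt0.
have pr : p = r.+1 by rewrite /p /r mulnS addn1.
have key : (122 / 100 * (80 / 19)) * ((4 * m + 3)`!)%:R * Y ^+ (4 * m.+1) <
    9 / 10 * eis_base R ^+ m.+1 * n%:R ^+ r.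
  have Xr : X ^+ r <= n%:R ^+ r by apply: lerXn2r => //; rewrite nnegrE ltW.
  apply: (@lt_le_trans _ _ (9 / 10 * eis_base R ^+ m.+1 * X ^+ r)); last first.
    by rewrite ler_wpM2l //; apply: mulr_ge0; [lra|exact: ltW].
  (* One more factor [X] completes X^{p-1} to X^p, which shares (kL)^k with Y^k; hence the [X] in
     [factorial_vs_power]. *)
  rewrite -(ltr_pM2r X0) -[X in _ < X]mulrA -exprSr -pr.
  have pk : (4 * m.+1 = 2 * p)%N by rewrite /p mulnA.
  have q0 : 0 < (2 * pi) ^+ (4 * m.+1) :> R by rewrite exprn_gt0 // pi2_gt0.
  have s0 : 0 < 7316 ^+ p :> R by apply: exprn_gt0; exact: threshold_constant_gt0.
  have XpE : X ^+ p = (k * L) ^+ (4 * m.+1) * k ^+ (4 * m.+1) / 7316 ^+ p.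
    rewrite /X expr_div_n; congr (_ / _).
    by rewrite pk !(exprM _ 2 p) -exprMn; congr (_ ^+ p); ring.
  have YkE : Y ^+ (4 * m.+1) = (k * L) ^+ (4 * m.+1) / (2 * pi) ^+ (4 * m.+1).
    by rewrite YE expr_div_n.
  have kL0 : 0 < (k * L) ^+ (4 * m.+1) by rewrite exprn_gt0 // mulr_gt0.
  rewrite XpE YkE; apply: (cancel_common_power Am kL0 q0 s0 _ factorial_vs_power threshold_pow_le).
  by apply: mulr_ge0; [apply: mulr_ge0; [exact: c0|exact: (ltW fj0)]|exact: (ltW X0)].
rewrite jE exprD.
apply: (@le_lt_trans _ _ ((122 / 100 * (80 / 19)) * ((4 * m + 3)`!)%:R * Y ^+ (4 * m.+1) * n%:R ^+ p)).
  have -> : 122 / 100 * (80 / 19) * ((4 * m + 3)`!)%:R * Y ^+ (4 * m.+1) * n%:R ^+ p =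
    122 / 100 * ((80 / 19) * ((4 * m + 3)`!)%:R * Y ^+ (4 * m.+1) * n%:R ^+ p) by ring.
  have -> : qr (- Y^-1) * (80 / 19 * Y ^+ (4 * m.+1)) * n%:R ^+ p * ((4 * m + 3)`!)%:R =
    qr (- Y^-1) * ((80 / 19) * ((4 * m + 3)`!)%:R * Y ^+ (4 * m.+1) * n%:R ^+ p) by ring.
  apply: ler_wpM2r; last exact: qr_small.
  apply: mulr_ge0; last exact: (ltW np0).
  apply: mulr_ge0; last exact: (ltW Yk0).
  by apply: mulr_ge0; [exact: c1|exact: (ltW fj0)].
have -> : eis_base R ^+ m.+1 * (9 / 10 * (n%:R ^+ p * n%:R ^+ r)) =
  9 / 10 * eis_base R ^+ m.+1 * n%:R ^+ r * n%:R ^+ p by ring.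
by rewrite ltr_pM2r.
Qed.

End Conditions.

Theorem theorem9 (R : realType) (k : nat) (f : R[i] -> R[i]) (a : nat -> R[i]) :
  (92 <= k)%N -> (4 %| k)%N ->
  modular_form k f -> has_qexp f a -> a 0%N = 1 ->
  (forall n : nat, (0 < n)%N ->
     n%:R <= (k%:R ^+ 2 * (ln (k%:R : R) + ln (ln (k%:R : R))) ^+ 2) ->
     0 <= a n) ->
  forall n : nat,
    (k%:R ^+ 4 * (ln (k%:R : R) + ln (ln (k%:R : R))) ^+ 2) / 7316 <= n%:R ->
    0 < a n.
Proof.
(* Here [m] is k/4 - 1, so that the power of E_4 has the positive exponent [m.+1]. *)
move=> k92 /dvdnP[[|m] kE]; first by rewrite kE in k92.
rewrite mulnC in kE; subst k.
have m_ge : (22 <= m)%N by move: k92; clear; lia.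
move=> [_ f_mod] fa a0 a_ge0 n n_ge.
set kR := (4 * m.+1)%:R in a_ge0 n_ge.
set L := ln kR + _ in a_ge0 n_ge.
pose Y := kR * L / (2 * pi); pose T := kR ^+ 2 * L ^+ 2.
have [G [e [Ge G_mod e0 e_ge0 e_ge]]] := eisenstein_power R m.
have Y2 : 2 <= Y.
  have := @Y_ge R m m_ge kR L Y erefl erefl erefl; lra.
have tail := @tail_factor_le R m m_ge kR L Y T erefl erefl erefl erefl.
have half := @Y_half R m m_ge kR L Y erefl erefl erefl.
have [n0 dom] := @main_term_dominates R m m_ge kR L Y erefl erefl erefl n n_ge.
have real := coef_real fa f_mod a0 a_ge0 Y2 tail.
have comp := coef_compare fa Ge f_mod G_mod a0 e0 e_ge0 a_ge0 Y2 tail half n0.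
(* The distance from a(n) to e(n) is less than e(n), so a(n) has positive real part. *)
have lt := le_lt_trans comp (lt_le_trans dom (e_ge n)).
have := norm_Re_le (a n - (e n)%:C); rewrite ler_norml => /andP[h _].
have pos : 0 < complex.Re (a n) by move: h lt; rewrite ReB /=; lra.
(* Strict positivity in [R[i]] also demands a zero imaginary part, which [coef_real] provides. *)
by move: (real n) pos; case: (a n) => x y /= -> x0; rewrite ltcE /= eqxx.
Qed.
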